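(* Let $\Phi_{KZ}=\Phi_{KZ}(\gamma_1,\dots,\gamma_N)$ be any solution, of the multiple-contour-integral form $$\Phi_{KZ}=\oint_{\Delta_1}dv_1\cdots\oint_{\Delta_M}dv_M\;W\,\varphi,\qquad \varphi=e(v_1)\cdots e(v_M)|p\rangle,$$ $$W=\prod_{1\le k<j\le N}(\gamma_j-\gamma_k)^{-i\hbar s_js_k/2}\prod_{1\le s<r\le M}(v_r-v_s)^{-2i\hbar}\prod_{r=1}^M\prod_{j=1}^N(\gamma_j-v_r)^{-i\hbar s_j},$$ of the Knizhnik–Zamolodchikov equations $$\frac{\partial\Phi_{KZ}}{\partial\gamma_j}=-i\hbar\sum_{k\neq j}\frac{\Omega_{jk}}{\gamma_j-\gamma_k}\,\Phi_{KZ}\qquad(j=1,\dots,N).$$ Put $s_\infty:=2M+\sum_{j=1}^Ns_j$, and let $\gamma_j=\gamma(w_j;\xi,\bar\xi)$. Then the function $$\Phi(\xi,\bar\xi)=(\xi-\bar\xi)^{-\frac14\hbar^2 s_\infty(s_\infty-2)}\prod_{j=1}^N\Big(\frac{\partial\gamma_j}{\partial w_j}\Big)^{-\frac14\hbar^2 s_j(s_j-2)}\Phi_{KZ}\big(\{\gamma_j(\xi,\bar\xi)\}\big)$$ with values in $\bigotimes_{j=1}^N\mathcal{H}_j$ satisfies the Wheeler–DeWitt equations $$-i\hbar\frac{\partial\Phi}{\partial\xi}=H^{(\xi)}\Phi,\qquad -i\hbar\frac{\partial\Phi}{\partial\bar\xi}=H^{(\bar\xi)}\Phi .$$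
   Context: $\hbar>0$ is a constant. Coordinates: $\xi=x+i\rho$, $\bar\xi=x-i\rho$, $\rho>0$. For pairwise distinct constants $w_j\in\mathbb{R}$, $\gamma_j=\gamma(w_j;\xi,\bar\xi)$ with $$\gamma(w;\xi,\bar\xi)=\frac{2}{\xi-\bar\xi}\Big\{w-\frac{\xi+\bar\xi}{2}+\sqrt{(w-\xi)(w-\bar\xi)}\Big\},$$ satisfying $\gamma_\xi=\frac{\gamma}{\xi-\bar\xi}\frac{1+\gamma}{1-\gamma}$, $\gamma_{\bar\xi}=\frac{\gamma}{\bar\xi-\xi}\frac{1-\gamma}{1+\gamma}$. Local branches of all powers are fixed. For each $j=1,\dots,N$, $\mathcal{H}_j$ is a unitary irreducible lowest weight representation with generators $h_j,e_j,f_j$, $[h_j,e_j]=2e_j$, $[h_j,f_j]=-2f_j$, $[e_j,f_j]=h_j$: either a positive discrete series representation of $SU(1,1)$ ($h_j^\dagger=h_j$, $e_j^\dagger=-f_j$; $s_j\ge2$ an integer) or a finite-dimensional representation of $SU(2)$ ($h_j^\dagger=h_j$, $e_j^\dagger=f_j$; $s_j\le0$ an integer), the same group for all $j$. Generators with different $j$ act on different tensor factors of $\bigotimes_j\mathcal{H}_j$ and commute. The vector $|p\rangle$ is the tensor product of the lowest weight vectors: $f_j|p\rangle=0$, $h_j|p\rangle=s_j|p\rangle$ for all $j$. Further $$e(v)=\sum_{j=1}^N\frac{e_j}{v-\gamma_j},\qquad \Omega_{jk}=\tfrac12h_jh_k+f_je_k+e_jf_k\quad(\text{including } j=k),$$ $$H^{(\xi)}=-\frac{\hbar^2}{\xi-\bar\xi}\sum_{j,k=1}^N\frac{\Omega_{jk}}{(1-\gamma_j)(1-\gamma_k)},\qquad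 H^{(\bar\xi)}=\frac{\hbar^2}{\xi-\bar\xi}\sum_{j,k=1}^N\frac{\Omega_{jk}}{(1+\gamma_j)(1+\gamma_k)} .$$ $\Delta$ is a closed cycle in $\mathbb{C}^M$ (a family of $v$-dependent contours $\Delta_1,\dots,\Delta_M$, without boundary, deformed continuously with the $\gamma_j$) having empty intersection with the hyperplanes $v_r=v_s$ ($r\neq s$) and the hypersurfaces $v_r=\gamma_j$, and on which $W$ is single-valued.
   Formalization: The exponents of (ξ−ξ̄) and ∂γ_j/∂w_j are −(iħ/4)s(s−2), not the printed −(ħ²/4)s(s−2), which fails already for N=1, M=0, s=3; the cycle Δ is taken as a twisted chain of C² singular cubes. *)

(* Defs.v *)
From HB Require Import structures.
From mathcomp Require Import all_boot all_order all_algebra.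
From mathcomp Require Import all_classical all_reals all_analysis.
From mathcomp Require Import complex.

Set Implicit Arguments.
Unset Strict Implicit.
Unset Printing Implicit Defensive.
Import Order.TTheory GRing.Theory Num.Theory numFieldNormedType.Exports.
Local Open Scope classical_set_scope.
Local Open Scope ring_scope.
Local Open Scope complex_scope.

(* R[i] carries no topology by default: it gets the one of its norm.          *)
HB.instance Definition _ (R : realType) := NormedModule.copy R[i] R[i]^o.

Definition cexp (R : realType) (z : R[i]) : R[i] :=
  (expR (complex.Re z))%:C * (cos (complex.Im z) +i* sin (complex.Im z)).

(* A local branch of z^a along f is written cexp (a * L x), where L is a      *)
(* branch of log f in the following sense.                                    *)
Definition log_branch (R : realType) (X : topologicalType) (A : set X)
    (f L : X -> R[i]) : Prop :=
  {within A, continuous L} /\ (forall x, A x -> cexp (L x) = f x).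

(* Derivatives along a real variable of functions with values in a complex    *)
(* normed space (mathcomp's derive needs the same scalar field on both sides) *)
Definition is_rderive (R : realType) (V : normedModType R[i]) (f : R -> V)
    (x : R) (l : V) : Prop :=
  (fun h : R => (h%:C)^-1 *: (f (x + h) - f x)) @ 0^' --> l.

Definition rderive (R : realType) (f : R -> R[i]) (x : R) : R[i] :=
  lim ((fun h : R => (h%:C)^-1 * (f (x + h) - f x)) @ 0^').

(* With xi = x + i rho: d/dxi = (d/dx - i d/drho) / 2 and                     *)
(* d/dxibar = (d/dx + i d/drho) / 2.                                          *)
Definition is_dxi (R : realType) (V : normedModType R[i]) (f : R[i] -> V)
    (xi : R[i]) (l : V) : Prop :=
  exists a b : V,
    [/\ is_rderive (fun x : R => f (xi + x%:C)) 0 a,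
        is_rderive (fun y : R => f (xi + 'i * y%:C)) 0 b
      & l = 2%:R^-1 *: (a - 'i *: b)].

Definition is_dxibar (R : realType) (V : normedModType R[i]) (f : R[i] -> V)
    (xi : R[i]) (l : V) : Prop :=
  exists a b : V,
    [/\ is_rderive (fun x : R => f (xi + x%:C)) 0 a,
        is_rderive (fun y : R => f (xi + 'i * y%:C)) 0 b
      & l = 2%:R^-1 *: (a + 'i *: b)].

(* For real w the radicand equals (w - x)^2 + rho^2 > 0, so a local branch of *)
(* the square root is a choice of sign; br is that choice.                    *)
Definition gamma (R : realType) (br : bool) (w : R) (xi : R[i]) : R[i] :=
  2%:R / (xi - xi^*) *
    (w%:C - (xi + xi^*) / 2%:R
     + (-1) ^+ br * sqrtC ((w%:C - xi) * (w%:C - xi^*))).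

Definition dgamma_dw (R : realType) (br : bool) (w : R) (xi : R[i]) : R[i] :=
  rderive (fun w' => gamma br w' xi) w.

Definition gamma_row (R : realType) (N : nat) (br : 'I_N -> bool)
    (w : 'I_N -> R) (xi : R[i]) : 'rV[R[i]]_N :=
  \row_j gamma (br j) (w j) xi.

Inductive real_form : Set := SU11 | SU2.

(* The generators of a discrete series representation are unbounded on the    *)
(* Hilbert space; lwm_space is their natural invariant dense domain, the      *)
(* pre-Hilbert space of finite combinations of weight vectors.                *)
Record lowest_weight_module (R : realType) (F : real_form) (s : int) := {
  lwm_space :> lmodType R[i];
  lwm_dot : {dot lwm_space for Num.conj};
  lwm_h : {linear lwm_space -> lwm_space};
  lwm_e : {linear lwm_space -> lwm_space};
  lwm_f : {linear lwm_space -> lwm_space};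
  lwm_vac : lwm_space;
  lwm_he : forall u, lwm_h (lwm_e u) - lwm_e (lwm_h u) = 2%:R *: lwm_e u;
  lwm_hf : forall u, lwm_h (lwm_f u) - lwm_f (lwm_h u) = - (2%:R *: lwm_f u);
  lwm_ef : forall u, lwm_e (lwm_f u) - lwm_f (lwm_e u) = lwm_h u;
  lwm_h_adj : forall u v, lwm_dot (lwm_h u) v = lwm_dot u (lwm_h v);
  lwm_e_adj : forall u v, lwm_dot (lwm_e u) v =
    match F with
    | SU11 => lwm_dot u (- lwm_f v)
    | SU2 => lwm_dot u (lwm_f v)
    end;
  lwm_irreducible : forall P : set lwm_space,
    P 0 -> (forall a u v, P u -> P v -> P (a *: u + v)) ->
    (forall u, P u -> [/\ P (lwm_h u), P (lwm_e u) & P (lwm_f u)]) ->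
    P = [set 0] \/ P = setT;
  lwm_vac_neq0 : lwm_vac != 0;
  lwm_f_vac : lwm_f lwm_vac = 0;
  lwm_h_vac : lwm_h lwm_vac = s%:~R *: lwm_vac;
  lwm_range :
    match F with
    | SU11 => (2 <= s)%R : Prop
    | SU2 => (s <= 0)%R /\
        exists n (b : 'I_n -> lwm_space), forall u,
          exists c : 'I_n -> R[i], u = \sum_(k < n) c k *: b k
    end
}.

(* A space spanned by pure tensors, with a multilinear pure tensor map and    *)
(* the product inner product: this determines the (pre-Hilbert) tensor        *)
(* product up to unique isometry.  tp_lift j A is A acting on the j-th factor.*)
Record tensor_product (R : realType) (N : nat) (H : 'I_N -> lmodType R[i])
    (dH : forall j, {dot H j for Num.conj}) := {
  tp_space :> normedModType R[i];
  tp_dot : {dot tp_space for Num.conj};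
  tp_pure : (forall j, H j) -> tp_space;
  tp_lift : forall j, {linear H j -> H j} -> {linear tp_space -> tp_space};
  tp_norm : forall u, `|u| ^+ 2 = tp_dot u u;
  tp_multilinear : forall (x : forall j, H j) (j : 'I_N) (a : R[i]) (u v : H j),
    tp_pure (dfwith x j (a *: u + v)) =
      a *: tp_pure (dfwith x j u) + tp_pure (dfwith x j v);
  tp_dot_pure : forall x y,
    tp_dot (tp_pure x) (tp_pure y) = \prod_(j < N) dH j (x j) (y j);
  tp_span : forall u, exists n (c : 'I_n -> R[i]) (x : 'I_n -> forall j, H j),
    u = \sum_(k < n) c k *: tp_pure (x k);
  tp_lift_pure : forall j (A : {linear H j -> H j}) x,
    tp_lift A (tp_pure x) = tp_pure (dfwith x j (A (x j)))
}.

Definition tensor_rep (R : realType) (N : nat) (F : real_form)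
    (s : 'I_N -> int) (rep : forall j, lowest_weight_module R F (s j)) :=
  tensor_product (fun j => lwm_dot (rep j)).

Definition op_h (R : realType) (N : nat) (F : real_form) (s : 'I_N -> int)
    (rep : forall j, lowest_weight_module R F (s j)) (T : tensor_rep rep)
    (j : 'I_N) (u : T) : T := tp_lift T (lwm_h (rep j)) u.

Definition op_e (R : realType) (N : nat) (F : real_form) (s : 'I_N -> int)
    (rep : forall j, lowest_weight_module R F (s j)) (T : tensor_rep rep)
    (j : 'I_N) (u : T) : T := tp_lift T (lwm_e (rep j)) u.

Definition op_f (R : realType) (N : nat) (F : real_form) (s : 'I_N -> int)
    (rep : forall j, lowest_weight_module R F (s j)) (T : tensor_rep rep)
    (j : 'I_N) (u : T) : T := tp_lift T (lwm_f (rep j)) u.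

Definition vacuum (R : realType) (N : nat) (F : real_form) (s : 'I_N -> int)
    (rep : forall j, lowest_weight_module R F (s j)) (T : tensor_rep rep) : T :=
  tp_pure T (fun j => lwm_vac (rep j)).

Definition e_gen (R : realType) (N : nat) (F : real_form) (s : 'I_N -> int)
    (rep : forall j, lowest_weight_module R F (s j)) (T : tensor_rep rep)
    (g : 'rV[R[i]]_N) (v : R[i]) (u : T) : T :=
  \sum_(j < N) (v - g 0 j)^-1 *: op_e j u.

Definition bethe_vector (R : realType) (N M : nat) (F : real_form)
    (s : 'I_N -> int) (rep : forall j, lowest_weight_module R F (s j))
    (T : tensor_rep rep) (g : 'rV[R[i]]_N) (v : 'rV[R[i]]_M) : T :=
  foldr (fun (r : 'I_M) (u : T) => e_gen g (v 0 r) u) (vacuum T) (enum 'I_M).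

Definition Omega (R : realType) (N : nat) (F : real_form) (s : 'I_N -> int)
    (rep : forall j, lowest_weight_module R F (s j)) (T : tensor_rep rep)
    (j k : 'I_N) (u : T) : T :=
  2%:R^-1 *: op_h j (op_h k u) + op_f j (op_e k u) + op_e j (op_f k u).

Definition H_xi (R : realType) (N : nat) (F : real_form) (s : 'I_N -> int)
    (rep : forall j, lowest_weight_module R F (s j)) (T : tensor_rep rep)
    (hbar : R) (g : 'rV[R[i]]_N) (xi : R[i]) (u : T) : T :=
  - (hbar%:C ^+ 2 / (xi - xi^*)) *:
    \sum_(j < N) \sum_(k < N) ((1 - g 0 j) * (1 - g 0 k))^-1 *: Omega j k u.

Definition H_xibar (R : realType) (N : nat) (F : real_form) (s : 'I_N -> int)
    (rep : forall j, lowest_weight_module R F (s j)) (T : tensor_rep rep)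
    (hbar : R) (g : 'rV[R[i]]_N) (xi : R[i]) (u : T) : T :=
  (hbar%:C ^+ 2 / (xi - xi^*)) *:
    \sum_(j < N) \sum_(k < N) ((1 + g 0 j) * (1 + g 0 k))^-1 *: Omega j k u.

(* "Solution" means a (Frechet) complex differentiable function satisfying    *)
(* the equations.                                                             *)
Definition KZ_solution (R : realType) (N : nat) (F : real_form)
    (s : 'I_N -> int) (rep : forall j, lowest_weight_module R F (s j))
    (T : tensor_rep rep) (hbar : R) (G : set 'rV[R[i]]_N)
    (Phi : 'rV[R[i]]_N -> T) : Prop :=
  forall g, G g ->
    differentiable Phi g /\
    forall j : 'I_N, 'D_(delta_mx 0 j) Phi g =
      - ('i * hbar%:C) *:
        \sum_(k < N | k != j) (g 0 j - g 0 k)^-1 *: Omega j k (Phi g).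

Definition unit_cube (R : realType) (M : nat) : set 'rV[R]_M :=
  [set t | forall b, 0 <= t 0 b <= 1].

Definition rpartial (R : realType) (M : nat) (b : 'I_M) (f : 'rV[R]_M -> R[i])
    (t : 'rV[R]_M) : R[i] :=
  rderive (fun h : R => f (t + h *: delta_mx 0 b)) 0.

Fixpoint Ck (R : realType) (M k : nat) (f : 'rV[R]_M -> R[i]) : Prop :=
  continuous f /\
  match k with
  | 0 => True
  | k'.+1 => forall b : 'I_M,
      (forall t, exists l,
         is_rderive (fun h : R => f (t + h *: delta_mx 0 b)) 0 l)
      /\ Ck k' (rpartial b f)
  end.

(* The face of [0,1]^M where the r-th coordinate is frozen to e in {0,1}.     *)
Definition face (R : realType) (M : nat) (r : 'I_M) (e : bool)
    (t : 'rV[R]_M.-1) : 'rV[R]_M :=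
  \row_b (if unlift r b is Some c then t 0 c else e%:R).

Definition integral01 (R : realType) (f : R -> R[i]) : R[i] :=
  (\int[@lebesgue_measure R]_(x in `[0, 1]) complex.Re (f x))%R
  +i* (\int[@lebesgue_measure R]_(x in `[0, 1]) complex.Im (f x))%R.

Fixpoint cube_integral (R : realType) (M : nat) :
    ('rV[R]_M -> R[i]) -> R[i] :=
  match M with
  | 0 => fun f => f 0
  | M'.+1 => fun f => integral01 (fun x : R =>
      cube_integral (fun t : 'rV[R]_M' => f (row_mx (const_mx x : 'rV[R]_1) t)))
  end.

(* A gamma-dependent twisted singular chain in C^M: finitely many singular    *)
(* cubes with integer multiplicities (so that piecewise smooth, v-dependent   *)
(* contours are covered), each carrying branches of log (v_r - v_s), s < r,   *)
(* and log (gamma_j - v_r), which fix the branch of W on it.                  *)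
Record contour_family (R : realType) (N M : nat) := {
  cf_size : nat;
  cf_mult : 'I_cf_size -> int;
  cf_map : 'I_cf_size -> 'rV[R[i]]_N * 'rV[R]_M -> 'rV[R[i]]_M;
  cf_logvv : 'I_cf_size -> 'I_M -> 'I_M -> 'rV[R[i]]_N * 'rV[R]_M -> R[i];
  cf_loggv : 'I_cf_size -> 'I_N -> 'I_M -> 'rV[R[i]]_N * 'rV[R]_M -> R[i]
}.

Definition weight (R : realType) (N M : nat) (hbar : R) (s : 'I_N -> int)
    (Lgg : 'I_N -> 'I_N -> 'rV[R[i]]_N -> R[i]) (D : contour_family R N M)
    (i : 'I_(cf_size D)) (p : 'rV[R[i]]_N * 'rV[R]_M) : R[i] :=
  (\prod_(j < N) \prod_(k < N | (k < j)%N)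
     cexp (- ('i * hbar%:C * (s j)%:~R * (s k)%:~R / 2%:R) * Lgg j k p.1)) *
  (\prod_(r < M) \prod_(q < M | (q < r)%N)
     cexp (- (2%:R * 'i * hbar%:C) * cf_logvv i r q p)) *
  (\prod_(r < M) \prod_(j < N)
     cexp (- ('i * hbar%:C * (s j)%:~R) * cf_loggv i j r p)).

Definition jacobian (R : realType) (N M : nat) (D : contour_family R N M)
    (i : 'I_(cf_size D)) (g : 'rV[R[i]]_N) (t : 'rV[R]_M) : R[i] :=
  \det (\matrix_(r < M, b < M) rpartial b (fun t' => cf_map i (g, t') 0 r) t).

(* Faces are compared together with the branch of W they carry.               *)
Definition same_face (R : realType) (N M : nat) (D : contour_family R N M)
    (W : 'I_(cf_size D) -> 'rV[R[i]]_N * 'rV[R]_M -> R[i]) (g : 'rV[R[i]]_N)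
    (a a' : 'I_(cf_size D) * 'I_M * bool) : Prop :=
  let: (i, r, e) := a in let: (i', r', e') := a' in
  forall t, unit_cube t ->
    cf_map i (g, face r e t) = cf_map i' (g, face r' e' t) /\
    W i (g, face r e t) = W i' (g, face r' e' t).

Definition degenerate_face (R : realType) (N M : nat)
    (D : contour_family R N M) (g : 'rV[R[i]]_N)
    (a : 'I_(cf_size D) * 'I_M * bool) : Prop :=
  let: (i, r, e) := a in
  exists b : 'I_M.-1, forall t t', unit_cube t -> unit_cube t' ->
    (forall c, c != b -> t 0 c = t' 0 c) ->
    cf_map i (g, face r e t) = cf_map i (g, face r e t').

(* The boundary vanishes as a formal sum of faces modulo degenerate ones;     *)
(* since faces carry their branch of W, this says both that the chain is      *)
(* closed and that W is single-valued on it.                                  *)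
Definition twisted_closed (R : realType) (N M : nat) (D : contour_family R N M)
    (W : 'I_(cf_size D) -> 'rV[R[i]]_N * 'rV[R]_M -> R[i])
    (g : 'rV[R[i]]_N) : Prop :=
  forall a, ~ degenerate_face g a ->
    \sum_(a' | `[< same_face W g a a' >])
      (-1) ^+ (a'.1.2 + a'.2) * cf_mult a'.1.1 = 0 :> int.

Record admissible_cycle (R : realType) (N M : nat) (hbar : R)
    (s : 'I_N -> int) (G : set 'rV[R[i]]_N)
    (Lgg : 'I_N -> 'I_N -> 'rV[R[i]]_N -> R[i])
    (D : contour_family R N M) : Prop := {
  ac_continuous : forall i : 'I_(cf_size D), {within G `*` @unit_cube R M, continuous (cf_map i)};
  ac_smooth : forall (i : 'I_(cf_size D)) g r, G g -> Ck 2 (fun t => cf_map i (g, t) 0 r);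
  ac_avoids_vv : forall (i : 'I_(cf_size D)) g t r q, G g -> unit_cube t -> r != q ->
    cf_map i (g, t) 0 r != cf_map i (g, t) 0 q;
  ac_avoids_gv : forall (i : 'I_(cf_size D)) g t r j, G g -> unit_cube t ->
    cf_map i (g, t) 0 r != g 0 j;
  ac_loggg : forall j k : 'I_N, (k < j)%N ->
    log_branch G (fun g => g 0 j - g 0 k) (Lgg j k);
  ac_logvv : forall (i : 'I_(cf_size D)) (r q : 'I_M), (q < r)%N ->
    log_branch (G `*` @unit_cube R M)
      (fun p => cf_map i p 0 r - cf_map i p 0 q) (cf_logvv i r q);
  ac_loggv : forall (i : 'I_(cf_size D)) j r,
    log_branch (G `*` @unit_cube R M)
      (fun p => p.1 0 j - cf_map i p 0 r) (cf_loggv i j r);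
  ac_closed : forall g, G g -> twisted_closed (@weight R N M hbar s Lgg D) g
}.

(* Phi g is the integral of W phi dv_1 ... dv_M over the cycle, as a weak     *)
(* (Pettis) integral.                                                         *)
Definition contour_integral_form (R : realType) (N M : nat) (F : real_form)
    (s : 'I_N -> int) (rep : forall j, lowest_weight_module R F (s j))
    (T : tensor_rep rep) (hbar : R) (G : set 'rV[R[i]]_N)
    (Lgg : 'I_N -> 'I_N -> 'rV[R[i]]_N -> R[i]) (D : contour_family R N M)
    (Phi : 'rV[R[i]]_N -> T) : Prop :=
  forall g, G g -> forall psi : T,
    tp_dot T (Phi g) psi =
    \sum_(i < cf_size D) (cf_mult i)%:~R *
      cube_integral (fun t =>
        weight hbar s Lgg i (g, t) * jacobian i g t
        * tp_dot T (bethe_vector T g (cf_map i (g, t))) psi).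

Definition s_infty (N M : nat) (s : 'I_N -> int) : int :=
  (2 * M)%:Z + \sum_(j < N) s j.

(* The factor is i hbar, not hbar^2: for N = 1, M = 0 the function            *)
(* (xi - xibar)^c (dgamma/dw)^c |p> satisfies the equations with generators   *)
(* H_xi, H_xibar exactly for c = - i hbar s (s - 2) / 4.                      *)
Definition wdw_exponent (R : realType) (hbar : R) (s : int) : R[i] :=
  - ('i * hbar%:C / 4%:R) * (s * (s - 2))%:~R.

Definition wdw_state (R : realType) (N M : nat) (F : real_form)
    (s : 'I_N -> int) (rep : forall j, lowest_weight_module R F (s j))
    (T : tensor_rep rep) (hbar : R) (br : 'I_N -> bool) (w : 'I_N -> R)
    (Lxi : R[i] -> R[i]) (Lgw : 'I_N -> R[i] -> R[i])
    (Phi : 'rV[R[i]]_N -> T) (xi : R[i]) : T :=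
  (cexp (wdw_exponent hbar (s_infty M s) * Lxi xi)
   * \prod_(j < N) cexp (wdw_exponent hbar (s j) * Lgw j xi))
  *: Phi (gamma_row br w xi).

(* Main.v *)
From HB Require Import structures.
Require Import Defs.
From mathcomp Require Import all_boot all_order all_algebra fingroup perm.
From mathcomp Require Import all_classical all_reals all_analysis.
From mathcomp Require Import complex ring lra.
Import Order.TTheory GRing.Theory Num.Theory numFieldNormedType.Exports.
Set Implicit Arguments.
Unset Strict Implicit.
Local Open Scope classical_set_scope.
Local Open Scope ring_scope.
Local Open Scope complex_scope.

(** The phase of the integrand turns the Bethe vectors into twisted total
    derivatives in the integration variables: by Stokes on the twisted cycle
    (the boundary faces cancel in pairs, degenerate ones contribute nothing),
    [Phi_KZ] is annihilated by the total lowering operator and is an eigenvector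
    of the total weight with eigenvalue [s_infty].  Everything is tested against
    vectors [psi], where raising and lowering operators are adjoint up to sign,
    so only scalar integrals occur.  Hence [\sum_j \sum_k Omega j k] acts on
    [Phi_KZ] as the total Casimir, the scalar [s_infty (s_infty - 2) / 2].
    In the variables [a_j = gamma_j] (for [xi]) or [a_j = - gamma_j] (for
    [xibar]) the chain rule and the Knizhnik-Zamolodchikov equations give a
    double sum with coefficient [a_j (1 + a_j) / ((1 - a_j) (a_j - a_k))]; its
    symmetrization in [j], [k] is [((1 - a_j) (1 - a_k))^-1 - 1 / 2], and the
    constant and diagonal terms are compensated by the total Casimir and the
    logarithmic derivatives of the prefactors. *)

(** The integral representation is used at a fixed [g] only, for the two eigenvector relations; all
    variation in [g] enters through [KZ_solution], so nothing is differentiated under the integral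
    sign. The exponents come from one function, F(a) = a (1 + a) / (1 - a) = - a - 2 + 2 / (1 - a).
    The derivative of gamma in xi is F(gamma) / (xi - xibar). The divided difference of F is 2 / ((1
    - a) (1 - b)) - 1, and on the diagonal it becomes F'(a) = 2 / (1 - a)^2 - 1. Differentiating the
    formula for gamma in w shows that F'(gamma) / (xi - xibar) is the logarithmic derivative of
    dgamma/dw. The factors dgamma_j/dw_j therefore supply the diagonal terms missing from the
    Knizhnik-Zamolodchikov sum, and the power of xi - xibar cancels the constant -1 summed over all
    pairs. The analytic obstacle is that the cycle and its logarithms are controlled on the closed
    cube alone, the logarithms being merely continuous: their derivatives have to be recovered,
    partial derivatives on faces compared by one-sided limits, and integrands extended continuously
    beyond the cube. *)

(** * Integrals of continuous real functions over the unit interval *)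

Definition rint01 (R : realType) (f : R -> R) : R :=
  (\int[@lebesgue_measure R]_(x in `[0, 1]) f x)%R.

Lemma is_deriveP (R : realType) (f : R -> R) (x l : R) :
  is_derive x 1 f l <-> (fun h => h^-1 * (f (x + h) - f x)) @ 0^' --> l.
Proof.
have E : (fun h : R => h^-1 *: ((f \o shift x) (h *: 1) - f x)) =
   (fun h => h^-1 * (f (x + h) - f x)).
  by apply/funext => h /=; rewrite [h *: 1]mulr1 (addrC h).
split=> [[d <-]|H]; first by rewrite -E; exact: d.
have d : derivable f x 1 by rewrite /derivable E; apply/cvg_ex; exists l.
apply: DeriveDef => //; by rewrite /derive E; apply: cvg_lim.
Qed.

Section rint01.
Context {R : realType}.
Implicit Types f g : R -> R.

Let mu := @lebesgue_measure R.

Lemma integrable_continuous f (a b : R) : continuous f ->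
  mu.-integrable `[a, b] (EFin \o f).
Proof.
move=> cf; apply: continuous_compact_integrable; first exact: segment_compact.
exact: continuous_subspaceT.
Qed.

Lemma eq_rint01 f g : (forall x, 0 <= x <= 1 -> f x = g x) ->
  rint01 f = rint01 g.
Proof.
by move=> fg; apply: eq_Rintegral => x; rewrite inE/= in_itv/= => /fg.
Qed.

Lemma rint01P f g a : continuous f -> continuous g ->
  rint01 (fun x => a * f x + g x) = a * rint01 f + rint01 g.
Proof.
move=> cf cg; rewrite /rint01 RintegralD//=; first by rewrite RintegralZl//; exact: integrable_continuous.
- have : continuous (fun x => a * f x) by move=> x; apply: cvgM; [exact: cvg_cst|exact: cf].
  exact: integrable_continuous.
- exact: integrable_continuous.
Qed.

Lemma rint01_cst (c : R) : rint01 (fun=> c) = c.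
Proof.
rewrite /rint01 Rintegral_cst//; move: (@lebesgue_measure_itv R `[0%R, 1%R]).
by rewrite /= lte_fin ltr01 oppr0 adde0 => ->; rewrite mulr1.
Qed.

Lemma rint01_0 : rint01 (fun=> 0) = 0 :> R.
Proof. exact: rint01_cst. Qed.

Lemma rint01_bound f e : continuous f ->
  (forall x, 0 <= x <= 1 -> `|f x| <= e) -> `|rint01 f| <= e.
Proof.
move=> cf fe; apply: le_trans (le_normr_Rintegral _ _) _ => //.
  exact: integrable_continuous.
have -> : e = \int[mu]_(_ in `[0%R, 1%R]) e.
  by rewrite -[LHS]rint01_cst.
apply: le_Rintegral => //.
- have : continuous (fun x => `|f x|) by move=> x; apply: cvg_norm; exact: cf.
  exact: integrable_continuous.
- by apply: integrable_continuous; exact: cst_continuous.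
Qed.

Lemma rint01_FTC f (F : R -> R) : continuous f ->
  (forall x : R, 0 <= x <= 1 -> {for x, continuous F}) ->
  (forall x : R, 0 < x < 1 -> 
    (fun h => h^-1 * (F (x + h) - F x)) @ 0^' --> f x) -> rint01 f = F 1 - F 0.
Proof.
move=> cf cF dF; rewrite /rint01 /Rintegral (@continuous_FTC2 _ f F)//.
- exact: continuous_subspaceT.
- split; first by move=> x; rewrite in_itv/= => /dF /is_deriveP [].
  + apply: cvg_at_right_filter; by apply: cF; rewrite lexx ler01.
  + apply: cvg_at_left_filter; by apply: cF; rewrite lexx ler01.
- by move=> x; rewrite in_itv/= => /dF /is_deriveP h; rewrite derive1E derive_val.
Qed.

Lemma continuous_rint01 (P : topologicalType) (f : P * R -> R) : continuous f ->
  continuous (fun p => rint01 (fun x => f (p, x))).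
Proof.
move=> cf p; apply/cvgrPdist_le => e e0.
have cp q : continuous (fun x => f (q, x)).
  move=> x; apply: (@continuous_comp R (P * R)%type R (fun x => (q, x)) f); last exact: cf.
  by apply: (cvg_pair (cvg_cst q) cvg_id).
have /compact_near_coveringP cov := @segment_compact R 0 1.
have nA : \forall q \near p, `[0%R, 1%R] `<=` (fun x => `|f (p, x) - f (q, x)| <= e).
  apply: (cov P (nbhs p) (fun q x => `|f (p, x) - f (q, x)| <= e)) => x _.
  have := cf (p, x) => /cvgrPdist_le /(_ (e / 2)).
  rewrite divr_gt0// => /(_ isT) [[A B]/= [nA nB] sAB].
  exists (B, A) => //= -[y q] [/= By Aq].
  have := sAB (p, y); have := sAB (q, y) => /=.
  move=> /(_ (conj Aq By)) h1 /(_ (conj (nbhs_singleton nA) By)) h2.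
  have -> : f (p, y) - f (q, y) = (f (p, x) - f (q, y)) - (f (p, x) - f (p, y)).
    by ring.
  by rewrite [e]splitr (le_trans (ler_normB _ _))// lerD.
move: nA; apply: filterS => q hq /=.
have -> : rint01 (fun x => f (p, x)) - rint01 (fun x => f (q, x)) =
   rint01 (fun x => -1 * f (q, x) + f (p, x)).
  by rewrite rint01P// mulN1r addrC.
apply: rint01_bound.
  by move=> x; apply: cvgD; [apply: cvgM; [exact: cvg_cst|]|]; exact: cp.
by move=> x x01; rewrite mulN1r addrC; apply: hq; rewrite /= in_itv.
Qed.

End rint01.

(** * Iterated integrals over the unit cube: Fubini and the fundamental theorem of calculus *)

Fixpoint rcube (R : realType) (M : nat) : ('rV[R]_M -> R) -> R :=
  match M with
  | 0 => fun f => f 0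
  | M'.+1 => fun f => rint01 (fun x : R =>
      rcube (fun t : 'rV[R]_M' => f (row_mx (const_mx x : 'rV[R]_1) t)))
  end.

Lemma continuous_pair (X Y Z : topologicalType) (f : X -> Y) (g : X -> Z) :
  continuous f -> continuous g -> continuous (fun x => (f x, g x)).
Proof. by move=> cf cg x; exact: (cvg_pair (cf x) (cg x)). Qed.

Lemma continuous_fst (X Y : topologicalType) : continuous (@fst X Y).
Proof. by move=> p; exact: cvg_fst. Qed.

Lemma continuous_snd (X Y : topologicalType) : continuous (@snd X Y).
Proof. by move=> p; exact: cvg_snd. Qed.

Lemma continuous_o (X Y Z : topologicalType) (f : Y -> Z) (g : X -> Y) :
  continuous f -> continuous g -> continuous (fun x => f (g x)).
Proof. by move=> cf cg x; apply: continuous_comp; [exact: cg|exact: cf]. Qed.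

Lemma continuous_mul (X : topologicalType) (K : numFieldType) (f g : X -> K) :
  continuous f -> continuous g -> continuous (fun x => f x * g x).
Proof. by move=> cf cg x; apply: cvgM; [exact: cf|exact: cg]. Qed.

Lemma continuous_add (X : topologicalType) (K : numFieldType) (f g : X -> K) :
  continuous f -> continuous g -> continuous (fun x => f x + g x).
Proof. by move=> cf cg x; apply: cvgD; [exact: cf|exact: cg]. Qed.

Lemma continuous_pairl (X Y Z : topologicalType) (h : X * Y -> Z) (x : X) :
  continuous h -> continuous (fun y => h (x, y)).
Proof.
move=> ch y; apply: (@continuous_comp _ _ _ (fun z => (x, z)) h); last exact: ch.
by apply: (cvg_pair (cvg_cst x) cvg_id).
Qed.

Lemma continuous_pairr (X Y Z : topologicalType) (h : X * Y -> Z) (y : Y) :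
  continuous h -> continuous (fun x => h (x, y)).
Proof.
move=> ch x; apply: (@continuous_comp _ _ _ (fun z => (z, y)) h); last exact: ch.
by apply: (cvg_pair cvg_id (cvg_cst y)).
Qed.

(** Both sides are the integral of [f] from [y] to [y + k], rescaled to the unit interval. The
    right-hand side shows the factor [k], so a difference quotient in [y] reduces to continuity in
    [k]. *)
Lemma rint01_incr (R : realType) (f : R -> R) (y k : R) : continuous f ->
  -1 < y -> -1 < y + k ->
  (y + k) * rint01 (fun s => f ((y + k) * s)) - y * rint01 (fun s => f (y * s)) =
  k * rint01 (fun s => f (y + k * s)).
Proof.
move=> cf.
(* The base point [-1] leaves room to the left of [0], so that the primitive has a two-sided
   derivative at [0] as well. *)
pose P (z : R) := (\int[@lebesgue_measure R]_(t in `[(-1)%R, z]) f t)%R.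
have dP (z : R) : -1 < z -> is_derive z 1 P (f z).
  move=> z1; have [] := @continuous_FTC1_closed R f (-1) z (z + 1) _ _ z1 (cf z).
  - by rewrite ltrDl.
  - exact: integrable_continuous.
  by move=> d e; split => //; rewrite -e derive1E.
have PE (a b : R) : -1 < a -> -1 < a + b ->
    P (a + b) - P a = b * rint01 (fun s => f (a + b * s)).
  move=> a1 ab1.
  have ok (s : R) : 0 <= s -> s <= 1 -> -1 < a + b * s.
    move=> s0 s1; have h2 : 0 <= s * (a + b + 1) by rewrite mulr_ge0//; lra.
    move: s1; rewrite le_eqVlt => /predU1P[->|s1]; first by rewrite mulr1.
    have : 0 < (1 - s) * (a + 1) by rewrite mulr_gt0//; lra.
    lra.
  have cl (s : R) : {for s, continuous (fun s => a + b * s)}.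
    by apply: cvgD; [exact: cvg_cst|apply: cvgM; [exact: cvg_cst|exact: cvg_id]].
  have cfl : continuous (fun s => f (a + b * s)).
    by move=> s; apply: continuous_comp; [exact: cl|exact: cf].
  have c0 : continuous (fun _ : R => 0 : R) by exact: cst_continuous.
  rewrite -[RHS]addr0 -[X in _ = _ + X]rint01_0.
  rewrite -rint01P// (@rint01_FTC R _ (fun s => P (a + b * s))).
  - by rewrite mulr1 mulr0 addr0.
  - by move=> s; apply: cvgD; [apply: cvgM; [exact: cvg_cst|exact: cfl]|exact: cvg_cst].
  - move=> s /andP[s0 s1]; apply: continuous_comp; first exact: cl.
    have [d _] := dP (a + b * s) (ok s ltac:(lra) ltac:(lra)).
    apply: differentiable_continuous; exact/derivable1_diffP.
  - move=> s /andP[s0 s1].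
    have d := dP (a + b * s) (ok s ltac:(lra) ltac:(lra)).
    have e : is_derive s 1 (fun s : R => a + b * s) b.
      by apply: is_derive_eq; rewrite add0r mul1r [b *: 1]mulr1.
    rewrite addr0; have /is_deriveP := @is_derive1_comp _ P _ s _ _ d e; rewrite mulrC; apply.
move=> y1 yk1.
have h0 := PE 0 y; have h1 := PE 0 (y + k); have h2 := PE y k y1 yk1.
rewrite !add0r in h0 h1.
under [rint01 (fun s => f ((y + k) * s))]eq_rint01 => s _ do rewrite -[_ * s]add0r.
under [rint01 (fun s => f (y * s))]eq_rint01 => s _ do rewrite -[_ * s]add0r.
rewrite -h0 ?ltrN10// -h1 ?ltrN10//.
rewrite -h2; ring.
Qed.

(** [H y x] is the integral of [h (x, _)] from [0] to [y]. Its integral over [x] is, as a function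
    of [y], a primitive of the inner integral on the right; the fundamental theorem evaluates it at
    [0] and [1]. *)
Lemma rint01_swap (R : realType) (h : R * R -> R) : continuous h ->
  rint01 (fun x => rint01 (fun y => h (x, y))) =
  rint01 (fun y => rint01 (fun x => h (x, y))).
Proof.
move=> ch.
pose H (y x : R) := y * rint01 (fun s => h (x, y * s)).
pose F2 : R * R * R -> R := fun p => p.1.2.
pose F1 : R * R * R -> R := fun p => p.1.1.
have cF2 : continuous F2.
  by apply: continuous_o; [exact: continuous_snd|exact: continuous_fst].
have cF1 : continuous F1.
  by apply: continuous_o; exact: continuous_fst.
have cN : continuous (fun p : R * R * R => h (p.1.2, p.1.1 * p.2)).
  apply: (@continuous_o _ _ _ h); first exact: ch.
  apply: continuous_pair; first exact: cF2.
  by apply: continuous_mul; [exact: cF1|exact: continuous_snd].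
have cH : continuous (fun p : R * R => H p.1 p.2).
  apply: continuous_mul; first exact: continuous_fst.
  exact: (continuous_rint01 cN).
have cG : continuous (fun y => rint01 (H y)) by exact: (continuous_rint01 cH).
rewrite [RHS](@rint01_FTC R _ (fun y => rint01 (H y))).
- have -> : rint01 (H 0) = 0.
    by rewrite -[RHS]rint01_0; apply: eq_rint01 => x _; rewrite /H mul0r.
  by rewrite subr0; apply: eq_rint01 => x _; rewrite /H mul1r; apply: eq_rint01 => y _; rewrite mul1r.
- apply: (continuous_rint01 (f := fun p => h (p.2, p.1))).
  apply: (@continuous_o _ _ _ h); first exact: ch.
  by apply: continuous_pair; [exact: continuous_snd|exact: continuous_fst].
- by move=> x _; exact: cG.
move=> y /andP[y0 y1].
have cN' : continuous (fun p : R * R * R => h (p.1.2, y + p.1.1 * p.2)).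
  apply: (@continuous_o _ _ _ h); first exact: ch.
  apply: continuous_pair; first exact: cF2.
  apply: continuous_add; first exact: cst_continuous.
  by apply: continuous_mul; [exact: cF1|exact: continuous_snd].
(* For small [k != 0], [Q k] is the difference quotient; unlike the quotient it makes sense at
   [k = 0], where its value is the required derivative. *)
pose Q k := rint01 (fun x => rint01 (fun s => h (x, y + k * s))).
have cQ : continuous Q by exact: (continuous_rint01 (continuous_rint01 cN')).
have Q0 : Q 0 = rint01 (fun x => h (x, y)).
  apply: eq_rint01 => x _.
  have -> : (fun s => h (x, y + 0 * s)) = (fun=> h (x, y)).
    by apply/funext => s; rewrite mul0r addr0.
  by rewrite rint01_cst.
have cQ0 : Q @ 0^' --> Q 0 by apply: cvg_within_filter; exact: cQ.
rewrite -Q0; apply: cvg_trans cQ0.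
apply: near_eq_cvg; near=> k.
have k0 : k != 0 by near: k; exact: nbhs_dnbhs_neq.
have yk : -1 < y + k.
  have : `|k| < 1 by near: k; apply: dnbhs0_lt.
  by rewrite ltr_norml => /andP[? ?]; lra.
have cHy z : continuous (H z) by exact: (@continuous_pairl R R R (fun p => H p.1 p.2) z cH).
rewrite [X in _ * X](_ : _ = k * Q k) ?mulKf//.
transitivity (rint01 (fun x => -1 * H y x + H (y + k) x)); first by rewrite rint01P// mulN1r addrC.
rewrite -[RHS]addr0 -[X in _ = _ + X]rint01_0 -rint01P//; last 2 first.
- exact: continuous_pairl k (continuous_rint01 cN').
- exact: cst_continuous.
apply: eq_rint01 => x _; rewrite addr0 mulN1r addrC.
by rewrite (@rint01_incr _ (fun y => h (x, y)))//; [exact: continuous_pairl|lra].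
Unshelve. all: by end_near. Qed.

Lemma continuous_rV (X : topologicalType) (K : numFieldType) (n : nat)
    (f : X -> 'rV[K]_n) :
  continuous f <-> forall j, continuous (fun x => f x 0 j).
Proof.
split=> [cf j|cf x].
  by apply: (@continuous_o _ _ _ (fun t : 'rV[K]_n => t 0 j) f) => //; exact: coord_continuous.
apply/cvg_ballP => e e0.
have: \forall y \near x, forall j, ball (f x 0 j) e (f y 0 j).
  apply: filter_forall => j.
  by have /cvg_ballP := cf j x; exact.
by apply: filterS => y H; rewrite /ball/=; split=> // i j; rewrite (ord1 i); exact: H.
Qed.

Lemma continuous_insert0 (R : realType) (M : nat) :
  continuous (fun p : R * 'rV[R]_M => row_mx (const_mx p.1 : 'rV[R]_1) p.2).
Proof.
apply/continuous_rV => j.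
case: (split_ordP j) => k ->.
  have -> : (fun p : R * 'rV[R]_M => row_mx (const_mx p.1 : 'rV[R]_1) p.2 0 (lshift M k)) = fst.
    by apply/funext => p; rewrite row_mxEl mxE.
  exact: continuous_fst.
have -> : (fun p : R * 'rV[R]_M => row_mx (const_mx p.1 : 'rV[R]_1) p.2 0 (rshift 1 k)) =
    (fun p => p.2 0 k).
  by apply/funext => p; rewrite row_mxEr.
apply: (@continuous_o _ _ _ (fun t : 'rV[R]_M => t 0 k)); last exact: continuous_snd.
exact: coord_continuous.
Qed.

Lemma continuous_insert1 (R : realType) (M : nat) (P Z : topologicalType)
    (f : P * 'rV[R]_M.+1 -> Z) : continuous f ->
  continuous (fun q : P * R * 'rV[R]_M =>
    f (q.1.1, row_mx (const_mx q.1.2 : 'rV[R]_1) q.2)).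
Proof.
move=> cf; apply: (@continuous_o _ _ _ f); first exact: cf.
apply: continuous_pair.
  by apply: continuous_o; [exact: continuous_fst|exact: continuous_fst].
apply: (@continuous_o _ _ _ (fun p : R * 'rV[R]_M => row_mx (const_mx p.1 : 'rV[R]_1) p.2)
   (fun q : P * R * 'rV[R]_M => (q.1.2, q.2))).
  exact: continuous_insert0.
apply: continuous_pair; last exact: continuous_snd.
by apply: continuous_o; [exact: continuous_snd|exact: continuous_fst].
Qed.

Lemma continuous_rcube (R : realType) (M : nat) (P : topologicalType)
    (f : P * 'rV[R]_M -> R) : continuous f ->
  continuous (fun p => rcube (fun t => f (p, t))).
Proof.
elim: M P f => [|M IH] P f cf /=; first exact: continuous_pairr.
pose g := (fun q : P * R * 'rV[R]_M => f (q.1.1, row_mx (const_mx q.1.2 : 'rV[R]_1) q.2)).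
have cg : continuous g by exact: continuous_insert1.
exact: (continuous_rint01 (IH _ _ cg)).
Qed.

Lemma rcubeP (R : realType) (M : nat) (a : R) (f g : 'rV[R]_M -> R) :
  continuous f -> continuous g ->
  rcube (fun t => a * f t + g t) = a * rcube f + rcube g.
Proof.
elim: M f g => [//|M IH] f g cf cg /=.
have c0 h x : continuous h ->
    continuous (fun t : 'rV[R]_M => h (row_mx (const_mx x : 'rV[R]_1) t) : R).
  move=> ch; apply: (@continuous_o _ _ _ h); first exact: ch.
  exact: (@continuous_pairl _ _ _ (fun p : R * 'rV[R]_M => row_mx (const_mx p.1 : 'rV[R]_1) p.2) x (@continuous_insert0 R M)).
have c1 h : continuous h ->
    continuous (fun x => rcube (fun t : 'rV[R]_M => h (row_mx (const_mx x : 'rV[R]_1) t) : R)).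
  move=> ch; apply: (@continuous_rcube _ _ _ (fun p : R * 'rV[R]_M => h (row_mx (const_mx p.1 : 'rV[R]_1) p.2))).
  by apply: (@continuous_o _ _ _ h); [exact: ch|exact: continuous_insert0].
rewrite -rint01P; [|exact: c1|exact: c1].
by apply: eq_rint01 => x _; rewrite IH//; exact: c0.
Qed.

Lemma eq_rcube (R : realType) (M : nat) (f g : 'rV[R]_M -> R) :
  (forall t, unit_cube t -> f t = g t) -> rcube f = rcube g.
Proof.
elim: M f g => [|M IH] f g fg /=; first by apply: fg => -[].
apply: eq_rint01 => x x01; apply: IH => t ut; apply: fg => b.
move: b; change (forall b : 'I_(1 + M), 0 <= row_mx (const_mx x : 'rV[R]_1) t 0 b <= 1) => b.
by case: (split_ordP b) => k ->; [rewrite row_mxEl mxE|rewrite row_mxEr; exact: ut].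
Qed.

Lemma rint01_rcube_swap (R : realType) (M : nat) (f : R * 'rV[R]_M -> R) :
  continuous f ->
  rint01 (fun x => rcube (fun t => f (x, t))) =
  rcube (fun t => rint01 (fun x => f (x, t))).
Proof.
elim: M f => [//|M IH] f cf /=.
pose g := fun q : R * R * 'rV[R]_M => f (q.1.1, row_mx (const_mx q.1.2 : 'rV[R]_1) q.2).
have cg : continuous g by exact: continuous_insert1.
rewrite (rint01_swap (continuous_rcube cg)).
apply: eq_rint01 => y _.
apply: (IH (fun p => g (p.1, y, p.2))).
apply: (@continuous_o _ _ _ g); first exact: cg.
apply: continuous_pair; last exact: continuous_snd.
by apply: continuous_pair; [exact: continuous_fst|exact: cst_continuous].
Qed.

(** Inserts an arbitrary real as the [b]-th coordinate; [face b e] is the case [x = e%:R]. *)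
Definition ins (R : realType) (M : nat) (b : 'I_M) (x : R) (t : 'rV[R]_M.-1) :
  'rV[R]_M := \row_c (if unlift b c is Some d then t 0 d else x).

Lemma continuous_ins (R : realType) (M : nat) (b : 'I_M) :
  continuous (fun p : R * 'rV[R]_M.-1 => ins b p.1 p.2).
Proof.
apply/continuous_rV => c; case: (unliftP b c) => [d|] ->.
  have -> : (fun p : R * 'rV[R]_M.-1 => ins b p.1 p.2 0 (lift b d)) = (fun p => p.2 0 d).
    by apply/funext => p; rewrite mxE liftK.
  apply: (@continuous_o _ _ _ (fun t : 'rV[R]_M.-1 => t 0 d)); last exact: continuous_snd.
  exact: coord_continuous.
have -> : (fun p : R * 'rV[R]_M.-1 => ins b p.1 p.2 0 b) = fst.
  by apply/funext => p; rewrite mxE unlift_none.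
exact: continuous_fst.
Qed.

Lemma ins_add (R : realType) (M : nat) (b : 'I_M) (x h : R) (t : 'rV[R]_M.-1) :
  ins b (x + h) t = ins b x t + h *: delta_mx 0 b.
Proof.
apply/rowP => c; rewrite !mxE eqxx; case: (unliftP b c) => [d|] -> /=.
  by rewrite eq_sym (negbTE (neq_lift _ _)) mulr0 addr0.
by rewrite eqxx mulr1.
Qed.

Lemma ins_cube (R : realType) (M : nat) (b : 'I_M) (x : R) (t : 'rV[R]_M.-1) :
  0 <= x <= 1 -> unit_cube t -> unit_cube (ins b x t).
Proof. by move=> x01 ut c; rewrite mxE; case: unlift. Qed.

Lemma ins0 (R : realType) (M : nat) (x : R) (t : 'rV[R]_M) :
  row_mx (const_mx x : 'rV[R]_1) t = ins (ord0 : 'I_M.+1) x t.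
Proof.
apply/rowP; change (forall c : 'I_(1 + M), row_mx (const_mx x : 'rV[R]_1) t 0 c = ins (ord0 : 'I_M.+1) x t 0 c) => c.
case: (split_ordP c) => k ->.
  rewrite row_mxEl mxE mxE (_ : lshift M k = ord0) ?unlift_none//.
  by apply/val_inj; rewrite /= (ord1 k).
rewrite row_mxEr mxE (_ : rshift 1 k = lift ord0 k) ?liftK//.
by apply/val_inj.
Qed.

Lemma ins_lift (R : realType) (M : nat) (b : 'I_M.+1) (x y : R) (t : 'rV[R]_M) :
  ins (ord0 : 'I_M.+2) y (ins b x t) =
  ins (lift ord0 b : 'I_M.+2) x (ins (ord0 : 'I_M.+1) y t).
Proof.
apply/rowP => c; rewrite mxE [RHS]mxE.
case: (unliftP ord0 c) => [d|] ->; last first.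
  have {2}-> : ord0 = lift (lift ord0 b) ord0 :> 'I_M.+2 by apply/val_inj.
  by rewrite liftK mxE unlift_none.
rewrite mxE; case: (unliftP b d) => [k|] ->.
  have -> : lift ord0 (lift b k) = lift (lift ord0 b) (lift ord0 k) :> 'I_M.+2.
    by apply/val_inj => /=; rewrite /bump /= !add1n !ltnS addnS.
  by rewrite liftK mxE liftK.
by rewrite !unlift_none.
Qed.

(** Brings the [b]-th integration innermost, where the one-dimensional fundamental theorem applies.
    By induction the only exchange needed is that of the first variable with all the others. *)
Lemma rcube_ins (R : realType) (M : nat) (b : 'I_M) (f : 'rV[R]_M -> R) :
  continuous f ->
  rcube f = rcube (fun t => rint01 (fun x => f (ins b x t))).
Proof.
case: M b f => [[]//|M] b f cf.
have cf0 : continuous (fun p : R * 'rV[R]_M => f (row_mx (const_mx p.1 : 'rV[R]_1) p.2)).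
  apply: (@continuous_o _ _ _ f); first exact: cf.
  exact: continuous_insert0.
elim: M b f cf cf0 => [|M IH] b f cf cf0.
  rewrite (ord1 b) /=; apply: eq_rint01 => x _.
  by rewrite ins0.
case: (unliftP ord0 b) => [b'|] ->.
  transitivity (rint01 (fun y => rcube (fun t : 'rV[R]_M.+1 => f (row_mx (const_mx y : 'rV[R]_1) t)))) => //.
  transitivity (rint01 (fun y => rcube (fun t' : 'rV[R]_M =>
     rint01 (fun x => f (ins (lift ord0 b' : 'I_M.+2) x (row_mx (const_mx y : 'rV[R]_1) t')))))) => //.
  apply: eq_rint01 => y _; rewrite (IH b').
  - by congr rcube; apply/funext => t; apply: eq_rint01 => x _; rewrite !ins0 ins_lift.
  - exact: (@continuous_pairl _ _ _ (fun p : R * 'rV[R]_M.+1 => f (row_mx (const_mx p.1 : 'rV[R]_1) p.2)) y).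
  - apply: (@continuous_o _ _ _ (fun t => f (row_mx (const_mx y : 'rV[R]_1) t))).
      exact: (@continuous_pairl _ _ _ (fun p : R * 'rV[R]_M.+1 => f (row_mx (const_mx p.1 : 'rV[R]_1) p.2)) y).
    exact: continuous_insert0.
transitivity (rint01 (fun y => rcube (fun t : 'rV[R]_M.+1 => f (row_mx (const_mx y : 'rV[R]_1) t)))) => //.
rewrite (rint01_rcube_swap cf0); congr rcube; apply/funext => t.
by apply: eq_rint01 => x _; rewrite ins0.
Qed.

(** The retraction onto the cube. Composition with it turns a function continuous on the cube only
    into one continuous everywhere, with the same integral. *)
Definition clamp (R : realType) (M : nat) (t : 'rV[R]_M) : 'rV[R]_M :=
  \row_b Num.max 0 (Num.min 1 (t 0 b)).

Lemma clamp_cube (R : realType) (M : nat) (t : 'rV[R]_M) : unit_cube (clamp t).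
Proof. by move=> b; rewrite mxE le_max lexx/= ge_max ler01/= ge_min lexx. Qed.

Lemma clampE (R : realType) (M : nat) (t : 'rV[R]_M) : unit_cube t -> clamp t = t.
Proof.
by move=> ut; apply/rowP => b; rewrite mxE; have /andP[? ?] := ut b; rewrite min_r// max_r.
Qed.

Lemma continuous_clamp (R : realType) (M : nat) : continuous (@clamp R M).
Proof.
apply/continuous_rV => b.
have -> : (fun t : 'rV[R]_M => clamp t 0 b) = (fun t => Num.max 0 (Num.min 1 (t 0 b))).
  by apply/funext => t; rewrite mxE.
apply: (@max_fun_continuous _ 'rV[R]_M R (fun=> 0) (fun t => Num.min 1 (t 0 b))).
  by move=> t; exact: cst_continuous.
apply: (@min_fun_continuous _ 'rV[R]_M R (fun=> 1) (fun t => t 0 b)); last exact: coord_continuous.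
by move=> t; exact: cst_continuous.
Qed.

Lemma continuous_comp_clamp (R : realType) (M : nat) (Z : topologicalType)
    (f : 'rV[R]_M -> Z) :
  {within @unit_cube R M, continuous f} -> continuous (f \o @clamp R M).
Proof.
move=> /subspace_continuousP cf t.
apply: cvg_trans (cf _ (clamp_cube t)) => A /= nA.
have := @continuous_clamp R M t _ nA.
move=> H; have {}H : nbhs t (fun u => unit_cube (clamp u) -> A (f (clamp u))) := H.
change (nbhs t (fun u => A (f (clamp u)))).
by apply: filterS H => u; apply; exact: clamp_cube.
Qed.

(** The derivative is asked for only where the [b]-th coordinate is interior: a branch of a
    logarithm known on the cube alone has a two-sided difference quotient there and not on the
    faces. *)
Lemma rcube_partial (R : realType) (M : nat) (b : 'I_M) (f F : 'rV[R]_M -> R) :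
  {within @unit_cube R M, continuous f} -> {within @unit_cube R M, continuous F} ->
  (forall t, unit_cube t -> 0 < t 0 b < 1 ->
    (fun h => h^-1 * (F (t + h *: delta_mx 0 b) - F t)) @ 0^' --> f t) ->
  rcube f = rcube (fun t => F (face b true t)) - rcube (fun t => F (face b false t)).
Proof.
move=> /continuous_comp_clamp cf /continuous_comp_clamp cF dF.
rewrite (@eq_rcube _ _ f (f \o @clamp R M)); last by move=> t ut /=; rewrite clampE.
have i01 (e : bool) : 0 <= (e%:R : R) <= 1 by case: e; rewrite /= ?lexx ?ler01.
rewrite (rcube_ins b)//.
have cFi e : continuous (fun t => (F \o @clamp R M) (ins b e%:R t)).
  apply: (@continuous_o _ _ _ (F \o @clamp R M)); first exact: cF.
  exact: (@continuous_pairl _ _ _ (fun p : R * 'rV[R]_M.-1 => ins b p.1 p.2) (e%:R) (@continuous_ins R M b)).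
transitivity (rcube (fun t => -1 * (F \o @clamp R M) (ins b 0 t) + (F \o @clamp R M) (ins b 1 t))).
  apply: eq_rcube => t ut; rewrite mulN1r addrC.
  have ci : continuous (fun x => ins b x t).
    exact: (@continuous_pairr _ _ _ (fun p : R * 'rV[R]_M.-1 => ins b p.1 p.2) t (@continuous_ins R M b)).
  rewrite (@rint01_FTC _ _ (fun x => (F \o @clamp R M) (ins b x t)))//.
  - by apply: (@continuous_o _ _ _ (f \o @clamp R M)); [exact: cf|exact: ci].
  - by move=> x _; apply: (@continuous_o _ _ _ (F \o @clamp R M)); [exact: cF|exact: ci].
  move=> x x01.
  have x01' : 0 <= x <= 1 by case/andP: x01 => ? ?; lra.
  have := dF (ins b x t) (ins_cube b x01' ut).
  rewrite mxE unlift_none x01 => /(_ isT) /= D.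
  rewrite clampE; last exact: ins_cube.
  (* For small [h] the shifted point is still in the cube, where [clamp] is the identity. *)
  apply: cvg_trans D; apply: near_eq_cvg; near=> h.
  rewrite -ins_add clampE//; apply: ins_cube => //.
  have : `|h| < Num.min x (1 - x).
    near: h; apply: dnbhs0_lt; rewrite lt_min; case/andP: x01 => ? ?; lra.
  by rewrite lt_min !ltr_norml => /andP[/andP[? ?] /andP[? ?]]; lra.
rewrite rcubeP; [|exact: (cFi false)|exact: (cFi true)].
rewrite mulN1r addrC; congr (_ - _).
  by apply: eq_rcube => t ut /=; rewrite clampE//; exact: (ins_cube b (i01 true) ut).
by apply: eq_rcube => t ut /=; rewrite clampE//; exact: (ins_cube b (i01 false) ut).
Unshelve. all: by end_near. Qed.

(** * Commutation relations of the generating operators and their action on Bethe vectors *)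

Section gaudin.
Context {K : fieldType} {V : lmodType K} {N M : nat}.
Variables (e f h : 'I_N -> {linear V -> V}) (vac : V) (s : 'I_N -> K).
Hypothesis ee : forall j k u, e j (e k u) = e k (e j u).
Hypothesis he : forall j k u, h j (e k u) = e k (h j u) + (2 * (j == k)%:R) *: e k u.
Hypothesis fe : forall j k u, f j (e k u) = e k (f j u) - (j == k)%:R *: h k u.
Hypothesis fvac : forall j, f j vac = 0.
Hypothesis hvac : forall j, h j vac = s j *: vac.
Variables (g : 'I_N -> K) (v : 'I_M -> K).

Definition gen (x : 'I_N -> {linear V -> V}) (a : K) (u : V) : V :=
  \sum_(j < N) (a - g j)^-1 *: x j u.

Definition gen_vec (l : seq 'I_M) : V := foldr (fun r => gen e (v r)) vac l.

Lemma gen_linear x a : linear (gen x a).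
Proof.
move=> c u w; rewrite /gen scaler_sumr -big_split/=; apply: eq_bigr => j _.
by rewrite linearP scalerDr !scalerA mulrC.
Qed.

HB.instance Definition _ x a := GRing.isLinear.Build K V V _ (gen x a) (gen_linear x a).

Definition tot (x : 'I_N -> {linear V -> V}) (u : V) : V := \sum_(j < N) x j u.

Lemma gen_ee a b u : gen e a (gen e b u) = gen e b (gen e a u).
Proof.
rewrite /gen; under eq_bigr do rewrite linear_sum scaler_sumr/=.
rewrite exchange_big/=; apply: eq_bigr => j _.
rewrite linear_sum scaler_sumr/=; apply: eq_bigr => k _.
by rewrite !linearZ/= !scalerA mulrC ee.
Qed.

Lemma tot_h_gen a u : tot h (gen e a u) = gen e a (tot h u) + 2%:R *: gen e a u.
Proof.
rewrite /tot /gen; under eq_bigr do rewrite linear_sum/=.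
rewrite exchange_big/= scaler_sumr -big_split/=; apply: eq_bigr => k _.
rewrite linear_sum scaler_sumr/=.
under eq_bigr => j _ do rewrite linearZ/= he scalerDr scalerA.
rewrite big_split/=; congr (_ + _).
rewrite (bigD1 k)//= eqxx mulr1 big1 ?addr0 ?scalerA 1?mulrC// => j /negbTE ->.
by rewrite mulr0 mulr0 scale0r.
Qed.

Lemma tot_f_gen a u : tot f (gen e a u) = gen e a (tot f u) - gen h a u.
Proof.
rewrite /tot /gen; under eq_bigr do rewrite linear_sum/=.
rewrite exchange_big/= -sumrB; apply: eq_bigr => k _.
rewrite linear_sum scaler_sumr/=.
under eq_bigr => j _ do rewrite linearZ/= fe scalerBr scalerA.
rewrite sumrB; congr (_ - _).
rewrite (bigD1 k)//= eqxx mulr1 big1 ?addr0// => j /negbTE ->.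
by rewrite mulr0 scale0r.
Qed.

(** Only the terms with equal indices have a nonzero commutator, and 1 / ((a - g) (b - g)) splits
    into partial fractions with denominator b - a. *)
Lemma gen_h_gen a b u : a != b -> (forall j, a != g j) -> (forall j, b != g j) ->
  gen h a (gen e b u) =
  gen e b (gen h a u) + (2 / (b - a)) *: (gen e a u - gen e b u).
Proof.
move=> ab ag bg; rewrite /gen; under eq_bigr do rewrite linear_sum/= scaler_sumr.
rewrite exchange_big/= -sumrB scaler_sumr -big_split/=; apply: eq_bigr => k _.
rewrite linear_sum scaler_sumr/=.
under eq_bigr => j _ do rewrite linearZ/= he scalerDr scalerA scalerDr !scalerA.
rewrite big_split/=; congr (_ + _).
  by apply: eq_bigr => j _; rewrite linearZ/= scalerA mulrC.
rewrite (bigD1 k)//= eqxx mulr1 big1 ?addr0.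
  rewrite -scalerBl scalerA; congr (_ *: _).
  by field; rewrite !subr_eq0 ag bg eq_sym ab.
by move=> j /negbTE ->; rewrite !mulr0 scale0r.
Qed.

Lemma tot_h_gen_vec l :
  tot h (gen_vec l) = ((2 * size l)%:R + \sum_j s j) *: gen_vec l.
Proof.
elim: l => [|r l IH] /=.
  rewrite add0r scaler_suml; apply: eq_bigr => j _; exact: hvac.
rewrite tot_h_gen IH linearZ/= -scalerDl; congr (_ *: _).
by rewrite mulnS natrD; ring.
Qed.

(** The expression whose vanishing is the Bethe equation for [v r]. Up to the factor [- ('i * hbar)]
    it is also the logarithmic derivative of the weight in [v r]; this coincidence makes the
    lowering operator act by total derivatives. *)
Definition bethe_coef (l : seq 'I_M) (r : 'I_M) : K :=
  \sum_j s j / (v r - g j) + \sum_(p <- l | p != r) 2 / (v r - v p).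

Hypothesis vg : forall r j, v r != g j.

Lemma gen_h_gen_vec a l : (forall j, a != g j) -> uniq l -> {in l, forall q, a != v q} ->
  gen h a (gen_vec l) = (\sum_j s j / (a - g j)) *: gen_vec l +
  \sum_(q <- l) (2 / (v q - a)) *: (gen e a (gen_vec (rem q l)) - gen_vec l).
Proof.
move=> ag; elim: l => [_ _|r l IH /= /andP[rl ul] al] /=.
  rewrite big_nil addr0 /gen scaler_suml; apply: eq_bigr => j _.
  by rewrite hvac scalerA mulrC.
rewrite gen_h_gen//; last by apply: al; rewrite mem_head.
rewrite IH//; last by move=> q ql; apply: al; rewrite inE ql orbT.
rewrite linearD linearZ/= big_cons eqxx -addrA; congr (_ + _).
rewrite addrC; congr (_ + _).
rewrite [gen e (v r) (\sum_(q <- l) _)]linear_sum/=; apply: eq_big_seq => q ql.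
rewrite linearZ/= linearB/= gen_ee.
by have /negbTE -> : r != q by apply: contraNneq rl => ->.
Qed.

(** Moving the total [f] past [gen e (v q)] leaves [gen h (v q)], which then travels to the vacuum.
    Its vacuum eigenvalue is the one-body part of [bethe_coef]; each exchange with [v r] adds 2 / (v
    q - v r) to the coefficient at [q] and 2 / (v r - v q) to the one at [r]. *)
Lemma tot_f_gen_vec l : uniq l -> {in l &, injective v} ->
  tot f (gen_vec l) = - \sum_(r <- l) bethe_coef l r *: gen_vec (rem r l).
Proof.
elim: l => [_ _|q l IH /= /andP[ql ul] inj] /=.
  by rewrite big_nil oppr0 /tot big1// => j _; rewrite fvac.
have vq r : r \in l -> v r != v q.
  move=> rl; apply: contraNneq ql => /inj <-//; rewrite inE ?eqxx// rl orbT //.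
rewrite tot_f_gen IH//; last first.
  by move=> x y xl yl; apply: inj; rewrite inE ?xl ?yl orbT.
rewrite gen_h_gen_vec//; last by move=> r rl; rewrite eq_sym vq.
rewrite big_cons eqxx linearN/= -opprD; congr (- _).
have -> : bethe_coef (q :: l) q = \sum_j s j / (v q - g j) + \sum_(p <- l) 2 / (v q - v p).
  rewrite /bethe_coef big_cons eqxx/=; congr (_ + _).
  rewrite big_seq_cond [RHS]big_seq; apply: eq_bigl => p; case pl : (p \in l) => //=.
  by apply: contraNneq ql => <-.
have -> : gen e (v q) (\sum_(r <- l) bethe_coef l r *: gen_vec (rem r l)) =
    \sum_(r <- l) bethe_coef l r *: gen e (v q) (gen_vec (rem r l)).
  by rewrite linear_sum/=; apply: eq_bigr => r _; rewrite linearZ.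
have -> : \sum_(r <- l) (2 / (v r - v q)) *: (gen e (v q) (gen_vec (rem r l)) - gen_vec l) =
    \sum_(r <- l) (2 / (v r - v q)) *: gen e (v q) (gen_vec (rem r l)) +
    (\sum_(r <- l) 2 / (v q - v r)) *: gen_vec l.
  rewrite scaler_suml -big_split/=; apply: eq_big_seq => r rl.
  rewrite scalerBr -scaleNr; congr (_ + _ *: _).
  by field; rewrite !subr_eq0 vq// eq_sym vq.
have -> : \sum_(r <- l) bethe_coef (q :: l) r *: gen_vec (rem r (q :: l)) =
    \sum_(r <- l) bethe_coef l r *: gen e (v q) (gen_vec (rem r l)) +
    \sum_(r <- l) (2 / (v r - v q)) *: gen e (v q) (gen_vec (rem r l)).
  rewrite -big_split/=; apply: eq_big_seq => r rl.
  have /negbTE qr : q != r by apply: contraNneq ql => ->.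
  rewrite qr /= -scalerDl; congr (_ *: _).
  by rewrite /bethe_coef big_cons qr/= [X in _ + X]addrC addrA.
rewrite scalerDl.
set a := \sum_(r <- l) _; set b := _ *: _; set c := \sum_(r <- l) _; set d := _ *: _.
by rewrite [c + d]addrC [b + _]addrA addrCA.
Qed.

(** On a vector killed by the total [f], the [e f] part vanishes and the [f e] part is the
    commutator, minus the total [h]; what remains is m^2 / 2 - m. *)
Lemma tot_Omega u m : 2%:R != 0 :> K -> tot f u = 0 -> tot h u = m *: u ->
  \sum_j \sum_k (2%:R^-1 *: h j (h k u) + f j (e k u) + e j (f k u)) =
  (m * (m - 2) / 2) *: u.
Proof.
move=> n2 fu hu.
have hh : \sum_j \sum_k h j (h k u) = (m * m) *: u.
  under eq_bigr do rewrite -linear_sum/= -/(tot h u) hu linearZ/=.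
  by rewrite -scaler_sumr -/(tot h u) hu scalerA.
have ef : \sum_j \sum_k e j (f k u) = 0.
  by apply: big1 => j _; rewrite -linear_sum/= -/(tot f u) fu linear0.
have fe' : \sum_j \sum_k f j (e k u) = - (m *: u).
  under eq_bigr do under eq_bigr do rewrite fe.
  rewrite exchange_big/=; under eq_bigr do rewrite sumrB.
  rewrite sumrB [X in X - _](_ : _ = 0) ?sub0r; last first.
    by apply: big1 => k _; rewrite -linear_sum/= -/(tot f u) fu linear0.
  rewrite -hu; congr (- _); apply: eq_bigr => k _.
  by rewrite (bigD1 k)//= eqxx scale1r big1 ?addr0// => j /negbTE ->; rewrite scale0r.
under eq_bigr do rewrite !big_split/= -scaler_sumr.
rewrite !big_split/= -scaler_sumr hh ef fe' addr0 scalerA -scaleNr -scalerDl.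
by congr (_ *: _); field.
Qed.

End gaudin.

(** * Operators on the tensor product and the Casimir of one factor *)

(** Besides the weak formulation of the integrals, this reduces vector identities to scalar ones
    that [ring] or [field] can decide. *)
Lemma dot_ext (R : realType) (U : lmodType R[i]) (d : {dot U for Num.conj}) (x y : U) :
  (forall w, d x w = d y w) -> x = y.
Proof.
move=> H; apply/eqP; rewrite -subr_eq0; apply/negPn/negP => n0.
have := dnorm_gt0 d (x - y).
by rewrite n0 linearBl/= H subrr ltxx.
Qed.

Lemma dot_conj (R : realType) (U : lmodType R[i]) (d : {dot U for Num.conj}) (x y : U) :
  d x y = Num.conj (d y x).
Proof. by rewrite hermC/= mul1r. Qed.

Lemma dfwith_twice (I : eqType) (X : I -> Type) (x : forall i, X i) i (a b : X i) :
  dfwith (dfwith x i a) i b = dfwith x i b.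
Proof.
apply: functional_extensionality_dep => k.
by case: (dfwithP x b k) => [|k' ik]; rewrite ?dfwithin// !dfwithout.
Qed.

Lemma dfwith_swap (I : eqType) (X : I -> Type) (x : forall i, X i) i j (a : X i) (b : X j) :
  i != j -> dfwith (dfwith x i a) j b = dfwith (dfwith x j b) i a.
Proof.
move=> ij; apply: functional_extensionality_dep => k.
have [->|kj] := eqVneq k j; first by rewrite dfwithin dfwithout// dfwithin.
rewrite dfwithout 1?eq_sym//.
have [->|ki] := eqVneq k i; first by rewrite !dfwithin.
by rewrite !dfwithout 1?eq_sym// eq_sym.
Qed.

Section tensor.
Context {R : realType} {N : nat} {H : 'I_N -> lmodType R[i]}
  {dH : forall j, {dot H j for Num.conj}} (T : tensor_product dH).

Lemma tp_ext (A B : T -> T) : linear A -> linear B ->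
  (forall x, A (tp_pure T x) = B (tp_pure T x)) -> forall u, A u = B u.
Proof.
move=> lA lB AB u; have [n [c [x ->]]] := tp_span u.
pose A' := HB.pack_for {linear T -> T} A (GRing.isLinear.Build _ _ _ _ A lA).
pose B' := HB.pack_for {linear T -> T} B (GRing.isLinear.Build _ _ _ _ B lB).
change (A' (\sum_(k < n) c k *: tp_pure T (x k)) = B' (\sum_(k < n) c k *: tp_pure T (x k))).
rewrite [LHS]linear_sum [RHS]linear_sum; apply: eq_bigr => k _.
by rewrite [LHS](linearZ_LR A') [RHS](linearZ_LR B'); congr (_ *: _); exact: AB.
Qed.

Lemma tp_pure0 x j : tp_pure T (dfwith x j 0) = 0.
Proof.
have := tp_multilinear T x 1 (0 : H j) 0; rewrite scaler0 addr0 scale1r => /eqP.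
by rewrite -subr_eq0 opprD addrA subrr sub0r oppr_eq0 => /eqP.
Qed.

Lemma tp_pureZ x j a (u : H j) : tp_pure T (dfwith x j (a *: u)) = a *: tp_pure T (dfwith x j u).
Proof. by rewrite -[a *: u]addr0 tp_multilinear tp_pure0 addr0. Qed.

Lemma tp_pureD x j (u v : H j) : tp_pure T (dfwith x j (u + v)) =
  tp_pure T (dfwith x j u) + tp_pure T (dfwith x j v).
Proof. by rewrite -[u]scale1r tp_multilinear !scale1r. Qed.

Lemma tp_lift_pure2 j (A B : {linear H j -> H j}) x :
  tp_lift T A (tp_lift T B (tp_pure T x)) = tp_pure T (dfwith x j (A (B (x j)))).
Proof. by rewrite !tp_lift_pure dfwithin dfwith_twice. Qed.

Lemma tp_lift_comm j k (A : {linear H j -> H j}) (B : {linear H k -> H k}) u :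
  j != k -> tp_lift T A (tp_lift T B u) = tp_lift T B (tp_lift T A u).
Proof.
move=> jk; move: u; apply: tp_ext => [c u w|c u w|x]; rewrite ?linearP//.
rewrite !tp_lift_pure (dfwithout _ _ jk) (dfwithout x (B (x k))) 1?eq_sym//.
by rewrite dfwith_swap// eq_sym.
Qed.

Lemma tp_lift_rel j (A B C : {linear H j -> H j}) (c : R[i]) :
  (forall u, A (B u) = B (A u) + c *: C u) ->
  forall u, tp_lift T A (tp_lift T B u) = tp_lift T B (tp_lift T A u) + c *: tp_lift T C u.
Proof.
move=> ABC; apply: tp_ext => [a u w|a u w|x].
- by rewrite !linearP.
- rewrite (linearP (tp_lift T A)) (linearP (tp_lift T B)) (linearP (tp_lift T C)).
  by rewrite !scalerDr !scalerA [c * a]mulrC addrACA.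
- by rewrite !tp_lift_pure2 ABC tp_pureD tp_pureZ tp_lift_pure.
Qed.

(** After expansion of both arguments into pure tensors, the two products of inner products differ
    in the [j]-th factor only. *)
Lemma tp_lift_adj j (A B : {linear H j -> H j}) (c : R[i]) :
  (forall x y, dH j (A x) y = c * dH j x (B y)) ->
  forall u v, tp_dot T (tp_lift T A u) v = c * tp_dot T u (tp_lift T B v).
Proof.
move=> AB u v; have [n [a [x ->]]] := tp_span u; have [m [b [y ->]]] := tp_span v.
have LL (X : {linear T -> T}) p (d : 'I_p -> R[i]) (z : 'I_p -> T) :
    X (\sum_k d k *: z k) = \sum_k d k *: X (z k).
  by rewrite linear_sum; apply: eq_bigr => k _; rewrite linearZ_LR.
have E1 p (d : 'I_p -> R[i]) (z : 'I_p -> T) w :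
    tp_dot T (\sum_k d k *: z k) w = \sum_k d k * tp_dot T (z k) w.
  by rewrite linear_sumlz; apply: eq_bigr => k _; rewrite linearZl_LR.
have E2 p (d : 'I_p -> R[i]) (z : 'I_p -> T) w :
    tp_dot T w (\sum_k d k *: z k) = \sum_k Num.conj (d k) * tp_dot T w (z k).
  by rewrite linear_sumr; apply: eq_bigr => k _; rewrite linearZr_LR.
rewrite !LL !E1 mulr_sumr; apply: eq_bigr => k _.
rewrite !E2 !mulr_sumr; apply: eq_bigr => l _; rewrite !tp_lift_pure !tp_dot_pure.
rewrite [X in _ * (_ * X) = _](bigD1 j)//= [X in _ = _ * (_ * (_ * X))](bigD1 j)//= !dfwithin AB.
set P := \prod_(i < N | _) _; set Q := \prod_(i < N | _) _.
have -> : P = Q by apply: eq_bigr => i ij; rewrite !dfwithout// eq_sym.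
by ring.
Qed.

End tensor.

Section rep.
Context {R : realType} {F : real_form} {s : int} (L : lowest_weight_module R F s).

(** The solutions of this eigenvalue equation form an invariant subspace, since the Casimir commutes
    with the generators, and it contains the vacuum; irreducibility makes it everything. The scalar
    is read off on the vacuum. *)
Lemma lwm_casimir (u : L) :
  2%:R^-1 *: lwm_h L (lwm_h L u) + lwm_f L (lwm_e L u) + lwm_e L (lwm_f L u) =
  (s%:~R * (s%:~R - 2) / 2) *: u.
Proof.
have he w : lwm_h L (lwm_e L w) = lwm_e L (lwm_h L w) + 2%:R *: lwm_e L w.
  by rewrite -lwm_he addrC subrK.
have hf w : lwm_h L (lwm_f L w) = lwm_f L (lwm_h L w) - 2%:R *: lwm_f L w.
  by rewrite -lwm_hf addrC subrK.
have ef w : lwm_e L (lwm_f L w) = lwm_f L (lwm_e L w) + lwm_h L w.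
  by rewrite -lwm_ef addrC subrK.
pose d := lwm_dot L.
have dD x y z : d (x + y) z = d x z + d y z by rewrite linearDl.
have dN x z : d (- x) z = - d x z by rewrite linearNl.
have dZ a x z : d (a *: x) z = a * d x z by rewrite linearZl_LR.
pose lin := (linearD (lwm_h L), linearD (lwm_e L), linearD (lwm_f L),
  raddfN (lwm_h L), raddfN (lwm_e L), raddfN (lwm_f L),
  linearZ_LR (lwm_h L), linearZ_LR (lwm_e L), linearZ_LR (lwm_f L)).
pose C w := 2%:R^-1 *: lwm_h L (lwm_h L w) + lwm_f L (lwm_e L w) + lwm_e L (lwm_f L w).
pose c : R[i] := s%:~R * (s%:~R - 2) / 2.
have [] := @lwm_irreducible _ _ _ L [set w | C w = c *: w].
- by rewrite /C/= !(linear0, scaler0, addr0).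
- move=> a x y /= Cx Cy; rewrite scalerDr scalerA [c * a]mulrC -scalerA -Cx -Cy /C !lin/=.
  by apply: (dot_ext (d := d)) => w; rewrite !(dD, dZ, dN); ring.
(* Commutation of [C] with the three generators: all words are brought to the order f, e, h and
   compared after pairing with a test vector. *)
- move=> w /= Cw; split; rewrite -lin -Cw /C.
  + do 4!rewrite ?(ef, he, hf, lin)/=; rewrite ?(ef, he, hf, lin).
    by apply: (dot_ext (d := d)) => z; rewrite !(dD, dZ, dN); field.
  + do 4!rewrite ?(ef, he, hf, lin)/=; rewrite ?(ef, he, hf, lin).
    by apply: (dot_ext (d := d)) => z; rewrite !(dD, dZ, dN); field.
  + do 4!rewrite ?(ef, he, hf, lin)/=; rewrite ?(ef, he, hf, lin).
    by apply: (dot_ext (d := d)) => z; rewrite !(dD, dZ, dN); field.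
- move=> P0; have : [set w | C w = c *: w] (lwm_vac L); last first.
    by rewrite P0 => /= v0; have := @lwm_vac_neq0 _ _ _ L; rewrite v0 eqxx.
  have fe : lwm_f L (lwm_e L (lwm_vac L)) = - (s%:~R *: lwm_vac L).
    have := ef (lwm_vac L); rewrite lwm_f_vac linear0 lwm_h_vac => /eqP.
    by rewrite eq_sym addrC addr_eq0 => /eqP->; rewrite opprK.
  rewrite /= /C lwm_h_vac linearZ/= lwm_h_vac lwm_f_vac linear0 addr0 fe !scalerA -scalerBl.
  by congr (_ *: _); rewrite /c; field.
- by move=> PT; have : [set w | C w = c *: w] u by rewrite PT.
Qed.

End rep.

(** * Limits and derivatives along a real variable of complex and vector valued functions *)

Section complex_limits.
Context {R : realType}.
Implicit Types (z : R[i]).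

Lemma normc_le_ReIm z : `|z| <= (`|complex.Re z| + `|complex.Im z|)%:C.
Proof.
rewrite {1}[z]complexE (le_trans (ler_normD _ _))// rmorphD/= lerD//.
  by rewrite normc_def/= expr0n/= addr0 sqrtr_sqr.
by rewrite normrM normc_def/= expr0n/= expr1n add0r sqrtr1 mul1r normc_def/= expr0n/= addr0 sqrtr_sqr.
Qed.

Lemma normc_ge_Im' z : `|complex.Im z|%:C <= `|z|.
Proof.
by case: z => a b; rewrite normc_def/= lecR -sqrtr_sqr ler_wsqrtr// lerDr sqr_ge0.
Qed.

Lemma cvg_complexP (X : Type) (F : set_system X) (FF : Filter F) (f : X -> R[i]) (l : R[i]) :
  f @ F --> l <->
  (fun x => complex.Re (f x)) @ F --> complex.Re l /\
  (fun x => complex.Im (f x)) @ F --> complex.Im l.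
Proof.
split=> [H|[HR HI]].
  split; apply/cvgrPdist_lt => e e0; have /cvgrPdist_lt/(_ e%:C) := H;
    rewrite ltcR => /(_ e0); apply: filterS => x; rewrite -ltcR; apply: le_lt_trans.
    by rewrite -raddfB/= normc_ge_Re.
  by rewrite -raddfB/= normc_ge_Im'.
apply/cvgrPdist_lt => e e0.
have [er e0'] : e = (complex.Re e)%:C /\ 0 < complex.Re e.
  by move: e0; case: e => a b; rewrite ltcE/= => /andP[/eqP -> ->].
have e2 : 0 < complex.Re e / 2 by rewrite divr_gt0.
have /cvgrPdist_lt/(_ _ e2) H1 := HR; have /cvgrPdist_lt/(_ _ e2) H2 := HI.
apply: filterS2 H1 H2 => x h1 h2; rewrite er.
apply: le_lt_trans (normc_le_ReIm _) _; rewrite ltcR !raddfB/=.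
by rewrite [ltRHS]splitr ltrD.
Qed.

Lemma cvgcZ (V : normedModType R[i]) (X : Type) (F : set_system X) (FF : Filter F)
    (f : X -> R[i]) (l : R[i]) (g : X -> V) m :
  f @ F --> l -> g @ F --> m -> (fun x => f x *: g x) @ F --> l *: m.
Proof. by move=> H H'; exact: (@cvgZ R[i] V X F FF f g l m H H'). Qed.

Lemma cvgvN (V : normedModType R[i]) (X : Type) (F : set_system X) (FF : Filter F)
    (g : X -> V) m : g @ F --> m -> (fun x => - g x) @ F --> - m.
Proof. exact: cvgN. Qed.

Lemma cvgvD (V : normedModType R[i]) (X : Type) (F : set_system X) (FF : Filter F)
    (f g : X -> V) l m : f @ F --> l -> g @ F --> m -> (fun x => f x + g x) @ F --> l + m.
Proof. exact: cvgD. Qed.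

Lemma cvgcD (X : Type) (F : set_system X) (FF : Filter F) (f g : X -> R[i]) (l m : R[i]) :
  f @ F --> l -> g @ F --> m -> (fun x => f x + g x) @ F --> l + m.
Proof. exact: cvgvD. Qed.

Lemma cvgcM (X : Type) (F : set_system X) (FF : Filter F) (f g: X -> R[i]) (l m : R[i]) :
  f @ F --> l -> g @ F --> m -> (fun x => f x * g x) @ F --> l * m.
Proof. by move=> H H'; exact: (@cvgcZ R[i] X F FF f l g m H H'). Qed.

Lemma cvgcV (X : Type) (F : set_system X) (FF : Filter F) (f : X -> R[i]) (l : R[i]) :
  l != 0 -> f @ F --> l -> (fun x => (f x)^-1) @ F --> l^-1.
Proof. by move=> l0 H; exact: (@cvgV R[i] X F FF f l l0 H). Qed.

Lemma is_rderiveP (f : R -> R[i]) (x : R) (l : R[i]) :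
  is_rderive f x l <->
  (fun h => h^-1 * (complex.Re (f (x + h)) - complex.Re (f x))) @ 0^' --> complex.Re l /\
  (fun h => h^-1 * (complex.Im (f (x + h)) - complex.Im (f x))) @ 0^' --> complex.Im l.
Proof.
rewrite /is_rderive; have E h : (h%:C)^-1 *: (f (x + h) - f x) =
    (h^-1 * (complex.Re (f (x + h)) - complex.Re (f x))) +i*
    (h^-1 * (complex.Im (f (x + h)) - complex.Im (f x))) :> R[i].
  rewrite /GRing.scale/= -fmorphV/= [f (x + h) - f x]complexE !raddfB/=.
  by apply/eqP; rewrite eq_complex/=; apply/andP; split; apply/eqP; rewrite /=; ring.
under eq_fun do rewrite E.
split=> [/cvg_complexP//|H]; exact/cvg_complexP.
Qed.

Lemma rderiveE (f : R -> R[i]) (x : R) (l : R[i]) : is_rderive f x l -> rderive f x = l.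
Proof. by move=> H; apply: cvg_lim. Qed.

Lemma is_rderive_unique (f : R -> R[i]) (x : R) (l l' : R[i]) :
  is_rderive f x l -> is_rderive f x l' -> l = l'.
Proof. by move=> /rderiveE <- /rderiveE. Qed.

Lemma eq_is_rderive {V : normedModType R[i]} (f f' : R -> V) x l :
  (forall y, f y = f' y) -> is_rderive f x l -> is_rderive f' x l.
Proof. by move=> /funext ->. Qed.

Section V.
Context {V : normedModType R[i]}.
Implicit Types (f : R -> V).

Lemma is_rderive_cts f x l : is_rderive f x l -> (fun h => f (x + h)) @ 0^' --> f x.
Proof.
move=> H.
have H0 : (fun h : R => h%:C) @ 0^' --> (0 : R[i]).
  apply/cvg_complexP; split; last exact: cvg_cst.
  by apply: cvg_within_filter; exact: cvg_id.
have H1 : (fun h => h%:C *: ((h%:C)^-1 *: (f (x + h) - f x)) + f x) @ 0^' --> 0 *: l + f x.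
  by apply: cvgD; [exact: cvgZ|exact: cvg_cst].
rewrite -[X in _ --> X]add0r -[X in X + _](scale0r l).
apply: cvg_trans H1; apply: near_eq_cvg; near=> h.
have h0 : h != 0 by near: h; exact: nbhs_dnbhs_neq.
rewrite /= scalerA divff ?scale1r ?subrK//.
by rewrite (_ : 0 = 0%:C) // (inj_eq (@complexI R)).
Unshelve. all: by end_near. Qed.

Lemma is_rderive_cst (a : V) x : is_rderive (fun=> a) x 0.
Proof. by rewrite /is_rderive; under eq_fun do rewrite subrr scaler0; exact: cvg_cst. Qed.

Lemma is_rderiveD f f' x l l' : is_rderive f x l -> is_rderive f' x l' ->
  is_rderive (fun y => f y + f' y) x (l + l').
Proof.
move=> H H'.
have H1 : (fun h => (h%:C)^-1 *: (f (x + h) - f x) + (h%:C)^-1 *: (f' (x + h) - f' x)) @ 0^' --> l + l'.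
  by apply: cvgD.
apply: cvg_trans H1; apply: near_eq_cvg; near=> h.
by rewrite /= -scalerDr opprD addrACA.
Unshelve. all: by end_near. Qed.

End V.

Lemma is_rderiveZ {V : normedModType R[i]} (a : R -> R[i]) (f : R -> V) x a' l : is_rderive a x a' -> is_rderive f x l ->
  is_rderive (fun y => a y *: f y) x (a x *: l + a' *: f x).
Proof.
move=> Ha Hf.
have H1 : (fun h => a (x + h) *: ((h%:C)^-1 *: (f (x + h) - f x))) @ 0^' --> a x *: l.
  by apply: cvgcZ; [exact: (is_rderive_cts Ha)|exact: Hf].
have H2 : (fun h => ((h%:C)^-1 *: (a (x + h) - a x)) *: f x) @ 0^' --> a' *: f x.
  by apply: cvgcZ; [exact: Ha|exact: cvg_cst].
have H3 : (fun h => a (x + h) *: ((h%:C)^-1 *: (f (x + h) - f x)) +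
   ((h%:C)^-1 *: (a (x + h) - a x)) *: f x) @ 0^' --> a x *: l + a' *: f x.
  by apply: cvgD.
apply: cvg_trans H3; apply: near_eq_cvg; near=> h.
rewrite /= scalerA [a (x + h) * _]mulrC -!scalerA -scalerDr; congr (_ *: _).
by rewrite scalerBr scalerBl addrA subrK.
Unshelve. all: by end_near. Qed.

Lemma is_rderiveM (a b : R -> R[i]) x a' b' : is_rderive a x a' -> is_rderive b x b' ->
  is_rderive (fun y => a y * b y) x (a' * b x + a x * b').
Proof. by move=> Ha Hb; rewrite addrC; have := is_rderiveZ Ha Hb; rewrite /GRing.scale/=. Qed.

Lemma is_rderive_sum {V : normedModType R[i]} (I : Type) (r : seq I) (P : pred I)
    (f : I -> R -> V) x (l : I -> V) :
  (forall i, P i -> is_rderive (f i) x (l i)) ->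
  is_rderive (fun y => \sum_(i <- r | P i) f i y) x (\sum_(i <- r | P i) l i).
Proof.
move=> H; elim: r => [|i r IH].
  rewrite big_nil; apply: (@eq_is_rderive _ (fun=> 0)); last exact: is_rderive_cst.
  by move=> y; rewrite big_nil.
rewrite big_cons; case: ifP => Pi.
  apply: (@eq_is_rderive _ (fun y => f i y + \sum_(i <- r | P i) f i y)); first by move=> y; rewrite big_cons Pi.
  by apply: is_rderiveD; [exact: H|].
by apply: eq_is_rderive IH => y; rewrite big_cons Pi.
Qed.

Lemma is_rderive_prod (I : Type) (r : seq I) (P : pred I)
    (f : I -> R -> R[i]) x (l : I -> R[i]) :
  (forall i, P i -> is_rderive (f i) x (l i * f i x)) ->
  is_rderive (fun y => \prod_(i <- r | P i) f i y) x
    ((\sum_(i <- r | P i) l i) * \prod_(i <- r | P i) f i x).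
Proof.
move=> H; elim: r => [|i r IH].
  rewrite !big_nil mul0r; apply: (@eq_is_rderive R[i] (fun=> 1)); last exact: is_rderive_cst.
  by move=> y; rewrite big_nil.
rewrite !big_cons; case: ifP => Pi; last by apply: eq_is_rderive IH => y; rewrite big_cons Pi.
apply: (@eq_is_rderive _ (fun y => f i y * \prod_(i <- r | P i) f i y)); first by move=> y; rewrite big_cons Pi.
rewrite (_ : _ * _ = l i * f i x * (\prod_(i0 <- r | P i0) f i0 x) +
  f i x * ((\sum_(i0 <- r | P i0) l i0) * (\prod_(i0 <- r | P i0) f i0 x))); last by ring.
by apply: is_rderiveM; [exact: H|].
Qed.

Lemma is_rderiveV (f : R -> R[i]) x l : f x != 0 -> is_rderive f x l ->
  is_rderive (fun y => (f y)^-1) x (- l / f x ^+ 2).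
Proof.
move=> fx0 H.
have cf := is_rderive_cts H.
have nf : \forall h \near 0^', f (x + h) != 0.
  have /cvgrPdist_lt/(_ `|f x|) := cf; rewrite normr_gt0 => /(_ fx0).
  apply: filterS => h; apply: contraTneq => ->; by rewrite subr0 ltxx.
have H1 : (fun h => - ((h%:C)^-1 *: (f (x + h) - f x)) * ((f (x + h))^-1 * (f x)^-1)) @ 0^'
   --> - l * ((f x)^-1 * (f x)^-1).
  apply: cvgcM; first exact: (cvgvN _ H).
  by apply: cvgcM; [exact: cvgcV|exact: cvg_cst].
rewrite /is_rderive (_ : _ / _ = - l * ((f x)^-1 * (f x)^-1)); last by rewrite expr2 invfM.
apply: cvg_trans H1; apply: near_eq_cvg; near=> h.
have fh0 : f (x + h) != 0 by near: h.
rewrite -[LHS]/(- ((h%:C)^-1 * (f (x + h) - f x)) * ((f (x + h))^-1 / f x)).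
rewrite -[RHS]/((h%:C)^-1 * ((f (x + h))^-1 - (f x)^-1)).
move: (h%:C^-1) fh0 fx0 => k; move: (f (x + h)) (f x) => p q p0 q0.
by field; rewrite p0 q0.
Unshelve. all: by end_near. Qed.

Lemma near_is_rderive {V : normedModType R[i]} (f f' : R -> V) x l :
  f x = f' x -> (\forall h \near 0^', f (x + h) = f' (x + h)) ->
  is_rderive f x l -> is_rderive f' x l.
Proof.
move=> fx nf H; apply: cvg_trans H; apply: near_eq_cvg; near=> h.
by rewrite fx; congr (_ *: (_ - _)); near: h.
Unshelve. all: by end_near. Qed.

Lemma cexpD (a b : R[i]) : cexp (a + b) = cexp a * cexp b.
Proof.
rewrite /cexp !raddfD/= expRD sinD cosD; apply/eqP; rewrite eq_complex /=.
by apply/andP; split; apply/eqP; ring.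
Qed.

Lemma cexp0 : cexp 0 = 1 :> R[i].
Proof. by rewrite /cexp/= expR0 sin0 cos0 mul1r. Qed.

Lemma cexp_neq0 (a : R[i]) : cexp a != 0.
Proof.
apply/eqP => H; have := cexpD a (- a); rewrite subrr cexp0 H mul0r => /eqP.
by rewrite oner_eq0.
Qed.

Lemma is_rderive_cexp (L : R -> R[i]) x l : is_rderive L x l ->
  is_rderive (fun y => cexp (L y)) x (l * cexp (L x)).
Proof.
move=> /is_rderiveP[H1 H2].
pose u := fun y => complex.Re (L y); pose v := fun y => complex.Im (L y).
have Du : is_derive x 1 u (complex.Re l) by apply/is_deriveP; exact: H1.
have Dv : is_derive x 1 v (complex.Im l) by apply/is_deriveP; exact: H2.
have De := @is_derive1_comp _ expR u x _ _ (is_derive_expR _) Du.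
have Dc := @is_derive1_comp _ cos v x _ _ (is_derive_cos _) Dv.
have Ds := @is_derive1_comp _ sin v x _ _ (is_derive_sin _) Dv.
have /is_deriveP M1 := is_deriveM De Dc.
have /is_deriveP M2 := is_deriveM De Ds.
have ER y : complex.Re (cexp (L y)) = expR (u y) * cos (v y) by rewrite /cexp/= mul0r subr0.
have EI y : complex.Im (cexp (L y)) = expR (u y) * sin (v y) by rewrite /cexp/= mul0r addr0.
apply/is_rderiveP; split.
  rewrite (funext (fun h => congr2 (fun p q => h^-1 * (p - q)) (ER (x + h)) (ER x))).
  move: M1; rewrite (_ : _ + _ = complex.Re (l * cexp (L x)))//.
  rewrite /cexp -/(u x) -/(v x) [l]complexE /=; rewrite /GRing.scale/=; ring.
rewrite (funext (fun h => congr2 (fun p q => h^-1 * (p - q)) (EI (x + h)) (EI x))).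
move: M2; rewrite (_ : _ + _ = complex.Im (l * cexp (L x)))//.
rewrite /cexp -/(u x) -/(v x) [l]complexE /=; rewrite /GRing.scale/=; ring.
Qed.

(** A merely continuous branch of the logarithm of a differentiable function is differentiable. The
    real part is half the logarithm of |f|^2. Near [x] the increment of the imaginary part is the
    arcsine of its own sine, and this sine is an explicit differentiable expression in [f]. *)
Lemma is_rderive_log (L f : R -> R[i]) x f' :
  (fun h => L (x + h)) @ 0^' --> L x -> cexp (L x) = f x ->
  (\forall h \near 0^', cexp (L (x + h)) = f (x + h)) ->
  is_rderive f x f' -> is_rderive L x (f' / f x).
Proof.
move=> /cvg_complexP[cu cv] fx fn Df.
(* Existence is enough: differentiating [cexp (L y) = f y] then determines the value. *)
suff [l Dl] : exists l, is_rderive L x l.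
  have D1 := is_rderive_cexp Dl.
  have D2 : is_rderive (fun y => cexp (L y)) x f'.
    by apply: near_is_rderive Df => //; apply: filterS fn => h ->.
  by rewrite (is_rderive_unique D2 D1) -fx mulfK ?cexp_neq0.
pose u := fun y => complex.Re (L y); pose v := fun y => complex.Im (L y).
have ER y : complex.Re (cexp (L y)) = expR (u y) * cos (v y) by rewrite /cexp/= mul0r subr0.
have EI y : complex.Im (cexp (L y)) = expR (u y) * sin (v y) by rewrite /cexp/= mul0r addr0.
have [DR DI] := (is_rderiveP _ _ _).1 Df.
pose a := fun y => complex.Re (f y); pose b := fun y => complex.Im (f y).
have {}DR : is_derive x 1 a (complex.Re f') by apply/is_deriveP; exact: DR.
have {}DI : is_derive x 1 b (complex.Im f') by apply/is_deriveP; exact: DI.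
have aE y : cexp (L y) = f y -> a y = expR (u y) * cos (v y) by move=> E; rewrite /a -E ER.
have bE y : cexp (L y) = f y -> b y = expR (u y) * sin (v y) by move=> E; rewrite /b -E EI.
pose q := fun y => a y * a y + b y * b y.
have qE y : cexp (L y) = f y -> q y = expR (u y + u y).
  move=> E; rewrite /q (aE _ E) (bE _ E) expRD.
  have := cos2Dsin2 (v y) => c2; transitivity (expR (u y) * expR (u y) * (cos (v y) ^+ 2 + sin (v y) ^+ 2)); last by rewrite c2 mulr1.
  ring.
pose u2 := fun y => 2^-1 * ln (q y).
have uE y : cexp (L y) = f y -> u y = u2 y.
  by move=> E; rewrite /u2 (qE _ E) expRK; field.
(* This is [sin (v y - v x)] wherever [cexp (L y) = f y], with every dependence on [y] expressed
   through [f]. *)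
pose s := fun y => expR (- u2 y) * expR (- u x) * (b y * a x - a y * b x).
have sE y : cexp (L y) = f y -> s y = sin (v y - v x).
  move=> E; rewrite /s -(uE _ E) (aE _ E) (bE _ E) (aE _ fx) (bE _ fx) sinB.
  have h1 := expRxMexpNx_1 (u y); have h2 := expRxMexpNx_1 (u x).
  transitivity ((expR (u y) * expR (- u y)) * (expR (u x) * expR (- u x)) *
     (sin (v y) * cos (v x) - cos (v y) * sin (v x))); first by ring.
  by rewrite h1 h2 !mul1r.
have qx : 0 < q x by rewrite (qE _ fx) expR_gt0.
have [lq Dq] : exists l, is_derive x 1 q l.
  have D := is_deriveD (is_deriveM DR DR) (is_deriveM DI DI).
  by eexists; exact: D.
have Dln := @is_derive1_comp _ (@ln R) q x _ _ (is_derive1_ln qx) Dq.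
have [lu2 Du2] : exists l, is_derive x 1 u2 l.
  have D := is_deriveM (is_derive_cst (2^-1 : R) x (1 : R)) Dln.
  by eexists; exact: D.
have [ls Ds] : exists l, is_derive x 1 s l.
  have DNu2 := is_deriveN Du2.
  have De := @is_derive1_comp _ expR (- u2) x _ _ (is_derive_expR _) DNu2.
  have De2 := is_deriveM De (is_derive_cst (expR (- u x)) x 1).
  have Dba := is_deriveM DI (is_derive_cst (a x) x 1).
  have Dab := is_deriveM DR (is_derive_cst (b x) x 1).
  have D := is_deriveM De2 (is_deriveB Dba Dab).
  by eexists; exact: D.
have s0 : s x = 0 by rewrite (sE _ fx) subrr sin0.
have Das : is_derive (s x) 1 asin (Num.sqrt (1 - s x ^+ 2))^-1.
  by apply: is_derive1_asin; rewrite s0 ltrN10 ltr01.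
have /is_deriveP Dv := @is_derive1_comp _ asin s x _ _ Das Ds.
have /is_deriveP Du := Du2.
exists (lu2 +i* ((Num.sqrt (1 - s x ^+ 2))^-1 * ls)).
apply/is_rderiveP; split => /=.
  apply: cvg_trans Du; apply: near_eq_cvg; near=> h.
  by rewrite -!uE //; near: h.
apply: cvg_trans Dv; apply: near_eq_cvg; near=> h.
have E : cexp (L (x + h)) = f (x + h) by near: h.
have asin0 : asin 0 = 0 :> R.
  rewrite -[in LHS]sin0 sinK// in_itv/=; have := pi_gt0 R; move=> ?; apply/andP; split; lra.
rewrite /= s0 asin0 subr0 (sE _ E) sinK//.
(* The assumed continuity of the branch enters here: it keeps the increment in the interval on which
   [asin] inverts [sin]. *)
have : `|v x - v (x + h)| < pi / 2.
  near: h; have /cvgrPdist_lt := cv; apply; rewrite divr_gt0// ?pi_gt0//.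
by rewrite in_itv/= ltr_norml => /andP[? ?]; apply/andP; split; lra.
Unshelve. all: by end_near. Qed.

End complex_limits.

(** * Symmetry of mixed partial derivatives *)

Definition has_partial (R : realType) (M : nat) (b : 'I_M) (f fb : 'rV[R]_M -> R) :=
  forall t, (fun h => h^-1 * (f (t + h *: delta_mx 0 b) - f t)) @ 0^' --> fb t.

Section schwarz.
Context {R : realType} {M : nat}.
Implicit Types (f : 'rV[R]_M -> R) (b c : 'I_M) (t : 'rV[R]_M).

Lemma partial_mvt b f fb t (x : R) : has_partial b f fb -> 0 < x ->
  exists2 y, 0 < y < x & f (t + x *: delta_mx 0 b) - f t = x * fb (t + y *: delta_mx 0 b).
Proof.
move=> H x0.
have D (y : R) : is_derive y 1 (fun z : R => f (t + z *: delta_mx 0 b)) (fb (t + y *: delta_mx 0 b)).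
  apply/is_deriveP; under eq_fun do rewrite scalerDl addrA.
  exact: H.
have [|y yx] := @MVT R (fun z : R => f (t + z *: delta_mx 0 b)) _ 0 x x0 (fun y _ => D y).
  apply: continuous_subspaceT => y; apply: differentiable_continuous.
  by apply/derivable1_diffP; have [] := D y.
by rewrite scale0r addr0 subr0 mulrC => E; exists y.
Qed.

Lemma second_difference b c f fb fbc t (x : R) : has_partial b f fb -> has_partial c fb fbc ->
  0 < x -> exists y z, [/\ 0 < y < x, 0 < z < x &
    f (t + x *: delta_mx 0 b + x *: delta_mx 0 c) - f (t + x *: delta_mx 0 b)
    - (f (t + x *: delta_mx 0 c) - f t) =
    x * (x * fbc (t + y *: delta_mx 0 b + z *: delta_mx 0 c))].
Proof.
move=> H H2 x0.
have H' : has_partial b (fun t => f (t + x *: delta_mx 0 c) - f t)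
    (fun t => fb (t + x *: delta_mx 0 c) - fb t).
  move=> u; have K := cvgB (H (u + x *: delta_mx 0 c)) (H u).
  under eq_fun do rewrite [u + _ *: delta_mx 0 b + _]addrAC.
  rewrite (_ : (fun h : R => _) = (fun h : R =>
    h^-1 * (f (u + x *: delta_mx 0 c + h *: delta_mx 0 b) - f (u + x *: delta_mx 0 c)) -
    h^-1 * (f (u + h *: delta_mx 0 b) - f u))); first exact: K.
  by apply/funext => h; ring.
have [y yx E] := partial_mvt t H' x0.
have [z zx E2] := partial_mvt (t + y *: delta_mx 0 b) H2 x0.
by exists y, z; split => //; rewrite E E2.
Qed.

(** The second difference of [f] over a small square is symmetric in the two directions. The mean
    value theorem, applied twice in either order, makes it x^2 times either mixed derivative at a
    nearby point. *)
Lemma schwarz b c f fb fc fbc fcb t : has_partial b f fb -> has_partial c fb fbc ->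
  has_partial c f fc -> has_partial b fc fcb -> continuous fbc -> continuous fcb ->
  fbc t = fcb t.
Proof.
move=> Hb Hbc Hc Hcb cbc ccb.
have near_t (g : 'rV[R]_M -> R) (p q : 'I_M) (e : R) : continuous g -> 0 < e ->
   \forall x \near (0 : R)^'+, forall y z, 0 < y < x -> 0 < z < x ->
   `|g (t + y *: delta_mx 0 p + z *: delta_mx 0 q) - g t| < e.
  move=> cg e0.
  have cG : continuous (fun u : R * R => g (t + u.1 *: delta_mx 0 p + u.2 *: delta_mx 0 q)).
    move=> u; apply: continuous_comp; last exact: cg.
    apply: cvgD; last by apply: cvgZ; [exact: cvg_snd|exact: cvg_cst].
    apply: cvgD; first exact: cvg_cst.
    by apply: cvgZ; [exact: cvg_fst|exact: cvg_cst].
  have := cG (0, 0) => /cvgrPdist_lt/(_ _ e0) [[A B] /= [/nbhs_ballP[d1 d10 dA] /nbhs_ballP[d2 d20 dB]] AB].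
  near=> x => y z /andP[y0 yx] /andP[z0 zx].
  have xd1 : x < d1 by near: x; exact: nbhs_right_lt.
  have xd2 : x < d2 by near: x; exact: nbhs_right_lt.
  have := AB (y, z); rewrite /= !scale0r !addr0 distrC; apply; split.
    by apply: dA; rewrite /ball/= sub0r normrN gtr0_norm// (lt_trans yx).
  by apply: dB; rewrite /ball/= sub0r normrN gtr0_norm// (lt_trans zx).
apply/eqP; rewrite -subr_eq0 -normr_le0; apply/ler_addgt0Pl => e e0; rewrite addr0.
have e2 : 0 < e / 2 by rewrite divr_gt0.
have N1 := near_t fbc b c _ cbc e2; have N2 := near_t fcb c b _ ccb e2.
have [x [x0 [h1 h2]]] : exists x : R, 0 < x /\
   ((forall y z, 0 < y < x -> 0 < z < x -> `|fbc (t + y *: delta_mx 0 b + z *: delta_mx 0 c) - fbc t| < e / 2) /\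
    (forall y z, 0 < y < x -> 0 < z < x -> `|fcb (t + y *: delta_mx 0 c + z *: delta_mx 0 b) - fcb t| < e / 2)).
  apply: (@filter_ex _ (0 : R)^'+); near=> x; split; first by near: x; exact: nbhs_right_gt.
  by split; near: x.
have [y [z [yx zx E1]]] := second_difference t Hb Hbc x0.
have [y' [z' [yx' zx' E2]]] := second_difference t Hc Hcb x0.
have E : fbc (t + y *: delta_mx 0 b + z *: delta_mx 0 c) = fcb (t + y' *: delta_mx 0 c + z' *: delta_mx 0 b).
  have x0' : x != 0 by rewrite gt_eqF.
  apply: (mulfI x0'); apply: (mulfI x0'); rewrite -E1 -E2 [t + x *: delta_mx 0 c + _]addrAC; ring.
have := h1 _ _ yx zx; have := h2 _ _ yx' zx'; rewrite E => k1 k2.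
rewrite (_ : _ - _ = (fcb (t + y' *: delta_mx 0 c + z' *: delta_mx 0 b) - fcb t)
  - (fcb (t + y' *: delta_mx 0 c + z' *: delta_mx 0 b) - fbc t)); last by ring.
by rewrite [e]splitr (le_trans (ler_normB _ _))// ltW// ltrD.
Unshelve. all: by end_near. Qed.

End schwarz.

Section smooth.
Context {R : realType} {M : nat}.
Implicit Types (f : 'rV[R]_M -> R[i]) (b c : 'I_M).

Lemma Ck_continuous k f : Ck k f -> continuous f.
Proof. by case: k => [|k] []. Qed.

Lemma Ck_rpartial k f b t : Ck k.+1 f ->
  is_rderive (fun h => f (t + h *: delta_mx 0 b)) 0 (rpartial b f t).
Proof.
by move=> [_ /(_ b)[/(_ t)[l Hl] _]]; rewrite /rpartial (rderiveE Hl).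
Qed.

Lemma CkS k f b : Ck k.+1 f -> Ck k (rpartial b f).
Proof. by move=> [_ /(_ b)[]]. Qed.

Lemma continuous_complexP (X : topologicalType) (f : X -> R[i]) : continuous f <->
  continuous (fun x => complex.Re (f x)) /\ continuous (fun x => complex.Im (f x)).
Proof.
split=> [cf|[c1 c2] x]; first by split=> x; have /cvg_complexP[] := cf x.
by apply/cvg_complexP; split; [exact: c1|exact: c2].
Qed.

Lemma has_partial_Re b f g : (forall t, is_rderive (fun h => f (t + h *: delta_mx 0 b)) 0 (g t)) ->
  has_partial b (fun t => complex.Re (f t)) (fun t => complex.Re (g t)) /\
  has_partial b (fun t => complex.Im (f t)) (fun t => complex.Im (g t)).
Proof.
move=> H; split=> t; have /is_rderiveP[K1 K2] := H t.
  by move: K1; under eq_fun do rewrite add0r scale0r addr0.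
by move: K2; under eq_fun do rewrite add0r scale0r addr0.
Qed.

Lemma Ck_schwarz f b c t : Ck 2 f -> rpartial c (rpartial b f) t = rpartial b (rpartial c f) t.
Proof.
move=> Cf.
have [b1 b2] := has_partial_Re (fun t => Ck_rpartial (b:=b) (t:=t) Cf).
have [c1 c2] := has_partial_Re (fun t => Ck_rpartial (b:=c) (t:=t) Cf).
have [bc1 bc2] := has_partial_Re (fun t => Ck_rpartial (b:=c) (t:=t) (CkS b Cf)).
have [cb1 cb2] := has_partial_Re (fun t => Ck_rpartial (b:=b) (t:=t) (CkS c Cf)).
have /continuous_complexP[k1 k2] := Ck_continuous (CkS c (CkS b Cf)).
have /continuous_complexP[l1 l2] := Ck_continuous (CkS b (CkS c Cf)).
have e1 := @schwarz R M b c (fun t => complex.Re (f t)) _ _ (fun t => complex.Re (rpartial c (rpartial b f) t)) (fun t => complex.Re (rpartial b (rpartial c f) t)) t b1 bc1 c1 cb1 k1 l1.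
have e2 := @schwarz R M b c (fun t => complex.Im (f t)) _ _ (fun t => complex.Im (rpartial c (rpartial b f) t)) (fun t => complex.Im (rpartial b (rpartial c f) t)) t b2 bc2 c2 cb2 k2 l2.
apply/eqP; rewrite eq_complex; apply/andP; split; apply/eqP; [exact: e1|exact: e2].
Qed.

End smooth.

(** * Integrals of complex functions over the cube *)

Section cube_integrals.
Context {R : realType} {M : nat}.
Implicit Types (f : 'rV[R]_M -> R[i]).

Let ucube := @unit_cube R M.

Lemma within_complexP (A : set 'rV[R]_M) f : {within A, continuous f} <->
  {within A, continuous (fun x => complex.Re (f x))} /\
  {within A, continuous (fun x => complex.Im (f x))}.
Proof. exact: (@continuous_complexP R (subspace A) f). Qed.

Lemma rcube_sum (I : Type) (r : seq I) (a : I -> R) (f : I -> 'rV[R]_M -> R) :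
  (forall i, {within ucube, continuous (f i)}) ->
  rcube (fun t => \sum_(i <- r) a i * f i t) = \sum_(i <- r) a i * rcube (f i).
Proof.
move=> cf.
have E i : rcube (f i) = rcube (f i \o @clamp R M).
  by apply: eq_rcube => t ut /=; rewrite clampE.
under eq_bigr do rewrite E.
rewrite (@eq_rcube _ _ _ (fun t => \sum_(i <- r) a i * (f i \o @clamp R M) t)); last first.
  by move=> t ut; apply: eq_bigr => i _ /=; rewrite clampE.
have cfc i : continuous (f i \o @clamp R M) by exact: continuous_comp_clamp.
have cS (r' : seq I) : continuous (fun t => \sum_(i <- r') a i * (f i \o @clamp R M) t).
  elim: r' => [|i r' IH].
    rewrite (_ : (fun t => _) = fun=> 0); first by move=> t; exact: cst_continuous.
    by apply/funext => t; rewrite big_nil.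
  rewrite (_ : (fun t => _) = fun t => a i * (f i \o @clamp R M) t + \sum_(i <- r') a i * (f i \o @clamp R M) t).
    by apply: continuous_add => //; apply: continuous_mul => //; move=> t; exact: cst_continuous.
  by apply/funext => t; rewrite big_cons.
elim: r => [|i r IH].
  rewrite big_nil (_ : (fun t => _) = fun=> 0); last by apply/funext => t; rewrite big_nil.
  have c0 : continuous (fun _ : 'rV[R]_M => (0 : R)) by move=> t; exact: cst_continuous.
  have := rcubeP (-1) c0 c0; rewrite (_ : (fun t => _) = fun=> 0); last by apply/funext => t; rewrite mulr0 addr0.
  by rewrite mulN1r addNr.
rewrite big_cons -IH -rcubeP//; congr rcube; apply/funext => t; by rewrite big_cons.
Qed.

End cube_integrals.

Lemma cube_integralE (R : realType) (M : nat) (f : 'rV[R]_M -> R[i]) :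
  cube_integral f = rcube (fun t => complex.Re (f t)) +i* rcube (fun t => complex.Im (f t)).
Proof.
elim: M f => [|M IH] f /=; first by case: (f 0).
by rewrite /integral01; congr (_ +i* _); apply: eq_Rintegral => x _; rewrite IH.
Qed.

Lemma eq_cube_integral (R : realType) (M : nat) (f f' : 'rV[R]_M -> R[i]) :
  (forall t, unit_cube t -> f t = f' t) -> cube_integral f = cube_integral f'.
Proof.
by move=> H; rewrite !cube_integralE; congr (_ +i* _); apply: eq_rcube => t ut; rewrite H.
Qed.

Lemma cube_integral_sum (R : realType) (M : nat) (I : Type) (r : seq I) (a : I -> R[i])
    (f : I -> 'rV[R]_M -> R[i]) :
  (forall i, {within @unit_cube R M, continuous (f i)}) ->
  cube_integral (fun t => \sum_(i <- r) a i * f i t) = \sum_(i <- r) a i * cube_integral (f i).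
Proof.
move=> cf.
have cR i := ((within_complexP _ _).1 (cf i)).1.
have cI i := ((within_complexP _ _).1 (cf i)).2.
have ReS (I' : Type) (s : seq I') (z : I' -> R[i]) : complex.Re (\sum_(i <- s) z i) = \sum_(i <- s) complex.Re (z i).
  by elim/big_rec2: _ => //= i x y _ <-; case: (z i) => ? ?; case: y.
have ImS (I' : Type) (s : seq I') (z : I' -> R[i]) : complex.Im (\sum_(i <- s) z i) = \sum_(i <- s) complex.Im (z i).
  by elim/big_rec2: _ => //= i x y _ <-; case: (z i) => ? ?; case: y.
rewrite cube_integralE.
pose F (k : bool) i := if k then (fun t => complex.Re (f i t)) else (fun t => complex.Im (f i t)).
have cF k i : {within @unit_cube R M, continuous (F k i)} by case: k; [exact: cR|exact: cI].
have lin2 (x y : I -> R) :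
   rcube (fun t => \sum_(i <- r) (x i * complex.Re (f i t) + y i * complex.Im (f i t))) =
   \sum_(i <- r) (x i * rcube (fun t => complex.Re (f i t)) + y i * rcube (fun t => complex.Im (f i t))).
  (* The real or imaginary part of a complex combination is a real combination of twice as many
     functions; the index list is doubled so that [rcube_sum] covers both kinds at once. *)
  pose r2 := [seq (b, i) | b <- [:: true; false], i <- r].
  have S (z : bool * I -> R) : \sum_(p <- r2) z p = \sum_(i <- r) (z (true, i) + z (false, i)).
    by rewrite /r2 /= cats0 big_cat !big_map/= big_split.
  have := @rcube_sum R M _ r2 (fun p => if p.1 then x p.2 else y p.2) (fun p => F p.1 p.2) (fun p => cF _ _).
  rewrite S/= => <-; congr rcube; apply/funext => t; by rewrite S.
apply/eqP; rewrite eq_complex /= ReS ImS; apply/andP; split; apply/eqP.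
  rewrite (_ : (fun t => _) = fun t => \sum_(i <- r) (complex.Re (a i) * complex.Re (f i t) + (- complex.Im (a i)) * complex.Im (f i t))).
    rewrite lin2; apply: eq_bigr => i _; rewrite cube_integralE; case: (a i) => p q /=; ring.
  by apply/funext => t; rewrite ReS; apply: eq_bigr => i _; case: (a i) (f i t) => ? ? [? ?] /=; ring.
rewrite (_ : (fun t => _) = fun t => \sum_(i <- r) (complex.Im (a i) * complex.Re (f i t) + complex.Re (a i) * complex.Im (f i t))).
  rewrite lin2; apply: eq_bigr => i _; rewrite cube_integralE; case: (a i) => p q /=; ring.
by apply/funext => t; rewrite ImS; apply: eq_bigr => i _; case: (a i) (f i t) => ? ? [? ?] /=; ring.
Qed.

Lemma cube_integral_partial (R : realType) (M : nat) (b : 'I_M) (f F : 'rV[R]_M -> R[i]) :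
  {within @unit_cube R M, continuous f} -> {within @unit_cube R M, continuous F} ->
  (forall t, unit_cube t -> 0 < t 0 b < 1 ->
    is_rderive (fun h => F (t + h *: delta_mx 0 b)) 0 (f t)) ->
  cube_integral f = cube_integral (fun t => F (face b true t)) -
    cube_integral (fun t => F (face b false t)).
Proof.
move=> /within_complexP[cf1 cf2] /within_complexP[cF1 cF2] H; rewrite !cube_integralE.
have H1 t : unit_cube t -> 0 < t 0 b < 1 ->
   (fun h => h^-1 * (complex.Re (F (t + h *: delta_mx 0 b)) - complex.Re (F t))) @ 0^' --> complex.Re (f t).
  by move=> ut tb; have /is_rderiveP[+ _] := H t ut tb; under eq_fun do rewrite add0r scale0r addr0.
have H2 t : unit_cube t -> 0 < t 0 b < 1 ->
   (fun h => h^-1 * (complex.Im (F (t + h *: delta_mx 0 b)) - complex.Im (F t))) @ 0^' --> complex.Im (f t).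
  by move=> ut tb; have /is_rderiveP[_ +] := H t ut tb; under eq_fun do rewrite add0r scale0r addr0.
by rewrite (rcube_partial cf1 cF1 H1) (rcube_partial cf2 cF2 H2).
Qed.

Section complex_continuity.
Context {R : realType} {X : topologicalType}.
Implicit Types f g : X -> R[i].

Lemma continuous_cM f g : continuous f -> continuous g -> continuous (fun x => f x * g x).
Proof. by move=> cf cg x; apply: cvgcM; [exact: cf|exact: cg]. Qed.

Lemma continuous_vD {V : normedModType R[i]} (f g : X -> V) :
  continuous f -> continuous g -> continuous (fun x => f x + g x).
Proof. by move=> cf cg x; apply: cvgD; [exact: cf|exact: cg]. Qed.

Lemma continuous_ccst (c : R[i]) : continuous (fun _ : X => c).
Proof. by move=> x; exact: cvg_cst. Qed.

Lemma continuous_csum (I : Type) (r : seq I) (P : pred I) (f : I -> X -> R[i]) :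
  (forall i, P i -> continuous (f i)) -> continuous (fun x => \sum_(i <- r | P i) f i x).
Proof.
move=> cf; elim: r => [|i r IH].
  by rewrite (_ : (fun x => _) = fun=> 0); [exact: continuous_ccst|apply/funext => x; rewrite big_nil].
case Pi : (P i).
  rewrite (_ : (fun x => _) = fun x => f i x + \sum_(i <- r | P i) f i x); last by apply/funext => x; rewrite big_cons Pi.
  exact: (@continuous_vD R[i] _ _ (cf i Pi) IH).
by rewrite (_ : (fun x => _) = fun x => \sum_(i <- r | P i) f i x); last by apply/funext => x; rewrite big_cons Pi.
Qed.

Lemma continuous_cprod (I : Type) (r : seq I) (P : pred I) (f : I -> X -> R[i]) :
  (forall i, P i -> continuous (f i)) -> continuous (fun x => \prod_(i <- r | P i) f i x).
Proof.
move=> cf; elim: r => [|i r IH].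
  by rewrite (_ : (fun x => _) = fun=> 1); [exact: continuous_ccst|apply/funext => x; rewrite big_nil].
case Pi : (P i).
  rewrite (_ : (fun x => _) = fun x => f i x * \prod_(i <- r | P i) f i x); last by apply/funext => x; rewrite big_cons Pi.
  exact: (continuous_cM (cf i Pi) IH).
by rewrite (_ : (fun x => _) = fun x => \prod_(i <- r | P i) f i x); last by apply/funext => x; rewrite big_cons Pi.
Qed.

End complex_continuity.

(** * Stokes for one singular cube *)

(** In contrast to [is_rderive_prod], no derivative has to be a multiple of its factor: this version
    is for products of Jacobian entries, which may vanish. *)
Lemma is_rderive_bigprod (R : realType) (I : finType) (P : pred I) (f : I -> R -> R[i]) x
    (l : I -> R[i]) : (forall k, P k -> is_rderive (f k) x (l k)) ->
  is_rderive (fun y => \prod_(k | P k) f k y) x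
    (\sum_(p | P p) l p * \prod_(k | P k && (k != p)) f k x).
Proof.
move=> H.
have G (r : seq I) : uniq r -> is_rderive (fun y => \prod_(k <- r | P k) f k y) x
    (\sum_(p <- r | P p) l p * \prod_(k <- r | P k && (k != p)) f k x).
  elim: r => [_|i r IH /= /andP[ir ur]].
    rewrite big_nil; apply: (@eq_is_rderive _ R[i] (fun=> 1)); last exact: is_rderive_cst.
    by move=> y; rewrite big_nil.
  have E (p : I) : p \in r -> P p ->
     l p * \prod_(k <- i :: r | P k && (k != p)) f k x =
     (if P i then f i x else 1) * (l p * \prod_(k <- r | P k && (k != p)) f k x).
    move=> pr Pp; rewrite big_cons.
    have -> : i != p by apply: contraNneq ir => ->.
    by rewrite andbT; case: ifP => _; [rewrite mulrCA|rewrite mul1r].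
  have E2 : \sum_(p <- r | P p) l p * \prod_(k <- i :: r | P k && (k != p)) f k x =
     (if P i then f i x else 1) * \sum_(p <- r | P p) l p * \prod_(k <- r | P k && (k != p)) f k x.
    by rewrite mulr_sumr big_seq_cond [RHS]big_seq_cond; apply: eq_bigr => p /andP[pr Pp]; exact: E.
  rewrite big_cons E2.
  case Pi : (P i); last first.
    by rewrite mul1r; apply: eq_is_rderive (IH ur) => y; rewrite big_cons Pi.
  rewrite big_cons eqxx andbF.
  have -> : \prod_(k <- r | P k && (k != i)) f k x = \prod_(k <- r | P k) f k x.
    rewrite big_seq_cond [RHS]big_seq_cond; apply: eq_bigl => k.
    case kr : (k \in r) => //=; case: (P k) => //=.
    by apply: contraNneq ir => <-.
  apply: (@eq_is_rderive _ R[i] (fun y => f i y * \prod_(k <- r | P k) f k y)).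
    by move=> y; rewrite big_cons Pi.
  by apply: is_rderiveM; [exact: H|exact: IH].
exact: (G (index_enum I) (index_enum_uniq I)).
Qed.

Section stokes.
Context {R : realType} {M : nat}.
Variable v : 'I_M -> 'rV[R]_M -> R[i].
Hypothesis Cv : forall q, Ck 2 (v q).

Definition jac (t : 'rV[R]_M) : 'M[R[i]]_M := \matrix_(q, b) rpartial b (v q) t.

(** In the Leibniz expansion of the cofactor in row [r], the contribution of differentiating the
    entry in row [p]. *)
Definition dterm (r p b : 'I_M) (s : {perm 'I_M}) (t : 'rV[R]_M) : R[i] :=
  rpartial b (rpartial (s p) (v p)) t * \prod_(k | (r != k) && (k != p)) jac t k (s k).

Definition scof (r b : 'I_M) (s : {perm 'I_M}) (t : 'rV[R]_M) : R[i] :=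
  (-1) ^+ s * \sum_(p | r != p) dterm r p b s t.

Definition dcof (r b : 'I_M) (t : 'rV[R]_M) : R[i] :=
  \sum_(s : {perm 'I_M} | s r == b) scof r b s t.

Lemma rderive_cofactor r b t :
  is_rderive (fun h => cofactor (jac (t + h *: delta_mx 0 b)) r b) 0 (dcof r b t).
Proof.
apply: (@eq_is_rderive _ R[i] (fun h => \sum_(s : {perm 'I_M} | s r == b) (-1) ^+ s *
    \prod_(k | r != k) jac (t + h *: delta_mx 0 b) k (s k))).
  by move=> h; rewrite expand_cofactor.
apply: is_rderive_sum => s _.
have Dj k : is_rderive (fun h => jac (t + h *: delta_mx 0 b) k (s k)) 0 (rpartial b (rpartial (s k) (v k)) t).
  apply: eq_is_rderive (Ck_rpartial (b := b) (t := t) (CkS (s k) (Cv k))) => h; by rewrite mxE.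
have D1 := is_rderive_bigprod (P := fun k => r != k) (fun k _ => Dj k).
have D2 := is_rderiveM (is_rderive_cst ((-1) ^+ s : R[i]) 0) D1.
move: D2; rewrite mul0r add0r scale0r addr0; exact.
Qed.

(** Piola identity: the rows of the cofactor matrix of a Jacobian are divergence free. The
    differentiated entry of row [p] is the mixed derivative of [v p] in the directions [s r] and
    [s p]. Composing [s] with the transposition of [r] and [p] preserves it by [Ck_schwarz] and
    changes the sign of [s], so the sum is its own negative. *)
Lemma piola r t : \sum_b dcof r b t = 0.
Proof.
have PB (Y : {perm 'I_M} -> R[i]) : \sum_s Y s = \sum_b \sum_(s : {perm 'I_M} | s r == b) Y s.
  exact: (partition_big (fun s : {perm 'I_M} => s r) xpredT).
transitivity (\sum_(s : {perm 'I_M}) scof r (s r) s t).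
  by rewrite [RHS]PB; apply: eq_bigr => b _; apply: eq_bigr => s /eqP ->.
transitivity (\sum_(p | r != p) \sum_(s : {perm 'I_M}) (-1) ^+ s * dterm r p (s r) s t).
  by rewrite exchange_big; apply: eq_bigr => s _; rewrite /scof mulr_sumr.
rewrite big1// => p rp.
set S := \sum_(s : {perm 'I_M}) _.
suff SN : S = - S.
  have : S *+ 2 = 0 by rewrite mulr2n {1}SN addNr.
  by move/eqP; rewrite mulrn_eq0/= => /eqP.
rewrite {1}/S (reindex_inj (mulgI (tperm r p))) -sumrN; apply: eq_bigr => s _.
have -> : dterm r p ((tperm r p * s)%g r) (tperm r p * s)%g t = dterm r p (s r) s t.
  rewrite /dterm !permM tpermL tpermR (Ck_schwarz _ _ _ (Cv p)); congr (_ * _).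
  by apply: eq_bigr => k /andP[rk kp]; rewrite permM tpermD// eq_sym.
by rewrite odd_permM odd_tperm rp signr_addb expr1 mulN1r mulNr.
Qed.

Lemma continuous_jac q b : continuous (fun t => jac t q b).
Proof.
rewrite (_ : (fun t => _) = rpartial b (v q)); last by apply/funext => t; rewrite mxE.
exact: Ck_continuous (CkS b (Cv q)).
Qed.

Lemma continuous_cofactor r b : continuous (fun t => cofactor (jac t) r b).
Proof.
rewrite (_ : (fun t => _) = fun t => \sum_(s : {perm 'I_M} | s r == b) (-1) ^+ s *
    \prod_(k | r != k) jac t k (s k)); last by apply/funext => t; rewrite expand_cofactor.
apply: continuous_csum => s _; apply: continuous_cM; first exact: continuous_ccst.
by apply: continuous_cprod => k _; exact: continuous_jac.
Qed.

Lemma continuous_det : continuous (fun t => \det (jac t)).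
Proof.
rewrite (_ : (fun t => _) = fun t => \sum_(s : {perm 'I_M}) (-1) ^+ s *
    \prod_(k : 'I_M) jac t k (s k)); last by apply/funext => t.
apply: continuous_csum => s _; apply: continuous_cM; first exact: continuous_ccst.
by apply: continuous_cprod => k _; exact: continuous_jac.
Qed.

Lemma continuous_dcof r b : continuous (dcof r b).
Proof.
rewrite /dcof; apply: continuous_csum => s _; apply: continuous_cM; first exact: continuous_ccst.
apply: continuous_csum => p _; apply: continuous_cM.
  exact: Ck_continuous (CkS b (CkS (s p) (Cv p))).
by apply: continuous_cprod => k _; exact: continuous_jac.
Qed.

(** [A] is the coefficient of the (M-1)-form lacking dv_r, and [dA q] plays the role of its
    derivative in [v q]. The divergence of [A] times the [r]-th row of cofactors has two parts:
    derivatives of cofactors, removed by [piola], and derivatives of [A], of which the expansion of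
    determinants along rows keeps only [dA r] times the Jacobian determinant. *)
Lemma stokes_cube (r : 'I_M) (A : 'rV[R]_M -> R[i]) (dA : 'I_M -> 'rV[R]_M -> R[i]) :
  {within @unit_cube R M, continuous A} ->
  (forall q, {within @unit_cube R M, continuous (dA q)}) ->
  (forall b t, unit_cube t -> 0 < t 0 b < 1 ->
    is_rderive (fun h => A (t + h *: delta_mx 0 b)) 0
      (\sum_q dA q t * rpartial b (v q) t)) ->
  cube_integral (fun t => dA r t * \det (jac t)) =
  \sum_b (cube_integral (fun t => A (face b true t) * cofactor (jac (face b true t)) r b) -
          cube_integral (fun t => A (face b false t) * cofactor (jac (face b false t)) r b)).
Proof.
move=> cA cdA DA.
have cw (f : 'rV[R]_M -> R[i]) : continuous f -> {within @unit_cube R M, continuous f}.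
  by move=> cf; exact: continuous_subspaceT.
pose g b t := (\sum_q dA q t * jac t q b) * cofactor (jac t) r b + A t * dcof r b t.
have cg b : {within @unit_cube R M, continuous (g b)}.
  apply: (@continuous_vD _ (subspace (@unit_cube R M)) R[i]).
    apply: (@continuous_cM _ (subspace (@unit_cube R M))); last by apply: cw; exact: continuous_cofactor.
    apply: (@continuous_csum _ (subspace (@unit_cube R M))) => q _.
    apply: (@continuous_cM _ (subspace (@unit_cube R M))); first exact: cdA.
    by apply: cw; exact: continuous_jac.
  apply: (@continuous_cM _ (subspace (@unit_cube R M))); first exact: cA.
  by apply: cw; exact: continuous_dcof.
transitivity (\sum_b cube_integral (g b)); last first.
  apply: eq_bigr => b _.
  apply: (@cube_integral_partial R M b (g b) (fun t => A t * cofactor (jac t) r b)).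
    exact: cg.
    apply: (@continuous_cM _ (subspace (@unit_cube R M))); first exact: cA.
    by apply: cw; exact: continuous_cofactor.
  move=> t ut tb; have D := is_rderiveM (DA b t ut tb) (@rderive_cofactor r b t).
  have -> : g b t = (\sum_q dA q t * rpartial b (v q) t) * cofactor (jac (t + 0 *: delta_mx 0 b)) r b
     + A (t + 0 *: delta_mx 0 b) * dcof r b t.
    rewrite scale0r addr0 /g; congr (_ * _ + _).
    by apply: eq_bigr => q _; rewrite mxE.
  exact: D.
transitivity (cube_integral (fun t => \sum_b 1 * g b t)).
  apply: eq_cube_integral => t ut.
  under eq_bigr do rewrite mul1r.
  rewrite /g big_split/= -mulr_sumr piola mulr0 addr0.
  under eq_bigr do rewrite mulr_suml.
  rewrite exchange_big/=.
  have E q : \sum_b dA q t * jac t q b * cofactor (jac t) r b = dA q t * (\det (jac t) *+ (q == r)).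
    transitivity (dA q t * (jac t *m \adj (jac t)) q r).
      rewrite [(_ *m _) q r]mxE mulr_sumr; apply: eq_bigr => b _.
      by rewrite [(\adj _) b r]mxE -mulrA.
    by rewrite mul_mx_adj [_%:M q r]mxE.
  under eq_bigr do rewrite E.
  rewrite (bigD1 r)//= eqxx mulr1n big1 ?addr0// => q /negbTE ->.
  by rewrite mulr0n mulr0.
rewrite (cube_integral_sum _ _ cg); by apply: eq_bigr => b _; rewrite mul1r.
Qed.

End stokes.

(** * Matrix elements of Bethe vectors as functions of the integration variables *)

Section cvg_complex.
Context {R : realType} {X : Type} {F : set_system X} {FF : Filter F}.

Lemma cvg_csum (I : Type) (r : seq I) (P : pred I) (f : I -> X -> R[i]) (l : I -> R[i]) :
  (forall i, P i -> f i @ F --> l i) ->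
  (fun x => \sum_(i <- r | P i) f i x) @ F --> \sum_(i <- r | P i) l i.
Proof.
move=> cf; elim: r => [|i r IH].
  rewrite big_nil (_ : (fun x => _) = fun=> 0); first exact: cvg_cst.
  by apply/funext => x; rewrite big_nil.
rewrite big_cons; case Pi : (P i).
  rewrite (_ : (fun x => _) = fun x => f i x + \sum_(i <- r | P i) f i x).
    exact: (@cvgcD R X F FF _ _ _ _ (cf i Pi) IH).
  by apply/funext => x; rewrite big_cons Pi.
by rewrite (_ : (fun x => _) = fun x => \sum_(i <- r | P i) f i x); last by apply/funext => x; rewrite big_cons Pi.
Qed.

Lemma cvg_cprod (I : Type) (r : seq I) (P : pred I) (f : I -> X -> R[i]) (l : I -> R[i]) :
  (forall i, P i -> f i @ F --> l i) ->
  (fun x => \prod_(i <- r | P i) f i x) @ F --> \prod_(i <- r | P i) l i.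
Proof.
move=> cf; elim: r => [|i r IH].
  rewrite big_nil (_ : (fun x => _) = fun=> 1); first exact: cvg_cst.
  by apply/funext => x; rewrite big_nil.
rewrite big_cons; case Pi : (P i).
  rewrite (_ : (fun x => _) = fun x => f i x * \prod_(i <- r | P i) f i x).
    exact: (cvgcM _ (cf i Pi) IH).
  by apply/funext => x; rewrite big_cons Pi.
by rewrite (_ : (fun x => _) = fun x => \prod_(i <- r | P i) f i x); last by apply/funext => x; rewrite big_cons Pi.
Qed.

Lemma cvg_cexp (f : X -> R[i]) l : f @ F --> l -> (fun x => cexp (f x)) @ F --> cexp l.
Proof.
move=> /cvg_complexP[fr fi].
have er : (fun x => expR (complex.Re (f x))) @ F --> expR (complex.Re l).
  exact: (continuous_cvg _ (@continuous_expR R _) fr).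
have ec : (fun x => cos (complex.Im (f x))) @ F --> cos (complex.Im l).
  exact: (continuous_cvg _ (@continuous_cos R _) fi).
have es : (fun x => sin (complex.Im (f x))) @ F --> sin (complex.Im l).
  exact: (continuous_cvg _ (@continuous_sin R _) fi).
have ERe z : complex.Re (@cexp R z) = expR (complex.Re z) * cos (complex.Im z) by rewrite /cexp/= mul0r subr0.
have EIm z : complex.Im (@cexp R z) = expR (complex.Re z) * sin (complex.Im z) by rewrite /cexp/= mul0r addr0.
apply/cvg_complexP; rewrite ERe EIm; split.
  by rewrite (funext (fun x => ERe (f x))); apply: cvgM.
by rewrite (funext (fun x => EIm (f x))); apply: cvgM.
Qed.

End cvg_complex.

Section pairing.
Context {R : realType} {N M : nat} {V : lmodType R[i]} (d : {dot V for Num.conj}).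
Variables (e e' : 'I_N -> {linear V -> V}) (vac : V) (g : 'I_N -> R[i]) (eps : R[i]).
Hypothesis adj : forall j u w, d (e j u) w = eps * d u (e' j w).

Definition Pf (l : seq 'I_M) (psi : V) (v : 'I_M -> R[i]) : R[i] :=
  d (gen_vec e vac g v l) psi.

(** The partial derivative of [Pf] in [v p]. Each [e j] is moved onto [psi] as its adjoint, so that
    what gets differentiated are scalar rational functions. *)
Fixpoint dPf (l : seq 'I_M) (p : 'I_M) (psi : V) (v : 'I_M -> R[i]) : R[i] :=
  if l is q :: l' then
    \sum_(j < N) eps * (((v q - g j)^-1 * dPf l' p (e' j psi) v) +
      (q == p)%:R * (- (1 / (v q - g j) ^+ 2)) * Pf l' (e' j psi) v)
  else 0.

Lemma Pf_cons q l psi v : Pf (q :: l) psi v =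
  \sum_(j < N) eps * ((v q - g j)^-1 * Pf l (e' j psi) v).
Proof.
rewrite /Pf /= /gen linear_sumlz; apply: eq_bigr => j _.
by rewrite linearZl_LR/= adj mulrCA.
Qed.

Lemma dPf_notin l p psi v : p \notin l -> dPf l p psi v = 0.
Proof.
elim: l psi => [//|q l IH] psi /=; rewrite inE negb_or => /andP[pq pl].
by rewrite big1// => j _; rewrite IH// mulr0 add0r eq_sym (negbTE pq) !mul0r mulr0.
Qed.

Lemma Pf_rderive l psi (v : R -> 'I_M -> R[i]) x (v' : 'I_M -> R[i]) :
  (forall q, is_rderive (fun y => v y q) x (v' q)) ->
  (forall q j, v x q != g j) ->
  is_rderive (fun y => Pf l psi (v y)) x (\sum_p dPf l p psi (v x) * v' p).
Proof.
move=> dv vg; elim: l psi => [|q l IH] psi.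
  by rewrite big1 => [|p _]; [exact: is_rderive_cst|rewrite mul0r].
apply: (@eq_is_rderive _ R[i] (fun y => \sum_(j < N) eps * ((v y q - g j)^-1 * Pf l (e' j psi) (v y)))).
  by move=> y; rewrite Pf_cons.
have -> : \sum_p dPf (q :: l) p psi (v x) * v' p =
  \sum_(j < N) (0 * ((v x q - g j)^-1 * Pf l (e' j psi) (v x)) + eps * ((- (v' q + 0) / (v x q - g j) ^+ 2) * Pf l (e' j psi) (v x) +
     (v x q - g j)^-1 * \sum_p dPf l p (e' j psi) (v x) * v' p)).
  rewrite /=; under eq_bigr do rewrite mulr_suml.
  rewrite exchange_big; apply: eq_bigr => j _ /=.
  rewrite mul0r add0r addr0 mulr_sumr [X in eps * (X + _)](_ : _ =
     \sum_p (q == p)%:R * (- (1 / (v x q - g j) ^+ 2)) * Pf l (e' j psi) (v x) * v' p); last first.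
    rewrite (bigD1 q)//= eqxx mul1r big1 ?addr0 => [|p /negbTE]; last by rewrite eq_sym => ->; rewrite !mul0r.
    by rewrite mul1r; ring.
  rewrite -big_split mulr_sumr; apply: eq_bigr => p _ /=; ring.
apply: is_rderive_sum => j _.
apply: is_rderiveM; first exact: is_rderive_cst.
apply: is_rderiveM; last exact: IH.
apply: is_rderiveV; first by rewrite subr_eq0.
by apply: is_rderiveD; [exact: dv|exact: is_rderive_cst].
Qed.

Context {X : Type} {F : set_system X} {FF : Filter F}.

Lemma cvg_inv_sub (v : X -> 'I_M -> R[i]) v0 q j : (forall q, (fun x => v x q) @ F --> v0 q) ->
  (forall q j, v0 q != g j) -> (fun x => (v x q - g j)^-1) @ F --> (v0 q - g j)^-1.
Proof.
move=> cv vg; apply: cvgcV; first by rewrite subr_eq0.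
by apply: (@cvgcD R X F FF); [exact: cv|exact: cvg_cst].
Qed.

Lemma Pf_cvg l psi (v : X -> 'I_M -> R[i]) v0 : (forall q, (fun x => v x q) @ F --> v0 q) ->
  (forall q j, v0 q != g j) -> (fun x => Pf l psi (v x)) @ F --> Pf l psi v0.
Proof.
move=> cv vg; elim: l psi => [|q l IH] psi; first exact: cvg_cst.
rewrite Pf_cons (funext (fun x => Pf_cons q l psi (v x))).
apply: cvg_csum => j _; apply: cvgcM; first exact: cvg_cst.
by apply: cvgcM; [exact: cvg_inv_sub|exact: IH].
Qed.

Lemma dPf_cvg l p psi (v : X -> 'I_M -> R[i]) v0 : (forall q, (fun x => v x q) @ F --> v0 q) ->
  (forall q j, v0 q != g j) -> (fun x => dPf l p psi (v x)) @ F --> dPf l p psi v0.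
Proof.
move=> cv vg; elim: l psi => [|q l IH] psi /=; first exact: cvg_cst.
apply: cvg_csum => j _; apply: cvgcM; first exact: cvg_cst.
apply: (@cvgcD R X F FF).
  by apply: cvgcM; [exact: cvg_inv_sub|exact: IH].
apply: cvgcM; last exact: Pf_cvg.
apply: cvgcM; first exact: cvg_cst.
rewrite !div1r -exprVn expr2 (funext (fun x => congr1 -%R (etrans (div1r _) (esym (exprVn _ 2%N))))).
apply: cvgvN; by apply: cvgcM; exact: cvg_inv_sub.
Qed.

End pairing.

(** * Stokes on the twisted cycle *)

(** The weight runs over pairs q < r, whereas its logarithmic derivative in one variable involves
    all other variables; antisymmetry lets each pair contribute to both of its members. *)
Lemma antisym_sum (K : comPzRingType) (M : nat) (a : 'I_M -> 'I_M -> K) (x : 'I_M -> K) :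
  (forall p q, p != q -> a p q = - a q p) ->
  \sum_(r < M) \sum_(q < M | (q < r)%N) a r q * (x r - x q) =
  \sum_r (\sum_(q | q != r) a r q) * x r.
Proof.
move=> anti.
have -> : \sum_(r < M) \sum_(q < M | (q < r)%N) a r q * (x r - x q) =
   \sum_(r < M) \sum_(q < M | (q < r)%N) a r q * x r +
   \sum_(r < M) \sum_(q < M | (q < r)%N) a q r * x q.
  rewrite -big_split; apply: eq_bigr => r _; rewrite -big_split; apply: eq_bigr => q qr /=.
  by rewrite (anti q r) ?neq_ltn ?qr// mulrBr mulNr.
rewrite [X in _ + X](exchange_big_dep predT)//= -big_split; apply: eq_bigr => r _ /=.
rewrite mulr_suml [RHS](bigID (fun q : 'I_M => (q < r)%N)) /=; congr (_ + _); apply: eq_bigl => q.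
  by rewrite neq_ltn; case: ltngtP.
by rewrite neq_ltn -leqNgt; case: ltngtP => //= /val_inj ->; rewrite ltnn.
Qed.

(** Averaging over classes: the term at [a] is spread evenly over the [n a] elements of its class,
    and after exchanging the sums each [P b] multiplies the total multiplicity of its class. *)
Lemma sum_class_eq0 (K : numFieldType) (I : finType) (e : rel I) (m P : I -> K) :
  reflexive e -> symmetric e -> transitive e ->
  (forall a b, e a b -> P a = P b) ->
  (forall a, P a = 0 \/ \sum_(b | e a b) m b = 0) ->
  \sum_a m a * P a = 0.
Proof.
move=> er es et Pe H.
pose n a : K := (#|[pred b | e a b]|)%:R.
have n0 a : n a != 0 by rewrite pnatr_eq0 -lt0n; apply/card_gt0P; exists a; rewrite inE er.
have ne a b : e a b -> n a = n b.
  move=> ab; congr (_%:R); apply: eq_card => c; rewrite !inE.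
  by apply/idP/idP => h; [apply: et h; rewrite es|exact: et h].
have -> : \sum_a m a * P a = \sum_a \sum_(b | e a b) (n a)^-1 * (m a * P a).
  apply: eq_bigr => a _; rewrite sumr_const -mulrnAl -[_ *+ _]mulr_natr -/(n a).
  by rewrite mulVf ?mul1r.
rewrite (exchange_big_dep predT)//= big1// => b _.
transitivity ((n b)^-1 * P b * \sum_(a | e b a) m a).
  rewrite mulr_sumr; apply: eq_big => [a|a ab]; first by rewrite es.
  by rewrite (ne _ _ ab) (Pe _ _ ab) -mulrA [P b * _]mulrC.
by case: (H b) => ->; rewrite ?mulr0 ?mul0r.
Qed.

Lemma face_add (R : realType) (M : nat) (b : 'I_M) (e : bool) (c : 'I_M.-1) (h : R)
    (t : 'rV[R]_M.-1) :
  face b e (t + h *: delta_mx 0 c) = face b e t + h *: delta_mx 0 (lift b c).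
Proof.
apply/rowP => k; rewrite !mxE eqxx /=; case: (unliftP b k) => [k'|] ->.
  by rewrite !mxE eqxx /= (inj_eq lift_inj).
by rewrite (negbTE (neq_lift _ _)) mulr0 addr0.
Qed.

Lemma face_cube (R : realType) (M : nat) (b : 'I_M) (e : bool) (t : 'rV[R]_M.-1) :
  unit_cube t -> unit_cube (face b e t).
Proof. by apply: ins_cube; case: e; rewrite /= ?lexx ?ler01. Qed.

Lemma continuous_face (R : realType) (M : nat) (b : 'I_M) (e : bool) :
  continuous (@face R M b e).
Proof.
exact: (@continuous_pairl _ _ _ (fun p : R * 'rV[R]_M.-1 => ins b p.1 p.2) (e%:R) (@continuous_ins R M b)).
Qed.

Lemma shift_cube (R : realType) (M : nat) (b : 'I_M) (h : R) (t : 'rV[R]_M) :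
  unit_cube t -> 0 <= t 0 b + h <= 1 -> unit_cube (t + h *: delta_mx 0 b).
Proof.
move=> ut tb c; rewrite !mxE eqxx /=; have [->|cb] := eqVneq c b; first by rewrite mulr1.
by rewrite mulr0 addr0; exact: ut.
Qed.

(** Equality of faces is known on the cube only, yet the Jacobian minors use two-sided derivatives.
    Since these exist, a one-sided difference quotient that stays in the cube already determines
    them. *)
Lemma rpartial_cube_eq (R : realType) (M : nat) (c : 'I_M) (f : R -> R[i]) (f' : R -> R[i])
    l l' (t : 'rV[R]_M) : unit_cube t ->
  is_rderive f 0 l -> is_rderive f' 0 l' -> f 0 = f' 0 ->
  (forall h, unit_cube (t + h *: delta_mx 0 c) -> f h = f' h) -> l = l'.
Proof.
move=> ut Df Df' f0 H.
have [F [PF [F0 Fc]]] : exists F : set_system R, ProperFilter F /\ (F `=>` (0 : R)^' /\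
    \forall h \near F, unit_cube (t + h *: delta_mx 0 c)).
  have /andP[t0 t1] := ut c.
  (* At the end [t 0 c = 1] the cube is approached from the left, everywhere else from the right. *)
  have [tc|tc] := ltrP (t 0 c) 1.
    exists (0 : R)^'+; split; first exact: at_right_proper_filter.
    split; first by apply: within_subset => x/=; rewrite lt_neqAle eq_sym => /andP[].
    near=> h; apply: shift_cube => //.
    have h0 : 0 < h by near: h; exact: nbhs_right_gt.
    have h1 : h < 1 - t 0 c by near: h; apply: nbhs_right_lt; rewrite subr_gt0.
    by apply/andP; split; lra.
  exists (0 : R)^'-; split; first exact: at_left_proper_filter.
  split; first by apply: within_subset => x/=; rewrite lt_neqAle => /andP[].
  near=> h; apply: shift_cube => //.
  have h0 : h < 0 by near: h; exact: nbhs_left_lt.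
  have h1 : -1 < h by near: h; apply: nbhs_left_gt; rewrite ltrN10.
  by apply/andP; split; lra.
have C1 : (fun h => (h%:C)^-1 *: (f (0 + h) - f 0)) @ F --> (l : R[i]).
  by apply: cvg_trans Df; exact: cvg_app F0.
have C2 : (fun h => (h%:C)^-1 *: (f' (0 + h) - f' 0)) @ F --> (l' : R[i]).
  by apply: cvg_trans Df'; exact: cvg_app F0.
have C3 : (fun h => (h%:C)^-1 *: (f (0 + h) - f 0)) @ F --> (l' : R[i]).
  apply: cvg_trans C2; apply: near_eq_cvg; apply: filterS Fc => h uh.
  by rewrite add0r f0 (H _ uh).
by apply: (@cvg_unique R[i] _ _ _ _ _ C1 C3).
Unshelve. all: by end_near. Qed.

Section cycle.
Context {R : realType} (hbar : R) {N M : nat} (s : 'I_N -> int) {G : set 'rV[R[i]]_N}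
  (Lgg : 'I_N -> 'I_N -> 'rV[R[i]]_N -> R[i]) {D : contour_family R N M}.
Hypothesis Dc : admissible_cycle hbar s G Lgg D.
Variable g : 'rV[R[i]]_N.
Hypothesis Gg : G g.

Let cube := @unit_cube R M.

Definition cv (i : 'I_(cf_size D)) (q : 'I_M) (t : 'rV[R]_M) : R[i] := cf_map i (g, t) 0 q.

Definition cw (i : 'I_(cf_size D)) (t : 'rV[R]_M) : R[i] := weight hbar s Lgg i (g, t).

(** The logarithmic derivative of the weight in the [q]-th integration variable. *)
Definition kap (i : 'I_(cf_size D)) (q : 'I_M) (t : 'rV[R]_M) : R[i] :=
  (\sum_(p | p != q) - (2%:R * 'i * hbar%:C) / (cv i q t - cv i p t)) +
  \sum_(j < N) ('i * hbar%:C * (s j)%:~R) / (g 0 j - cv i q t).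

Lemma Ck_cv i q : Ck 2 (cv i q).
Proof. exact: (@ac_smooth _ _ _ _ _ _ _ _ Dc i g q Gg). Qed.

Lemma near_cube (b : 'I_M) (t : 'rV[R]_M) : unit_cube t -> 0 < t 0 b < 1 ->
  \forall h \near 0^', unit_cube (t + h *: delta_mx 0 b).
Proof.
move=> ut /andP[t0 t1]; near=> h; apply: shift_cube => //.
have : `|h| < Num.min (t 0 b) (1 - t 0 b).
  by near: h; apply: dnbhs0_lt; rewrite lt_min t0 subr_gt0.
by rewrite lt_min !ltr_norml => /andP[/andP[? ?] /andP[? ?]]; apply/andP; split; lra.
Unshelve. all: by end_near. Qed.

Lemma log_cvg (L : 'rV[R[i]]_N * 'rV[R]_M -> R[i]) t : unit_cube t ->
  {within G `*` cube, continuous L} ->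
  (fun u => L (g, u)) @ within cube (nbhs t) --> L (g, t).
Proof.
move=> ut /subspace_continuousP cL A nA.
have := cL (g, t) (conj Gg ut) A nA => K.
have K' : nbhs (g, t) (fun p => (G `*` cube) p -> A (L p)) := K.
have K2 : nbhs t (fun u => (G `*` cube) (g, u) -> A (L (g, u))).
  move: K' => [[A1 B1] /= [nA1 nB1] sub]; apply: filterS nB1 => u Bu.
  by apply: (sub (g, u)); split => //; exact: nbhs_singleton.
change (nbhs t (fun u => cube u -> A (L (g, u)))).
by apply: filterS K2 => u H cu; apply: H.
Qed.

Lemma line_cvg (f : 'rV[R]_M -> R[i]) b t : unit_cube t -> 0 < t 0 b < 1 ->
  f @ within cube (nbhs t) --> f t ->
  (fun h : R => f (t + h *: delta_mx 0 b)) @ 0^' --> f t.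
Proof.
move=> ut tb cf A nA.
have K : nbhs t (fun u => cube u -> A (f u)) := cf A nA.
have cp : (fun h : R => t + h *: delta_mx 0 b) @ 0^' --> t.
  rewrite -[X in _ --> X]addr0 -(scale0r (delta_mx 0 b)).
  apply: cvgD; first exact: cvg_cst.
  by apply: cvgZ; [apply: cvg_within_filter; exact: cvg_id|exact: cvg_cst].
have K2 : \forall h \near 0^', cube (t + h *: delta_mx 0 b) -> A (f (t + h *: delta_mx 0 b)) := cp _ K.
have := near_cube ut tb; move: K2.
by apply: filterS2 => h H /H.
Qed.

(** [cexp (c * L)] is a branch of the power [h ^ c]. The branch [L] lives over the cube, hence the
    restriction to interior values of the [b]-th coordinate. *)
Lemma cexp_log_rderive (c : R[i]) (h L : 'rV[R[i]]_N * 'rV[R]_M -> R[i]) b t h' :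
  unit_cube t -> 0 < t 0 b < 1 -> log_branch (G `*` cube) h L ->
  is_rderive (fun k => h (g, t + k *: delta_mx 0 b)) 0 h' ->
  is_rderive (fun k => cexp (c * L (g, t + k *: delta_mx 0 b))) 0
    (c * (h' / h (g, t)) * cexp (c * L (g, t + 0 *: delta_mx 0 b))).
Proof.
move=> ut tb [cL eL] Dh.
have DL : is_rderive (fun k => L (g, t + k *: delta_mx 0 b)) 0 (h' / h (g, t + 0 *: delta_mx 0 b)).
  apply: (is_rderive_log _ _ _ Dh).
  - rewrite scale0r addr0 (_ : (fun k : R => _) = fun k : R => L (g, t + k *: delta_mx 0 b)).
      exact: (line_cvg ut tb (log_cvg ut cL)).
    by apply/funext => k; rewrite add0r.
  - by rewrite scale0r addr0; apply: eL.
  - by apply: filterS (near_cube ut tb) => k uk; rewrite add0r; apply: eL.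
have DcL := is_rderiveM (is_rderive_cst c 0) DL.
have := is_rderive_cexp DcL; rewrite mul0r add0r.
by rewrite {1}scale0r {1}addr0.
Qed.

Lemma cw_rderive i b t : unit_cube t -> 0 < t 0 b < 1 ->
  is_rderive (fun k => cw i (t + k *: delta_mx 0 b)) 0
    ((\sum_q kap i q t * rpartial b (cv i q) t) * cw i t).
Proof.
move=> ut tb.
pose dv q := rpartial b (cv i q) t.
have Dv q : is_rderive (fun k => cv i q (t + k *: delta_mx 0 b)) 0 (dv q).
  exact: (Ck_rpartial (b := b) (t := t) (Ck_cv i q)).
pose cB : R[i] := - (2%:R * 'i * hbar%:C).
pose cC j : R[i] := - ('i * hbar%:C * (s j)%:~R).
pose fB r q k := cexp (cB * cf_logvv i r q (g, t + k *: delta_mx 0 b)).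
pose fC r j k := cexp (cC j * cf_loggv i j r (g, t + k *: delta_mx 0 b)).
have DB (r q : 'I_M) : (q < r)%N -> is_rderive (fB r q) 0 (cB * ((dv r - dv q) / (cv i r t - cv i q t)) * fB r q 0).
  move=> qr.
  have K : is_rderive (fun k => cv i r (t + k *: delta_mx 0 b) - cv i q (t + k *: delta_mx 0 b)) 0 (dv r - dv q).
    have := is_rderiveD (Dv r) (is_rderiveM (is_rderive_cst (-1 : R[i]) 0) (Dv q)).
    rewrite mul0r add0r mulN1r; apply: eq_is_rderive => k.
    by rewrite mulN1r.
  exact: (@cexp_log_rderive cB (fun p => cf_map i p 0 r - cf_map i p 0 q) (cf_logvv i r q) b t _ ut tb
    (@ac_logvv _ _ _ _ _ _ _ _ Dc i r q qr) K).
have DC (r : 'I_M) (j : 'I_N) : is_rderive (fC r j) 0 (cC j * (- dv r / (g 0 j - cv i r t)) * fC r j 0).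
  have K : is_rderive (fun k => g 0 j - cv i r (t + k *: delta_mx 0 b)) 0 (- dv r).
    have := is_rderiveD (is_rderive_cst (g 0 j) 0) (is_rderiveM (is_rderive_cst (-1 : R[i]) 0) (Dv r)).
    rewrite mul0r !add0r mulN1r; apply: eq_is_rderive => k.
    by rewrite mulN1r.
  exact: (@cexp_log_rderive (cC j) (fun p => p.1 0 j - cf_map i p 0 r) (cf_loggv i j r) b t _ ut tb
    (@ac_loggv _ _ _ _ _ _ _ _ Dc i j r) K).
have DB1 (r : 'I_M) := is_rderive_prod (r := index_enum 'I_M) (P := fun q : 'I_M => (q < r)%N) (fun q qr => DB r q qr).
have DB2 := is_rderive_prod (r := index_enum 'I_M) (P := xpredT) (fun r _ => DB1 r).
have DC1 (r : 'I_M) := is_rderive_prod (r := index_enum 'I_N) (P := xpredT) (fun j _ => DC r j).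
have DC2 := is_rderive_prod (r := index_enum 'I_M) (P := xpredT) (fun r _ => DC1 r).
pose cA := \prod_(j < N) \prod_(k < N | (k < j)%N)
     cexp (- ('i * hbar%:C * (s j)%:~R * (s k)%:~R / 2%:R) * Lgg j k g).
have := is_rderiveM (is_rderiveM (is_rderive_cst cA 0) DB2) DC2.
set SB := \sum_(r < M) \sum_(q < M | _) _; set SC := \sum_(r < M) \sum_(j < N) _.
(* [kap] is organized by variable, the derivative of the product by pairs; [antisym_sum] translates
   for the factors in v_r - v_q. *)
have -> : \sum_q kap i q t * rpartial b (cv i q) t = SB + SC.
  rewrite /kap; under eq_bigr do rewrite mulrDl.
  rewrite big_split/=; congr (_ + _).
    rewrite -(@antisym_sum _ M (fun q p => - (2%:R * 'i * hbar%:C) / (cv i q t - cv i p t)) dv).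
      by apply: eq_bigr => r _; apply: eq_bigr => q _; rewrite /cB mulrA mulrAC.
    by move=> p q _; rewrite -[cv i p t - _]opprB invrN mulrN.
  apply: eq_bigr => r _; rewrite mulr_suml; apply: eq_bigr => j _.
  by rewrite /cC mulNr [- dv r / _]mulNr mulrN opprK [LHS]mulrAC [RHS]mulrA.
have -> : cw i t = cA * (\prod_(r < M) \prod_(q < M | (q < r)%N) fB r q 0) *
    (\prod_(r < M) \prod_(j < N) fC r j 0).
  by rewrite /fB /fC scale0r addr0.
set PB := \prod_(r < M) \prod_(q < M | _) _; set PC := \prod_(r < M) \prod_(j < N) _.
rewrite mul0r add0r (_ : cA * (SB * PB) * PC + cA * PB * (SC * PC) = (SB + SC) * (cA * PB * PC)).
  exact: eq_is_rderive.
by ring.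
Qed.

Lemma cv_cvg i q t : cv i q @ within cube (nbhs t) --> cv i q t.
Proof. by apply: cvg_within_filter; exact: (Ck_continuous (Ck_cv i q)). Qed.

Lemma cw_cvg i t : unit_cube t -> cw i @ within cube (nbhs t) --> cw i t.
Proof.
move=> ut; apply: cvgcM; [apply: cvgcM|].
- exact: (cvg_cst (\prod_(j < N) \prod_(k < N | (k < j)%N) cexp (- ('i * hbar%:C * (s j)%:~R * (s k)%:~R / 2%:R) * Lgg j k g))).
- apply: cvg_cprod => r _; apply: cvg_cprod => q qr; apply: cvg_cexp; apply: cvgcM; first exact: cvg_cst.
  by apply: (log_cvg ut); have [] := @ac_logvv _ _ _ _ _ _ _ _ Dc i r q qr.
- apply: cvg_cprod => r _; apply: cvg_cprod => j _; apply: cvg_cexp; apply: cvgcM; first exact: cvg_cst.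
  by apply: (log_cvg ut); have [] := @ac_loggv _ _ _ _ _ _ _ _ Dc i j r.
Qed.

Lemma kap_cvg i q t : unit_cube t -> kap i q @ within cube (nbhs t) --> kap i q t.
Proof.
move=> ut; apply: cvgcD.
  apply: cvg_csum => p pq; apply: cvgcM; first exact: cvg_cst.
  apply: cvgcV; first by rewrite subr_eq0 eq_sym (ac_avoids_vv Dc).
  by apply: cvgcD; [exact: cv_cvg|apply: cvgvN; exact: cv_cvg].
apply: cvg_csum => j _; apply: cvgcM; first exact: cvg_cst.
apply: cvgcV; first by rewrite subr_eq0 eq_sym (ac_avoids_gv Dc).
by apply: cvgcD; [exact: cvg_cst|apply: cvgvN; exact: cv_cvg].
Qed.

End cycle.

Section stokes_cycle.
Context {R : realType} (hbar : R) {N M : nat} (s : 'I_N -> int) {G : set 'rV[R[i]]_N}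
  (Lgg : 'I_N -> 'I_N -> 'rV[R[i]]_N -> R[i]) {D : contour_family R N M}.
Hypothesis Dc : admissible_cycle hbar s G Lgg D.
Variable g : 'rV[R[i]]_N.
Hypothesis Gg : G g.
Context {V : lmodType R[i]} (d : {dot V for Num.conj}).
Variables (e e' : 'I_N -> {linear V -> V}) (vac : V) (eps : R[i]).
Hypothesis adj : forall j u w, d (e j u) w = eps * d u (e' j w).
Variable psi : V.

Let cube := @unit_cube R M.
Let g0 j := g 0 j.

Definition rest (r : 'I_M) : seq 'I_M := rem r (enum 'I_M).

(** With the factor e(v_r) removed, v_r enters only through the weight. The derivative in v_r is
    therefore [kap r] times the coefficient itself, which is the shape produced by the total
    lowering operator. *)
Definition form_coef (i : 'I_(cf_size D)) (r : 'I_M) (t : 'rV[R]_M) : R[i] :=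
  cw hbar s Lgg g i t * Pf d e vac g0 (rest r) psi (fun q => cv g i q t).

Let jac_ i t := jac (cv (D := D) g i) t.

Lemma cv_neq i t q j : unit_cube t -> cv (D := D) g i q t != g0 j.
Proof. by move=> ut; exact: (@ac_avoids_gv _ _ _ _ _ _ _ _ Dc i g t q j Gg ut). Qed.

Lemma form_coef_cvg i r t : unit_cube t ->
  form_coef i r @ within cube (nbhs t) --> form_coef i r t.
Proof.
move=> ut; apply: cvgcM; first exact: (cw_cvg Dc Gg).
apply: (Pf_cvg adj) => [q|q j]; last exact: cv_neq.
exact: (cv_cvg Dc Gg).
Qed.

Lemma stokes_form i r :
  cube_integral (fun t => kap hbar s g i r t * form_coef i r t * \det (jac_ i t)) =
  \sum_b (cube_integral (fun t => form_coef i r (face b true t) * cofactor (jac_ i (face b true t)) r b) -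
          cube_integral (fun t => form_coef i r (face b false t) * cofactor (jac_ i (face b false t)) r b)).
Proof.
pose dA q t := kap hbar s g i q t * form_coef i r t +
   cw hbar s Lgg g i t * dPf d e e' vac g0 eps (rest r) q psi (fun q => cv g i q t).
have Cv q : Ck 2 (cv (D := D) g i q) by exact: (Ck_cv Dc Gg).
transitivity (cube_integral (fun t => dA r t * \det (jac_ i t))).
  apply: eq_cube_integral => t ut; rewrite /dA dPf_notin ?mulr0 ?addr0//.
  by rewrite /rest mem_rem_uniqF ?enum_uniq.
apply: (stokes_cube Cv).
- apply/subspace_continuousP => t ut; exact: form_coef_cvg.
- move=> q; apply/subspace_continuousP => t ut; apply: cvgcD.
    by apply: cvgcM; [exact: (kap_cvg Dc Gg)|exact: form_coef_cvg].
  apply: cvgcM; first exact: (cw_cvg Dc Gg).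
  by apply: (dPf_cvg adj) => [p|p j]; [exact: (cv_cvg Dc Gg)|exact: cv_neq].
move=> b t ut tb.
have Dw := cw_rderive Dc Gg (i := i) ut tb.
have DP := @Pf_rderive _ _ _ _ d e e' vac g0 eps adj (rest r) psi
  (fun k q => cv g i q (t + k *: delta_mx 0 b)) 0 (fun q => rpartial b (cv g i q) t)
  (fun q => Ck_rpartial (b := b) (t := t) (Cv q)) .
have := is_rderiveM Dw (DP _).
have -> : t + 0 *: delta_mx 0 b = t by rewrite scale0r addr0.
move=> /(_ (fun q j => cv_neq i q j ut)).
set X := _ + _; set Y := \sum_q dA q t * _.
suff -> : X = Y by [].
rewrite /X /Y /dA.
under [RHS]eq_bigr do rewrite mulrDl.
rewrite big_split/= -mulrA mulr_suml mulr_sumr; congr (_ + _); apply: eq_bigr => q _.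
  by rewrite /form_coef; ring.
by rewrite mulrA.
Qed.

(** The integral over a face of the sum over [r] of the (M-1)-forms. Of the cofactor sign only the
    row part stays inside; the column part depends on the position of the face and is left to the
    orientation sign. Hence the value depends only on the map and the branch carried by the face. *)
Definition face_integral (a : 'I_(cf_size D) * 'I_M * bool) : R[i] :=
  \sum_(r < M) cube_integral (fun t => (-1) ^+ r *
    (form_coef a.1.1 r (face a.1.2 a.2 t) *
     \det (row' r (col' a.1.2 (jac_ a.1.1 (face a.1.2 a.2 t)))))).

Lemma face_cvg b k (f : 'rV[R]_M -> R[i]) t : unit_cube t ->
  (forall u, unit_cube u -> f @ within cube (nbhs u) --> f u) ->
  (fun u => f (face b k u)) @ within (@unit_cube R M.-1) (nbhs t) --> f (face b k t).
Proof.
move=> ut cf A nA.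
have K : nbhs (face b k t) (fun u => cube u -> A (f u)) := cf _ (face_cube b k ut) A nA.
have K2 : nbhs t (fun u => cube (face b k u) -> A (f (face b k u))) := @continuous_face R M b k t _ K.
change (nbhs t (fun u => unit_cube u -> A (f (face b k u)))).
by apply: filterS K2 => u H uu; apply: H; exact: face_cube.
Qed.

Lemma face_term_sign i r b k :
  cube_integral (fun t => form_coef i r (face b k t) * cofactor (jac_ i (face b k t)) r b) =
  (-1) ^+ b * cube_integral (fun t => (-1) ^+ r *
    (form_coef i r (face b k t) * \det (row' r (col' b (jac_ i (face b k t)))))).
Proof.
set f := fun t => (-1) ^+ r * _.
have Cv q : Ck 2 (cv (D := D) g i q) by exact: (Ck_cv Dc Gg).
have fE t : f t = (-1) ^+ b * (form_coef i r (face b k t) * cofactor (jac_ i (face b k t)) r b).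
  rewrite /f /cofactor exprD [RHS]mulrC.
  transitivity ((-1) ^+ r * (form_coef i r (face b k t) * \det (row' r (col' b (jac_ i (face b k t))))) * ((-1) ^+ b * (-1) ^+ b)).
    by rewrite -exprD addnn -mul2n exprM sqrrN !expr1n mulr1.
  by ring.
have cf : {within @unit_cube R M.-1, continuous f}.
  rewrite (funext fE); apply/subspace_continuousP => t ut.
  apply: cvgcM; first exact: cvg_cst.
  have H1 := @face_cvg b k (form_coef i r) t ut (fun u uu => @form_coef_cvg i r u uu).
  have HC (u : 'rV[R]_M) : unit_cube u -> (fun u => cofactor (jac_ i u) r b) @ within cube (nbhs u) --> cofactor (jac_ i u) r b.
    by move=> uu; apply: cvg_within_filter; exact: (continuous_cofactor Cv).
  have H2 := @face_cvg b k (fun u => cofactor (jac_ i u) r b) t ut HC.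
  exact: (cvgcM _ H1 H2).
have := @cube_integral_sum R M.-1 unit [:: tt] (fun=> (-1) ^+ b) (fun=> f) (fun=> cf).
rewrite big_seq1 => <-; apply: eq_cube_integral => t ut.
have sq : (-1) ^+ b * (-1) ^+ b = 1 :> R[i] by rewrite -exprD addnn -mul2n exprM sqrrN !expr1n.
by rewrite big_seq1 fE [RHS]mulrA sq mul1r.
Qed.

(** The map ignores one face coordinate, so a column of every minor vanishes. *)
Lemma degenerate_face_integral a : degenerate_face g a -> face_integral a = 0.
Proof.
case: a => [[i b] k] /= [c0 H]; rewrite /face_integral big1// => r _ /=.
have c0E : cube_integral (fun _ : 'rV[R]_M.-1 => 0) = 0 :> R[i].
  have c00 (i0 : unit) : {within @unit_cube R M.-1, continuous (fun _ : 'rV[R]_M.-1 => 0 : R[i])}.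
    by apply/subspace_continuousP => t ut; exact: cvg_cst.
  have := @cube_integral_sum R M.-1 unit [::] (fun=> 0) (fun=> fun=> 0) c00.
  by rewrite !big_nil.
rewrite -[RHS]c0E; apply: eq_cube_integral => t ut.
rewrite (expand_det_col _ c0) big1 ?mulr0// => q _.
rewrite !mxE.
have Cv : Ck 2 (cv (D := D) g i (lift r q)) by exact: (Ck_cv Dc Gg).
have Dq := Ck_rpartial (b := lift b c0) (t := face b k t) Cv.
rewrite (rpartial_cube_eq (c := c0) ut Dq (is_rderive_cst (cv g i (lift r q) (face b k t)) 0)) ?mul0r//.
  by rewrite scale0r addr0.
move=> h uh; rewrite -face_add /cv; congr (fun_of_matrix _ _ _); apply: H => // c cc.
by rewrite !mxE (negbTE cc) andbF mulr0 addr0.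
Qed.

Lemma same_face_integral a a' : same_face (@weight R N M hbar s Lgg D) g a a' ->
  face_integral a = face_integral a'.
Proof.
case: a a' => [[i b] k] [[i' b'] k'] /= H; rewrite /face_integral; apply: eq_bigr => r _ /=.
apply: eq_cube_integral => t ut; congr (_ * (_ * _)).
  have [H1 H2] := H t ut; rewrite /form_coef /cw H2; congr (_ * Pf _ _ _ _ _ _ _).
  by apply/funext => q; rewrite /cv H1.
congr (\det _); apply/matrixP => q c; rewrite !mxE.
have Cv j q' : Ck 2 (cv (D := D) g j q') by exact: (Ck_cv Dc Gg).
apply: (rpartial_cube_eq (c := c) ut (Ck_rpartial (b := lift b c) (t := face b k t) (Cv i (lift r q)))
  (Ck_rpartial (b := lift b' c) (t := face b' k' t) (Cv i' (lift r q)))).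
  by rewrite !scale0r !addr0 /cv; have [-> _] := H t ut.
by move=> h uh; rewrite -!face_add /cv; have [-> _] := H _ uh.
Qed.

(** Stokes on each cube leaves an oriented sum over faces. Faces related by [same_face] have equal
    integrals, and on each class the oriented multiplicities cancel by [ac_closed] unless the face
    is degenerate. *)
Lemma cycle_form_integral :
  \sum_(i < cf_size D) (cf_mult i)%:~R * \sum_(r < M)
    cube_integral (fun t => kap hbar s g i r t * form_coef i r t * \det (jac_ i t)) = 0.
Proof.
(* The orientation signs are those of [twisted_closed]. They give the end [true] a minus sign while
   Stokes gives it a plus sign, hence the overall minus in front of the sum. *)
pose m (a : 'I_(cf_size D) * 'I_M * bool) : R[i] := ((-1) ^+ (a.1.2 + a.2) * cf_mult a.1.1)%:~R.
transitivity (- \sum_a m a * face_integral a); last first.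
  pose e0 a b := `[< same_face (@weight R N M hbar s Lgg D) g a b >].
  rewrite (@sum_class_eq0 _ _ e0) ?oppr0//.
  - by move=> [[i b] k]; apply/asboolP.
  - move=> [[i b] k] [[i' b'] k']; apply/asboolP/asboolP => H t ut; have [h1 h2] := H t ut; by rewrite h1 h2.
  - move=> [[i b] k] [[i' b'] k'] [[i2 b2] k2] /asboolP H /asboolP H'; apply/asboolP => t ut.
    by have [h1 h2] := H t ut; have [h3 h4] := H' t ut; rewrite -h1 -h2 in h3 h4 *; split; congruence.
  - by move=> a b /asboolP; exact: same_face_integral.
  - move=> a; have [da|nda] := pselect (degenerate_face g a).
      by left; exact: degenerate_face_integral.
    right; rewrite /m -rmorph_sum/=.
    by rewrite (ac_closed Dc Gg nda).
have -> : \sum_a m a * face_integral a = \sum_(i < cf_size D) \sum_(b < M) \sum_(k : bool) m (i, b, k) * face_integral (i, b, k).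
  rewrite (pair_bigA _ (fun i b => \sum_(k : bool) m (i, b, k) * face_integral (i, b, k)))/=.
  rewrite (pair_bigA _ (fun p k => m (p.1, p.2, k) * face_integral (p.1, p.2, k)))/=.
  by apply: eq_bigr => -[[i b] k].
rewrite -sumrN; apply: eq_bigr => i _.
under eq_bigr do rewrite stokes_form.
rewrite exchange_big/= mulr_sumr -sumrN; apply: eq_bigr => b _.
pose X (r : 'I_M) (k : bool) := cube_integral (fun t => (-1) ^+ r *
  (form_coef i r (face b k t) * \det (row' r (col' b (jac_ i (face b k t)))))).
have -> : \sum_(r < M) (cube_integral (fun t => form_coef i r (face b true t) * cofactor (jac_ i (face b true t)) r b) -
    cube_integral (fun t => form_coef i r (face b false t) * cofactor (jac_ i (face b false t)) r b)) =
    \sum_(r < M) (-1) ^+ b * (X r true - X r false).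
  apply: eq_bigr => r _; rewrite [RHS]mulrBr.
  exact: (congr2 (fun x y => x - y) (face_term_sign i r b true) (face_term_sign i r b false)).
have fi (k : bool) : face_integral (i, b, k) = \sum_r X r k by [].
have mE (k : bool) : m (i, b, k) = (-1) ^+ b * (-1) ^+ k * (cf_mult i)%:~R.
  by rewrite /m rmorphM rmorphXn rmorphN rmorph1 exprD.
rewrite big_bool (fi true) (fi false) (mE true) (mE false) expr1 expr0 -mulr_sumr sumrB.
have alg (x y z u : R[i]) : y * (x * (z - u)) = - (x * -1 * y * z + x * 1 * y * u) by ring.
exact: alg.
Qed.

End stokes_cycle.

Lemma dfwith_id (I : eqType) (X : I -> Type) (x : forall i, X i) i : dfwith x i (x i) = x.
Proof.
apply: functional_extensionality_dep => k.
by case: (dfwithP x (x i) k).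
Qed.

Lemma s_inftyE (R : realType) (N M : nat) (s : 'I_N -> int) :
  (s_infty M s)%:~R = (2 * M)%:R + \sum_j (s j)%:~R :> R[i].
Proof.
rewrite /s_infty mulrzDr; congr (_ + _).
by elim/big_rec2: _ => [|j x y _ <-]; rewrite ?mulr0z ?mulrzDr.
Qed.

Lemma form_sum_scale (K : fieldType) (I : finType) (W J c x : K) (b p : I -> K) : x != 0 ->
  W * J * (c * - \sum_r b r * p r) = \sum_r c / x * (- x * b r * (W * p r) * J).
Proof.
move=> x0; rewrite mulrN mulrN -mulNr !mulr_sumr; apply: eq_bigr => r _.
by field.
Qed.

(** * Total weight and total lowering operator on the solution *)

Section weights.
Context {R : realType} {N : nat} {F : real_form} {s : 'I_N -> int}
  {rep : forall j, lowest_weight_module R F (s j)} (T : tensor_rep rep).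

Definition lin_h (j : 'I_N) : {linear T -> T} := tp_lift T (lwm_h (rep j)).
Definition lin_e (j : 'I_N) : {linear T -> T} := tp_lift T (lwm_e (rep j)).
Definition lin_f (j : 'I_N) : {linear T -> T} := tp_lift T (lwm_f (rep j)).

Let sC (j : 'I_N) : R[i] := (s j)%:~R.

(** The sign relating the adjoint of [e] to [f] in the chosen real form; carrying it treats both
    groups at once. *)
Definition form_sign : R[i] := if F is SU11 then -1 else 1.

Lemma form_sign_sq : form_sign * form_sign = 1.
Proof. by rewrite /form_sign; case: F; rewrite ?mulrNN mul1r. Qed.

Lemma lin_e_adj j u w : tp_dot T (lin_e j u) w = form_sign * tp_dot T u (lin_f j w).
Proof.
apply: tp_lift_adj => x y; rewrite lwm_e_adj /form_sign; case: F rep x y => r x y.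
  by rewrite linearNr mulN1r.
by rewrite mul1r.
Qed.

Lemma lin_f_adj j u w : tp_dot T (lin_f j u) w = form_sign * tp_dot T u (lin_e j w).
Proof.
have E : tp_dot T w (lin_f j u) = form_sign * tp_dot T (lin_e j w) u.
  by rewrite lin_e_adj mulrA form_sign_sq mul1r.
have E2 : Num.conj (tp_dot T (lin_e j w) u) = tp_dot T u (lin_e j w) := esym (dot_conj (tp_dot T) u (lin_e j w)).
rewrite (dot_conj _ (lin_f j u)) E rmorphM/= E2; congr (_ * _).
by rewrite /form_sign; case: F; rewrite ?rmorphN rmorph1.
Qed.

Lemma lin_h_adj j u w : tp_dot T (lin_h j u) w = tp_dot T u (lin_h j w).
Proof.
rewrite -[RHS]mul1r; apply: tp_lift_adj => x y; by rewrite mul1r lwm_h_adj.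
Qed.

Lemma lin_ee j k u : lin_e j (lin_e k u) = lin_e k (lin_e j u).
Proof. by have [->//|jk] := eqVneq j k; exact: tp_lift_comm. Qed.

Lemma lin_he j k u : lin_h j (lin_e k u) = lin_e k (lin_h j u) + (2 * (j == k)%:R) *: lin_e k u.
Proof.
have [->|jk] := eqVneq j k; last by rewrite mulr0 scale0r addr0; exact: tp_lift_comm.
rewrite mulr1; apply: tp_lift_rel => w.
by rewrite -lwm_he addrC subrK.
Qed.

Lemma lin_fe j k u : lin_f j (lin_e k u) = lin_e k (lin_f j u) - (j == k)%:R *: lin_h k u.
Proof.
have [->|jk] := eqVneq j k; last by rewrite scale0r subr0; exact: tp_lift_comm.
rewrite -scaleNr; apply: tp_lift_rel => w.
by rewrite scaleN1r -lwm_ef opprB addrC subrK.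
Qed.

Lemma lin_f_vac j : lin_f j (vacuum T) = 0.
Proof. by rewrite /lin_f /vacuum tp_lift_pure lwm_f_vac tp_pure0. Qed.

Lemma lin_h_vac j : lin_h j (vacuum T) = sC j *: vacuum T.
Proof. by rewrite /lin_h /vacuum tp_lift_pure lwm_h_vac tp_pureZ dfwith_id. Qed.

Lemma Omega_sym j k (u : T) : j != k -> Omega j k u = Omega k j u.
Proof.
move=> jk; rewrite /Omega /op_h /op_e /op_f.
rewrite (tp_lift_comm (lwm_h (rep j)) (lwm_h (rep k)) u jk).
rewrite (tp_lift_comm (lwm_f (rep j)) (lwm_e (rep k)) u jk).
rewrite (tp_lift_comm (lwm_e (rep j)) (lwm_f (rep k)) u jk).
by rewrite -!addrA; congr (_ + _); rewrite addrC.
Qed.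

Lemma Omega_diag j (u : T) : Omega j j u = (sC j * (sC j - 2) / 2) *: (u : T).
Proof.
have dD (x y z : T) : tp_dot T (x + y) z = tp_dot T x z + tp_dot T y z by rewrite linearDl.
have dZ a (x z : T) : tp_dot T (a *: x) z = a * tp_dot T x z by rewrite linearZl_LR.
rewrite /Omega /op_h /op_e /op_f; move: u; apply: tp_ext.
- move=> a u w; rewrite !(linearP (tp_lift T (lwm_h (rep j)))) !(linearP (tp_lift T (lwm_e (rep j)))) !(linearP (tp_lift T (lwm_f (rep j)))).
  rewrite !(linearP (tp_lift T (lwm_e (rep j)))).
  by apply: (dot_ext (d := tp_dot T)) => z; rewrite !(dD, dZ); ring.
- by move=> a u w; rewrite scalerDr !scalerA mulrC.
move=> x; rewrite !tp_lift_pure2 -tp_pureZ -!tp_pureD lwm_casimir tp_pureZ dfwith_id //.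
Qed.

Lemma Omega_total (u : T) m : tot lin_f u = 0 -> tot lin_h u = m *: u ->
  \sum_j \sum_k Omega j k u = (m * (m - 2) / 2) *: u.
Proof.
move=> fu hu; apply: (tot_Omega (e := lin_e) (f := lin_f) (h := lin_h)) => //.
exact: lin_fe.
Qed.

Lemma bethe_vectorE M (g : 'rV[R[i]]_N) (v : 'rV[R[i]]_M) :
  bethe_vector T g v = gen_vec lin_e (vacuum T) (fun j => g 0 j) (fun r => v 0 r) (enum 'I_M).
Proof. by []. Qed.

Section integral.
Context {hbar : R} {M : nat} {G : set 'rV[R[i]]_N}
  {Lgg : 'I_N -> 'I_N -> 'rV[R[i]]_N -> R[i]} {D : contour_family R N M}.
Hypothesis hbar0 : hbar != 0.
Hypothesis Dc : admissible_cycle hbar s G Lgg D.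
Variable Phi : 'rV[R[i]]_N -> T.
Hypothesis PhiI : contour_integral_form hbar G Lgg D Phi.
Variable g : 'rV[R[i]]_N.
Hypothesis Gg : G g.

Lemma ihbar_neq0 : 'i * hbar%:C != 0 :> R[i].
Proof.
rewrite mulf_eq0 negb_or; apply/andP; split.
  by rewrite eq_complex/= oner_eq0 andbF.
by rewrite (_ : 0 = 0%:C) // (inj_eq (@complexI R)).
Qed.

(** Here the exponents of the weight meet the commutation relations. *)
Lemma kapE (i : 'I_(cf_size D)) r t : kap hbar s g i r t =
  - ('i * hbar%:C) * bethe_coef sC (fun j => g 0 j) (fun q => cv g i q t) (enum 'I_M) r.
Proof.
rewrite /kap /bethe_coef big_enum_cond /= mulrDr addrC !mulr_sumr; congr (_ + _).
  apply: eq_bigr => j _; rewrite -/(sC j) -[cv g i r t - g 0 j]opprB invrN.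
  move: ('i * hbar%:C) (sC j) ((g 0 j - cv g i r t)^-1) => x y z; ring.
apply: eq_big => [p|p _]; first by [].
move: hbar%:C ((cv g i r t - cv g i p t)^-1) => x z; move: ('i : R[i]) => y; ring.
Qed.

(** By adjointness the total lowering operator acts on the Bethe vector. [tot_f_gen_vec] and [kapE]
    turn the integrand into the total derivatives of [cycle_form_integral]. *)
Lemma weak_tot_e psi : tp_dot T (Phi g) (tot lin_e psi) = 0.
Proof.
rewrite (PhiI Gg).
(* [form_sign] comes from passing to the adjoint, the inverse of ['i * hbar] from replacing
   [bethe_coef] by [kap]; [hbar] must therefore be nonzero. *)
pose c := form_sign / ('i * hbar%:C).
pose fc := form_coef hbar s Lgg g (tp_dot T) lin_e (vacuum T) psi (D := D).
pose K i r t := kap hbar s g i r t * fc i r t * \det (jac (cv (D := D) g i) t).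
have Cv i q : Ck 2 (cv (D := D) g i q) by exact: (Ck_cv Dc Gg).
have cK i r : {within @unit_cube R M, continuous (K i r)}.
  apply/subspace_continuousP => t ut; apply: cvgcM.
    by apply: cvgcM; [exact: (kap_cvg Dc Gg)|exact: (form_coef_cvg Dc Gg lin_e_adj)].
  by apply: cvg_within_filter; exact: (continuous_det (Cv i)).
have KE (i : 'I_(cf_size D)) t : unit_cube t ->
   weight hbar s Lgg i (g, t) * Defs.jacobian i g t * tp_dot T (bethe_vector T g (cf_map i (g, t))) (tot lin_e psi) =
   \sum_(r < M) c * K i r t.
  move=> ut.
  have -> : tp_dot T (bethe_vector T g (cf_map i (g, t))) (tot lin_e psi) =
      form_sign * tp_dot T (tot lin_f (bethe_vector T g (cf_map i (g, t)))) psi.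
    rewrite /tot linear_sumlz/= linear_sumr/= mulr_sumr; apply: eq_bigr => j _.
    by rewrite lin_f_adj mulrA form_sign_sq mul1r.
  pose b r := bethe_coef sC (fun j => g 0 j) (fun q => cv g i q t) (enum 'I_M) r.
  pose p r := Pf (tp_dot T) lin_e (vacuum T) (fun j => g 0 j) (rest r) psi (fun q => cv g i q t).
  have -> : tp_dot T (tot lin_f (bethe_vector T g (cf_map i (g, t)))) psi = - \sum_(r < M) b r * p r.
    rewrite bethe_vectorE (@tot_f_gen_vec _ _ _ _ lin_e lin_f lin_h _ sC lin_ee lin_he lin_fe lin_f_vac lin_h_vac).
    - rewrite linearNl/= linear_sumlz/= big_enum; congr (- _); apply: eq_bigr => r _.
      by rewrite linearZl_LR.
    - by move=> r j; exact: (@ac_avoids_gv _ _ _ _ _ _ _ _ Dc i g t r j Gg ut).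
    - exact: enum_uniq.
    - move=> r q _ _ /eqP rq; apply/eqP; apply: contraTT rq => rq.
      exact: (@ac_avoids_vv _ _ _ _ _ _ _ _ Dc i g t r q Gg ut rq).
  apply: (etrans (form_sum_scale _ _ _ b p ihbar_neq0)); apply: eq_bigr => r _.
  by rewrite /K kapE.
transitivity (\sum_(i < cf_size D) (cf_mult i)%:~R * (c * \sum_(r < M) cube_integral (K i r))).
  apply: eq_bigr => i _; congr (_ * _).
  rewrite (eq_cube_integral (KE i)) mulr_sumr.
  exact: (@cube_integral_sum R M _ (index_enum 'I_M) (fun=> c) (K i) (cK i)).
under eq_bigr do rewrite mulrCA.
rewrite -mulr_sumr; apply: (etrans (congr1 (fun z => c * z) _) (mulr0 c)).
exact: (cycle_form_integral Dc Gg (vacuum T) lin_e_adj psi).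
Qed.

Lemma tot_f_integral : tot lin_f (Phi g) = 0.
Proof.
apply: (dot_ext (d := tp_dot T)) => psi; rewrite linear0l.
have -> : tp_dot T (tot lin_f (Phi g)) psi = form_sign * tp_dot T (Phi g) (tot lin_e psi).
  rewrite /tot linear_sumlz linear_sumr mulr_sumr; apply: eq_bigr => j _.
  exact: lin_f_adj.
by rewrite weak_tot_e mulr0.
Qed.

(** The Bethe vector is already an eigenvector at each point of the cycle, so linearity of the
    integral is enough. *)
Lemma tot_h_integral : tot lin_h (Phi g) = (s_infty M s)%:~R *: Phi g.
Proof.
apply: (dot_ext (d := tp_dot T)) => psi; rewrite linearZl_LR.
have totH (u : T) : tp_dot T (tot lin_h u) psi = tp_dot T u (tot lin_h psi).
  rewrite /tot linear_sumlz linear_sumr; apply: eq_bigr => j _; exact: lin_h_adj.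
have dZ a (u : T) : tp_dot T (a *: u) psi = a * tp_dot T u psi by rewrite linearZl_LR.
rewrite totH; apply: (etrans (PhiI Gg (tot lin_h psi))).
apply: (etrans _ (congr1 (fun z => (s_infty M s)%:~R * z) (esym (PhiI Gg psi)))).
rewrite mulr_sumr; apply: eq_bigr => i _.
rewrite mulrCA; congr (_ * _).
set m : R[i] := (s_infty M s)%:~R.
pose X t := weight hbar s Lgg i (g, t) * Defs.jacobian i g t * tp_dot T (bethe_vector T g (cf_map i (g, t))) psi.
have Cv q : Ck 2 (cv (D := D) g i q) by exact: (Ck_cv Dc Gg).
have cX : {within @unit_cube R M, continuous X}.
  apply/subspace_continuousP => t ut; apply: cvgcM.
    apply: cvgcM; first exact: (cw_cvg Dc Gg).
    by apply: cvg_within_filter; exact: (continuous_det Cv).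
  apply: (@Pf_cvg _ _ _ _ (tp_dot T) lin_e lin_f (vacuum T) (fun j => g 0 j) form_sign lin_e_adj _ _ _
    (enum 'I_M) psi (fun u q => cf_map i (g, u) 0 q) (fun q => cf_map i (g, t) 0 q)) => [q|q j].
    exact: (cv_cvg Dc Gg).
  exact: (@ac_avoids_gv _ _ _ _ _ _ _ _ Dc i g t q j Gg ut).
have := @cube_integral_sum R M unit [:: tt] (fun=> m) (fun=> X) (fun=> cX).
rewrite big_seq1 => <-; apply: eq_cube_integral => t ut; rewrite big_seq1 /X.
rewrite -totH bethe_vectorE (@tot_h_gen_vec _ _ _ _ lin_e lin_h _ sC lin_he lin_h_vac) dZ.
have e : (2 * M)%:R + \sum_j sC j = m by rewrite /m s_inftyE.
rewrite size_enum_ord e.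
by rewrite mulrCA.
Qed.

End integral.

End weights.

(** * The function gamma and its derivative along real paths *)

Section gamma.
Context {R : realType}.

Lemma sqrtC_real (x : R) : 0 <= x -> sqrtC (x%:C) = (Num.sqrt x)%:C :> R[i].
Proof.
move=> x0; have s0 : 0 <= (Num.sqrt x)%:C :> R[i] by rewrite ler0c sqrtr_ge0.
by rewrite -[in LHS](sqr_sqrtr x0) rmorphXn sqrCK.
Qed.

Definition sgn_root (br : bool) (w x y : R) : R :=
  (-1) ^+ br * Num.sqrt ((w - x) ^+ 2 + y ^+ 2).

Lemma sgn_root_sq br w x y : sgn_root br w x y ^+ 2 = (w - x) ^+ 2 + y ^+ 2.
Proof.
rewrite /sgn_root exprMn -exprM mulnC exprM sqrrN !expr1n mul1r sqr_sqrtr//.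
by rewrite addr_ge0 ?sqr_ge0.
Qed.

Lemma sgn_root_neq0 br w x y : y != 0 -> sgn_root br w x y != 0.
Proof.
move=> y0; rewrite -sqrf_eq0 sgn_root_sq paddr_eq0 ?sqr_ge0//.
by rewrite negb_and [in X in _ || X]sqrf_eq0 y0 orbT.
Qed.

Lemma i_neq0 : 'i != 0 :> R[i].
Proof. by rewrite eq_complex/= oner_eq0 andbF. Qed.

Lemma real_complex_neq0 (y : R) : y != 0 -> y%:C != 0 :> R[i].
Proof. by move=> y0; rewrite (_ : 0 = 0%:C) // (inj_eq (@complexI R)). Qed.

Lemma realCD (x y : R) : (x + y)%:C = x%:C + y%:C :> R[i].
Proof. exact: rmorphD. Qed.

Lemma realCN (x : R) : (- x)%:C = - x%:C :> R[i].
Proof. exact: rmorphN. Qed.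

Lemma realCM (x y : R) : (x * y)%:C = x%:C * y%:C :> R[i].
Proof. exact: rmorphM. Qed.

Lemma realCV (x : R) : (x^-1)%:C = (x%:C)^-1 :> R[i].
Proof. exact: fmorphV. Qed.

Lemma subr_conjC (z : R[i]) : z - z^* = 2 * ('i * (complex.Im z)%:C).
Proof. by case: z => x y; apply/eqP; rewrite eq_complex /=; apply/andP; split; apply/eqP; ring. Qed.

Lemma gammaE br w (z : R[i]) :
  gamma br w z = (w - complex.Re z + sgn_root br w (complex.Re z) (complex.Im z))%:C /
    ('i * (complex.Im z)%:C).
Proof.
rewrite /gamma subr_conjC; case: z => x y /=.
have -> : (w%:C - (x +i* y)) * (w%:C - (x +i* y)^*) = ((w - x) ^+ 2 + y ^+ 2)%:C.
  by apply/eqP; rewrite eq_complex /=; apply/andP; split; apply/eqP; ring.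
rewrite sqrtC_real ?addr_ge0 ?sqr_ge0//.
rewrite (_ : (-1) ^+ br * (Num.sqrt ((w - x) ^+ 2 + y ^+ 2))%:C = (sgn_root br w x y)%:C); last first.
  by rewrite /sgn_root rmorphM rmorphXn rmorphN rmorph1.
rewrite (_ : (x +i* y) + (x +i* y)^* = 2 * x%:C); last first.
  by apply/eqP; rewrite eq_complex /=; apply/andP; split; apply/eqP; ring.
rewrite !realCD realCN; move: ('i * y%:C) => P.
have [->|P0] := eqVneq P 0; first by rewrite !mulr0 !invr0 !mulr0 mul0r.
by move: (sgn_root br w x y)%:C w%:C x%:C => S W X; field.
Qed.

Lemma is_rderive_real (f : R -> R) (p f' : R) : is_derive p 1 f f' ->
  is_rderive (fun q => (f q)%:C) p f'%:C.
Proof.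
move=> /is_deriveP H; apply/is_rderiveP; split => //=.
by rewrite (_ : (fun h : R => _) = fun=> 0); [exact: cvg_cst|apply/funext => h; rewrite subrr mulr0].
Qed.

Section path.
Variables (br : bool) (f g : R -> R) (p f' g' : R).
Hypotheses (g0 : g p != 0) (df : is_derive p 1 f f') (dg : is_derive p 1 g g').

(** The square root and [gamma] along a path, with [f] for w - Re xi and [g] for Im xi. A moving xi
    with fixed w and a moving w with fixed xi are both instances. *)
Definition Sp (q : R) : R := (-1) ^+ br * Num.sqrt (f q ^+ 2 + g q ^+ 2).

Definition Gp (q : R) : R[i] := (f q + Sp q)%:C / ('i * (g q)%:C).

Lemma Sp_sq q : Sp q ^+ 2 = f q ^+ 2 + g q ^+ 2.
Proof.
rewrite /Sp exprMn -exprM mulnC exprM sqrrN !expr1n mul1r sqr_sqrtr//.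
by rewrite addr_ge0 ?sqr_ge0.
Qed.

Lemma Sp_neq0 : Sp p != 0.
Proof.
rewrite -sqrf_eq0 Sp_sq paddr_eq0 ?sqr_ge0//.
by rewrite negb_and [in X in _ || X]sqrf_eq0 g0 orbT.
Qed.

Lemma is_derive_Sp : is_derive p 1 Sp ((f p * f' + g p * g') / Sp p).
Proof.
have q0 : 0 < f p * f p + g p * g p.
  by rewrite -!expr2 ltr_wpDl ?sqr_ge0// lt_def sqrf_eq0 g0 sqr_ge0.
have dq := is_deriveD (is_deriveM df df) (is_deriveM dg dg).
have ds := @is_derive1_comp _ Num.sqrt (f * f + g * g) p _ _ (is_derive1_sqrt q0) dq.
have D := is_deriveM (is_derive_cst ((-1) ^+ br : R) p (1 : R)) ds.
apply: is_derive_eq D _.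
have S0 : Num.sqrt (f p * f p + g p * g p) != 0 by rewrite gt_eqF// sqrtr_gt0.
rewrite /Sp !expr2.
have E : (Num.sqrt \o (f * f + g * g)) p = Num.sqrt (f p * f p + g p * g p) by [].
have alg (e s a b c d : R) : e * e = 1 -> s != 0 -> e * ((2 * s)^-1 * (a * b + a * b + (c * d + c * d))) + s * 0 =
   (a * b + c * d) / (e * s).
  move=> ee s0; have e0 : e != 0 by apply/eqP => e0; move: ee; rewrite e0 mul0r => /eqP; rewrite eq_sym oner_eq0.
  have -> : (a * b + c * d) / (e * s) = e * e * ((a * b + c * d) / (e * s)) by rewrite ee mul1r.
  by field; rewrite e0 s0.
apply: alg => //; by rewrite -expr2 -exprM mulnC exprM sqrrN !expr1n.
Qed.

Let DC : R[i] := (f p)%:C.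
Let SC : R[i] := (Sp p)%:C.
Let P : R[i] := 'i * (g p)%:C.

Lemma P_neq0 : P != 0.
Proof. by rewrite mulf_neq0 ?i_neq0 ?real_complex_neq0. Qed.

Lemma SC_neq0 : SC != 0.
Proof. exact: real_complex_neq0 Sp_neq0. Qed.

Lemma GpE : Gp p = (DC + SC) / P.
Proof. by rewrite /Gp rmorphD. Qed.

Let S' : R[i] := (DC * f'%:C + (g p)%:C * g'%:C) / SC.

Lemma Gp_rderive : is_rderive Gp p ((f'%:C + S') / P - Gp p * ('i * g'%:C) / P).
Proof.
have DS := is_rderive_real is_derive_Sp.
have D1 := is_rderiveD (is_rderive_real df) DS.
have D2 := is_rderiveV P_neq0 (is_rderiveM (is_rderive_cst ('i : R[i]) p) (is_rderive_real dg)).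
have := is_rderiveM D1 D2.
rewrite mul0r add0r -/P -/DC -/SC.
have -> : ((f p * f' + g p * g') / Sp p)%:C = S' by rewrite /S' /DC /SC realCM realCV realCD !realCM.
rewrite GpE => H.
have -> : (f'%:C + S') / P - (DC + SC) / P * ('i * g'%:C) / P =
  (f'%:C + S') * P^-1 + (DC + SC) * (- ('i * g'%:C) / P ^+ 2).
  have := P_neq0; move: P S' DC SC ('i * g'%:C) (f'%:C : R[i]) => a b c d k l a0; by field.
by apply: eq_is_rderive H => q; rewrite /Gp rmorphD.
Qed.

(** The quotient is dgamma/dw, see [dgamma_dwE], so this provides the derivative of the
    prefactors. *)
Lemma GpS_rderive G' : is_rderive Gp p G' ->
  is_rderive (fun q => Gp q / (Sp q)%:C) p (G' / SC - Gp p * S' / SC ^+ 2).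
Proof.
move=> DG.
have DS := @is_rderiveV _ (fun q => (Sp q)%:C) p _ SC_neq0 (is_rderive_real is_derive_Sp).
have := is_rderiveM DG DS.
have -> : ((f p * f' + g p * g') / Sp p)%:C = S' by rewrite /S' /DC /SC realCM realCV realCD !realCM.
by rewrite -/SC mulrA mulrN mulNr.
Qed.

End path.

End gamma.

(** * Symmetrization of the Knizhnik-Zamolodchikov sum and the chain rule *)

(** Since a (1 + a) / (1 - a) = - a - 2 + 2 / (1 - a), its divided difference is 2 / ((1 - a) (1 -
    b)) - 1. Twice the off-diagonal sum therefore has these coefficients. Completing it by the
    diagonal costs the terms with [kap], and the constant -1 over all pairs costs [Kt]. *)
Lemma kz_sum (K : numFieldType) (V : lmodType K) (N : nat) (a : 'I_N -> K)
    (om : 'I_N -> 'I_N -> V) (u : V) (kap : 'I_N -> K) (Kt : K) :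
  (forall j k, j != k -> om j k = om k j) -> (forall j, om j j = kap j *: u) ->
  \sum_j \sum_k om j k = Kt *: u -> (forall j k, j != k -> a j != a k) ->
  (forall j, a j != 1) ->
  \sum_j (a j * (1 + a j) / (1 - a j)) *: (\sum_(k | k != j) (a j - a k)^-1 *: om j k) +
    (Kt / 2 + \sum_j kap j * ((1 - a j) ^- 2 - 2^-1)) *: u =
  \sum_j \sum_k ((1 - a j) * (1 - a k))^-1 *: om j k.
Proof.
move=> sym diag totE inj a1.
pose fa j := a j * (1 + a j) / (1 - a j).
pose X := \sum_j \sum_(k | k != j) (fa j / (a j - a k)) *: om j k.
have n2 : 2%:R != 0 :> K by rewrite pnatr_eq0.
have d1 j : 1 - a j != 0 by rewrite subr_eq0 eq_sym.
have XE : \sum_j (fa j) *: (\sum_(k | k != j) (a j - a k)^-1 *: om j k) = X.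
  by apply: eq_bigr => j _; rewrite scaler_sumr; apply: eq_bigr => k _; rewrite scalerA.
have Xsym : X = \sum_j \sum_(k | k != j) (- fa k / (a j - a k)) *: om j k.
  rewrite /X (exchange_big_dep predT)//=; apply: eq_bigr => j _.
  apply: eq_big => [k|k kj]; first by rewrite eq_sym.
  rewrite sym 1?eq_sym//; congr (_ *: _); rewrite -[a k - a j]opprB invrN mulrN mulNr //.
have X2 : X + X = \sum_j \sum_(k | k != j) (2 * ((1 - a j) * (1 - a k))^-1 - 1) *: om j k.
  rewrite {2}Xsym /X -big_split; apply: eq_bigr => j _; rewrite -big_split; apply: eq_bigr => k kj /=.
  rewrite -scalerDl; congr (_ *: _); rewrite /fa.
  have jk : a j - a k != 0 by rewrite subr_eq0 inj// eq_sym.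
  by field; rewrite jk !d1.
pose Y := \sum_j \sum_k ((1 - a j) * (1 - a k))^-1 *: om j k.
have Y2 : \sum_j \sum_(k | k != j) (2 * ((1 - a j) * (1 - a k))^-1 - 1) *: om j k =
    2%:R *: Y - Kt *: u - (\sum_j kap j * (2 * (1 - a j) ^- 2 - 1)) *: u.
  rewrite -totE /Y scaler_sumr -sumrB scaler_suml -sumrB; apply: eq_bigr => j _.
  rewrite scaler_sumr -sumrB [X in _ = X - _](bigD1 j)//= diag.
  have E : 2%:R *: (((1 - a j) * (1 - a j))^-1 *: (kap j *: u)) - kap j *: u =
      (kap j * (2 * (1 - a j) ^- 2 - 1)) *: u.
    by rewrite !scalerA -scalerBl; congr (_ *: _); field; rewrite d1.
  rewrite E addrAC subrr add0r.
  by apply: eq_bigr => k kj; rewrite scalerBl scale1r scalerA.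
rewrite -/fa XE -/Y; apply: (scalerI n2).
rewrite scalerDr scaler_nat mulr2n X2 Y2 scalerA.
have -> : 2 * (Kt / 2 + \sum_j kap j * ((1 - a j) ^- 2 - 2^-1)) =
    Kt + \sum_j kap j * (2 * (1 - a j) ^- 2 - 1).
  rewrite mulrDr mulr_sumr; congr (_ + _); first by field.
  by apply: eq_bigr => j _; field; rewrite d1.
have gen (x p q : V) : x - p - q + (p + q) = x by rewrite -[x - p - q]addrA -opprD subrK.
by rewrite [(Kt + _) *: u]scalerDl; exact: gen.
Qed.

(** A complex differentiable map along a path with a real parameter. The difference quotient is the
    differential at the quotient [Q h], which converges, plus the rescaled Taylor remainder, which
    tends to zero because [Q h] stays bounded. *)
Lemma is_rderive_chain (R : realType) (N : nat) (T : normedModType R[i])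
    (Phi : 'rV[R[i]]_N -> T) (gr : R -> 'rV[R[i]]_N) (v : 'I_N -> R[i]) :
  differentiable Phi (gr 0) ->
  (forall j, is_rderive (fun h => gr h 0 j) 0 (v j)) ->
  is_rderive (fun h => Phi (gr h)) 0 (\sum_j v j *: 'D_(delta_mx 0 j) Phi (gr 0)).
Proof.
move=> dPhi dgr; set g := gr 0.
pose V0 : 'rV[R[i]]_N := \row_j v j.
pose Q (h : R) : 'rV[R[i]]_N := (h%:C)^-1 *: (gr h - g).
have cQ : Q @ 0^' --> V0.
  move=> A [B nB BA].
  have : \forall h \near 0^', forall j, B 0 j (Q h 0 j).
    apply: filter_forall => j.
    have C : (fun h : R => Q h 0 j) @ 0^' --> (V0 0 j : R[i]).
      rewrite mxE; have := dgr j; rewrite /is_rderive; apply: cvg_trans; apply: near_eq_cvg.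
      by near=> h; rewrite !mxE add0r.
    exact: C (nB 0 j).
  rewrite /=; apply: filterS => h H; apply: BA => i j; rewrite (ord1 i); exact: H.
have [cd /eqaddoP lo] := (diff_locallyP _ _).1 dPhi.
have cdQ : (fun h => 'd Phi g (Q h)) @ 0^' --> 'd Phi g V0.
  by apply: continuous_cvg => //; exact: cd.
have -> : \sum_j v j *: 'D_(delta_mx 0 j) Phi g = 'd Phi g V0.
  rewrite [V0]row_sum_delta linear_sum; apply: eq_bigr => j _.
  by rewrite linearZ/= mxE deriveE.
pose r h := Phi (gr h) - Phi g - 'd Phi g (gr h - g).
have h0 : \forall h \near (0 : R)^', h%:C != 0 :> R[i].
  by near=> h; apply: real_complex_neq0; near: h; exact: nbhs_dnbhs_neq.
have h00 : (fun h : R => h%:C) @ 0^' --> (0 : R[i]).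
  apply/cvg_complexP; split; last exact: cvg_cst.
  by apply: cvg_within_filter; exact: cvg_id.
have d0 : (fun h => gr h - g) @ 0^' --> (0 : 'rV[R[i]]_N).
  rewrite -(scale0r V0).
  have H : (fun h => h%:C *: Q h) @ 0^' --> 0 *: V0 by apply: cvgcZ.
  apply: cvg_trans H; apply: near_eq_cvg.
  by near=> h; rewrite /Q scalerA mulfV ?scale1r//; near: h.
have r0 : (fun h => (h%:C)^-1 *: r h) @ 0^' --> (0 : T).
  apply/cvgr0Pnorm_lt => e e0.
  have K0 : 0 < `|V0| + 1 by rewrite ltr_wpDl.
  have e1 : 0 < e / (2 * (`|V0| + 1)) by rewrite divr_gt0// mulr_gt0.
  have /d0 lo1 := lo _ e1.
  have bQ : \forall h \near 0^', `|Q h| < `|V0| + 1.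
    have /cvgr_norm_lt := cQ; apply; by rewrite ltrDl.
  have rE h : (Phi \o shift g - (cst (Phi g) + 'd Phi g)) (gr h - g) = r h.
    by rewrite /r !fctE /= subrK opprD addrA.
  near=> h.
  have hn0 : h%:C != 0 :> R[i] by near: h.
  have L1 : `|r h| <= e / (2 * (`|V0| + 1)) * `|gr h - g| by rewrite -rE; near: h.
  have L2 : `|Q h| < `|V0| + 1 by near: h.
  rewrite normrZ normfV.
  have gQ : `|gr h - g| = `|h%:C| * `|Q h| by rewrite -normrZ /Q scalerA mulfV ?scale1r.
  have hp : 0 < `|h%:C : R[i]| by rewrite normr_gt0.
  rewrite mulrC ltr_pdivrMr//; apply: le_lt_trans L1 _; rewrite gQ mulrCA [ltRHS]mulrC ltr_pM2l//.
  rewrite -mulrA gtr_pMr// mulrC ltr_pdivrMr ?mulr_gt0// mul1r.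
  apply: lt_le_trans L2 _; by rewrite ler_peMl ?ler1n// ltW.
have S0 : (fun h => 'd Phi g (Q h) + (h%:C)^-1 *: r h) @ 0^' --> 'd Phi g V0.
  by rewrite -[X in _ --> X]addr0; apply: cvgvD; [exact: cdQ|exact: r0].
rewrite /is_rderive; apply: cvg_trans S0; apply: near_eq_cvg; near=> h.
rewrite add0r -/g /r /Q.
have dZ a x : 'd Phi g (a *: x) = a *: 'd Phi g x by rewrite linearZ.
by rewrite dZ -scalerDr addrC subrK.
Unshelve. all: by end_near. Qed.

(** * Wirtinger derivatives of gamma, dgamma/dw and xi - xibar as rational identities *)

Section log_derivatives.
Variables (K : fieldType) (I D S P y g : K).

(** Here [D] is w - x, [S] the square root, [y] is rho, [P] is i rho and [g] is gamma; [(X, Y)] is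
    the velocity of (x, rho). [dS] and [dG] are derivatives of [S] and [g]; [dE] and [dl] are the
    logarithmic derivatives of [g / S], which is dgamma/dw, and of xi - xibar. *)
Definition dS (X Y : K) : K := (D * - X + y * Y) / S.
Definition dG (X Y : K) : K := (- X + dS X Y) / P - g * (I * Y) / P.
Definition dE (X Y : K) : K := (dG X Y / S - g * dS X Y / S ^+ 2) / (g / S).
Definition dl (X Y : K) : K := I * Y / P.

Hypotheses (n2 : 2%:R != 0 :> K) (II : I * I = -1) (PE : P = I * y) (P0 : P != 0) (S0 : S != 0)
  (SS : S ^+ 2 = D ^+ 2 - P ^+ 2) (gE : g = (D + S) / P).

Lemma g_neq0 : g != 0.
Proof.
apply/eqP => g0; have : (D + S) * (D - S) = P ^+ 2.
  by rewrite -[RHS]opprK -(addKr (D ^+ 2) (- P ^+ 2)) -SS; ring.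
have -> : D + S = g * P by rewrite gE divfK.
by rewrite g0 !mul0r => /esym/eqP; rewrite sqrf_eq0 (negbTE P0).
Qed.

Lemma DBS : D - S = P / g.
Proof.
have H : (D + S) * (D - S) = P ^+ 2.
  by rewrite -[RHS]opprK -(addKr (D ^+ 2) (- P ^+ 2)) -SS; ring.
have DS : D + S = g * P by rewrite gE divfK.
move: H; rewrite DS => H; apply: (mulfI (mulf_neq0 g_neq0 P0)); rewrite H.
by field; rewrite g_neq0.
Qed.

(** D + S = g P and D - S = P / g: the quadratic relation for the root is uniformized by gamma, so
    that [D] and [S] become rational in [g] and [P]. *)
Lemma S_g : S = P * (g - g^-1) / 2.
Proof.
have DS : D + S = g * P by rewrite gE divfK.
have -> : P * (g - g^-1) / 2 = (g * P - P / g) / 2 by rewrite mulrBr [g * P]mulrC.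
by rewrite -DS -DBS; field.
Qed.

Lemma D_g : D = P * (g + g^-1) / 2.
Proof.
have DS : D + S = g * P by rewrite gE divfK.
have -> : P * (g + g^-1) / 2 = (g * P + P / g) / 2 by rewrite mulrDr [g * P]mulrC.
by rewrite -DS -DBS; field.
Qed.

Lemma g2_neq1 : g ^+ 2 - 1 != 0.
Proof.
apply: contraNneq S0 => g2; rewrite S_g; have -> : g - g^-1 = (g ^+ 2 - 1) / g by field; exact: g_neq0.
by rewrite g2 mul0r mulr0 mul0r.
Qed.

Lemma g_neq1 : g != 1.
Proof. by apply: contraNneq g2_neq1 => ->; rewrite expr1n subrr. Qed.

Lemma g_neqN1 : g != -1.
Proof. by apply: contraNneq g2_neq1 => ->; rewrite sqrrN expr1n subrr. Qed.

Lemma dG10 : dG 1 0 = - g / S.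
Proof. by rewrite /dG /dS gE; field; rewrite S0 P0. Qed.

Lemma dG01 : I * dG 0 1 = S^-1 + g / P.
Proof.
rewrite /dG /dS (_ : I * _ = I * y / (S * P) - I * I * g / P); last by field; rewrite S0 P0.
by rewrite -PE II; field; rewrite S0 P0.
Qed.

Lemma dE10 : dE 1 0 = - S^-1 + D / S ^+ 2.
Proof. by rewrite /dE dG10 /dS; field; rewrite S0 g_neq0. Qed.

Lemma dE01 : I * dE 0 1 = (g * S)^-1 + P^-1 - P / S ^+ 2.
Proof.
have -> : I * dE 0 1 = ((I * dG 0 1) / S - g * (I * y) / S ^+ 3) / (g / S).
  by rewrite /dE /dS; move: (dG 0 1) g_neq0 => x g0; field; rewrite S0 g0.
by rewrite dG01 -PE; field; rewrite S0 P0 g_neq0.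
Qed.

(** The sign [e] selects the operator: [1] for d/dxi, [-1] for d/dxibar. With 2 P = xi - xibar these
    are the two defining differential equations of gamma, uniform in [e * g]. *)
Lemma dG_half e : (e == 1) || (e == -1) ->
  2^-1 * (dG 1 0 - e * (I * dG 0 1)) = (e * g) * (1 + e * g) / (1 - e * g) / (2 * P).
Proof.
move=> ee; rewrite dG01 dG10 S_g.
have g0 := g_neq0; have g2 := g2_neq1.
have g1 : 1 - g != 0 by rewrite subr_eq0 eq_sym g_neq1.
have g1' : 1 + g != 0 by rewrite addrC -[1]opprK subr_eq0 g_neqN1.
have -> : g - g^-1 = - (1 - g) * (1 + g) / g by field.
have {ee} [->|->] : e = 1 \/ e = -1 by case/orP: ee => /eqP; [left|right].
  by rewrite !mul1r; field; rewrite ?oppr_eq0 n2 P0 g0 g1 g1'.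
by rewrite !mulN1r !opprK; field; rewrite ?oppr_eq0 n2 P0 g0 g1 g1'.
Qed.

(** The value is the one obtained by differentiating the equation of [dG_half] in w: F(a) = a (1 +
    a) / (1 - a) has derivative 2 / (1 - a)^2 - 1, evaluated at [e * g]. *)
Lemma dE_half e : (e == 1) || (e == -1) ->
  2^-1 * (dE 1 0 - e * (I * dE 0 1)) = e / (2 * P) * (2 * (1 - e * g) ^- 2 - 1).
Proof.
move=> ee; rewrite dE01 dE10 D_g S_g.
have g0 := g_neq0; have g2 := g2_neq1.
have g1 : 1 - g != 0 by rewrite subr_eq0 eq_sym g_neq1.
have g1' : 1 + g != 0 by rewrite addrC -[1]opprK subr_eq0 g_neqN1.
have -> : g - g^-1 = - (1 - g) * (1 + g) / g by field.
have {ee} [->|->] : e = 1 \/ e = -1 by case/orP: ee => /eqP; [left|right].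
  by rewrite !mul1r; field; rewrite ?oppr_eq0 n2 P0 g0 g1 g1'.
by rewrite !mulN1r !opprK; field; rewrite ?oppr_eq0 n2 P0 g0 g1 g1'.
Qed.

Lemma dl_half e : 2^-1 * (dl 1 0 - e * (I * dl 0 1)) = e / (2 * P).
Proof.
rewrite /dl; transitivity (- (I * I) * e / (2 * P)); last by rewrite II opprK mul1r.
by field; rewrite ?n2 ?P0.
Qed.

End log_derivatives.

(** With [q] for i hbar, the exponents - (q / 2) times a Casimir value make the logarithmic
    derivatives of the prefactors equal to the constant and diagonal terms of [kz_sum], under the
    same factor as the Knizhnik-Zamolodchikov terms. The substitution of [e * gam] for [gam] covers
    both equations. *)
Lemma wdw_combine (K : numFieldType) (V : lmodType K) (N : nat)
  (gam gX gY EX EY kap : 'I_N -> K) (lX lY Kt P q I e pre : K)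
  (om : 'I_N -> 'I_N -> V) (u : V) (dP : 'I_N -> V) :
  (e == 1) || (e == -1) -> P != 0 ->
  (forall j, 2^-1 * (gX j - e * (I * gY j)) =
     (e * gam j) * (1 + e * gam j) / (1 - e * gam j) / (2 * P)) ->
  (forall j, 2^-1 * (EX j - e * (I * EY j)) = e / (2 * P) * (2 * (1 - e * gam j) ^- 2 - 1)) ->
  2^-1 * (lX - e * (I * lY)) = e / (2 * P) ->
  (forall j, dP j = - q *: \sum_(k | k != j) (gam j - gam k)^-1 *: om j k) ->
  (forall j k, j != k -> om j k = om k j) -> (forall j, om j j = kap j *: u) ->
  \sum_j \sum_k om j k = Kt *: u -> (forall j k, j != k -> gam j != gam k) ->
  (forall j, gam j != 1) -> (forall j, gam j != -1) ->
  2^-1 *: ((pre *: \sum_j gX j *: dP j +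
      ((- (q / 2) * Kt * lX + \sum_j - (q / 2) * kap j * EX j) * pre) *: u) -
    e *: (I *: (pre *: \sum_j gY j *: dP j +
      ((- (q / 2) * Kt * lY + \sum_j - (q / 2) * kap j * EY j) * pre) *: u))) =
  (- q * e / (2 * P) * pre) *:
    \sum_j \sum_k ((1 - e * gam j) * (1 - e * gam k))^-1 *: om j k.
Proof.
move=> ee P0 gXY EXY lXY dPE sym diag totE inj g1 gN1.
have n2 : 2%:R != 0 :> K by rewrite pnatr_eq0.
have e0 : e != 0 by case/orP: ee => /eqP ->; rewrite ?oppr_eq0 oner_eq0.
have eV : e^-1 = e by case/orP: ee => /eqP ->; rewrite ?invrN invr1.
have eg1 j : e * gam j != 1.
  case/orP: ee => /eqP ->; rewrite ?mul1r// mulN1r; apply: contraNneq (gN1 j) => <-.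
  by rewrite opprK.
have eginj j k : j != k -> e * gam j != e * gam k by move=> /inj; rewrite (inj_eq (mulfI e0)).
have KZ := kz_sum sym diag totE eginj eg1.
set A := \sum_j gX j *: dP j; set B := \sum_j gY j *: dP j.
set lx := - (q / 2) * Kt * lX + _; set ly := - (q / 2) * Kt * lY + _.
have -> : 2^-1 *: ((pre *: A + (lx * pre) *: u) - e *: (I *: (pre *: B + (ly * pre) *: u))) =
    pre *: (2^-1 *: (A - e *: (I *: B)) + (2^-1 * (lx - e * (I * ly))) *: u).
  rewrite [I *: (_ + _)]scalerDr [e *: (_ + _)]scalerDr opprD addrACA.
  rewrite [2^-1 *: (_ + _)]scalerDr [pre *: (_ + _)]scalerDr; congr (_ + _).
    rewrite !scalerBr !scalerA; congr (_ *: _ - _ *: _); move: (2^-1 : K) => h; ring.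
  rewrite !scalerA -scalerBl !scalerA; congr (_ *: _); move: (2^-1 : K) => h; ring.
have -> : 2^-1 *: (A - e *: (I *: B)) =
    (- q * e / (2 * P)) *: \sum_j (e * gam j * (1 + e * gam j) / (1 - e * gam j)) *:
      (\sum_(k | k != j) (e * gam j - e * gam k)^-1 *: om j k).
  rewrite /A /B !scaler_sumr -sumrB scaler_sumr; apply: eq_bigr => j _.
  have -> : 2^-1 *: (gX j *: dP j - e *: (I *: (gY j *: dP j))) =
      (2^-1 * (gX j - e * (I * gY j))) *: dP j.
    by rewrite !scalerA -scalerBl scalerA -!mulrA.
  rewrite gXY dPE; set x := _ / (1 - _).
  have -> : \sum_(k | k != j) (e * gam j - e * gam k)^-1 *: om j k =
      e *: \sum_(k | k != j) (gam j - gam k)^-1 *: om j k.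
    rewrite scaler_sumr; apply: eq_bigr => k _.
    by rewrite scalerA -mulrBr invfM eV.
  rewrite !scalerA; congr (_ *: _).
  have ee1 : e * e = 1 by rewrite -{1}eV mulVf.
  transitivity (- q * x / (2 * P) * (e * e)); first by rewrite ee1 mulr1; field; rewrite P0.
  by field; rewrite P0.
have -> : 2^-1 * (lx - e * (I * ly)) = - q * e / (2 * P) *
    (Kt / 2 + \sum_j kap j * ((1 - e * gam j) ^- 2 - 2^-1)).
  have sE : 2^-1 * (\sum_j - (q / 2) * kap j * EX j - e * (I * \sum_j - (q / 2) * kap j * EY j)) =
      \sum_j - q * e / (2 * P) * (kap j * ((1 - e * gam j) ^- 2 - 2^-1)).
    rewrite !mulr_sumr -sumrB mulr_sumr; apply: eq_bigr => j _.
    transitivity (- (q / 2) * kap j * (2^-1 * (EX j - e * (I * EY j)))); first by field.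
    by rewrite EXY; move: (eg1 j) => g1j; field; rewrite P0 subr_eq0 eq_sym g1j.
  rewrite [RHS]mulrDr [X in _ = _ + X]mulr_sumr -sE /lx /ly.
  have -> : - q * e / (2 * P) * (Kt / 2) = - (q / 2) * Kt * (2^-1 * (lX - e * (I * lY))).
    by rewrite lXY; field; rewrite P0.
  move: (\sum_j - (q / 2) * kap j * EX j) (\sum_j - (q / 2) * kap j * EY j) (2^-1 : K) => a b h; ring.
by rewrite -[(_ * (Kt / 2 + _)) *: u]scalerA -scalerDr KZ scalerA [pre * _]mulrC.
Qed.

(** * The derivative of the state along a path in the upper half plane *)

Section wdw.
Context {R : realType}.

Definition sgn_rootC (br : bool) (w : R) (z : R[i]) : R[i] :=
  (sgn_root br w (complex.Re z) (complex.Im z))%:C.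

(** The path formula with w as parameter: the root has derivative f / S, so gamma has derivative (1
    + f / S) / P, which is gamma / S. *)
Lemma dgamma_dwE br w (z : R[i]) : complex.Im z != 0 ->
  dgamma_dw br w z = gamma br w z / sgn_rootC br w z.
Proof.
move=> z0; pose f (q : R) := q - complex.Re z; pose k (q : R) := complex.Im z.
have df : is_derive w 1 f 1.
  have := is_deriveB (is_derive_id w (1 : R)) (is_derive_cst (complex.Re z) w (1 : R)).
  by rewrite subr0.
have dk : is_derive w 1 k 0 by exact: is_derive_cst.
have D0 := @Gp_rderive _ br f k w 1 0 z0 df dk.
have D1 : is_rderive (fun w' => gamma br w' z) w
    ((1%:C + ((f w)%:C * 1%:C + (k w)%:C * 0%:C) / (Sp br f k w)%:C) / ('i * (k w)%:C) -
      Gp br f k w * ('i * 0%:C) / ('i * (k w)%:C)).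
  by apply: (@eq_is_rderive _ R[i]) D0 => q; rewrite gammaE.
rewrite /dgamma_dw (rderiveE D1) /sgn_rootC gammaE.
have S0 := @SC_neq0 _ br f k w z0.
have P0 := @P_neq0 _ k w z0.
rewrite -[sgn_root _ _ _ _]/(Sp br f k w) -[w - _]/(f w) realCD -[complex.Im z]/(k w).
rewrite !mulr0 mul0r subr0 addr0 !mulr1.
move: ('i * (k w)%:C) (f w)%:C (Sp br f k w)%:C P0 S0 => P a S P0 S0.
by field; rewrite P0 S0.
Qed.

Section path.
Context {N M : nat} {F : real_form} {s : 'I_N -> int}
  {rep : forall j, lowest_weight_module R F (s j)} (T : tensor_rep rep).
Variables (hbar : R) (Phi : 'rV[R[i]]_N -> T) (w : 'I_N -> R) (br : 'I_N -> bool)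
  (U : set R[i]) (Lxi : R[i] -> R[i]) (Lgw : 'I_N -> R[i] -> R[i]).
Hypotheses (U_open : open U) (U_upper : forall xi, U xi -> 0 < complex.Im xi)
  (Lxi_branch : log_branch U (fun xi => xi - xi^*) Lxi)
  (Lgw_branch : forall j : 'I_N, log_branch U (dgamma_dw (br j) (w j)) (Lgw j)).
Variables (z : R -> R[i]) (x' y' : R).
Hypotheses (dre : is_derive (0 : R) (1 : R) (fun q => complex.Re (z q)) x')
  (dim : is_derive (0 : R) (1 : R) (fun q => complex.Im (z q)) y') (Uz : U (z 0)).

Let xi := z 0.
Let y : R[i] := (complex.Im xi)%:C.
Let P : R[i] := 'i * y.
Let Dj (j : 'I_N) : R[i] := (w j - complex.Re xi)%:C.
Let Sj (j : 'I_N) : R[i] := sgn_rootC (br j) (w j) xi.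
Let gj (j : 'I_N) : R[i] := gamma (br j) (w j) xi.
Let X : R[i] := x'%:C.
Let Y : R[i] := y'%:C.

Let y0 : complex.Im xi != 0.
Proof. by rewrite gt_eqF// U_upper. Qed.

Let z_rderive : is_rderive z 0 (X + 'i * Y).
Proof.
apply/is_rderiveP; split.
  by rewrite [complex.Re (_ + _)](_ : _ = x'); [apply/is_deriveP|rewrite /=; ring].
by rewrite [complex.Im (_ + _)](_ : _ = y'); [apply/is_deriveP|rewrite /=; ring].
Qed.

Let z_cvg : (fun h => z (0 + h)) @ 0^' --> xi.
Proof. exact: is_rderive_cts z_rderive. Qed.

Let z_near : \forall h \near 0^', U (z (0 + h)).
Proof. by apply: z_cvg; apply: open_nbhs_nbhs; split. Qed.

Let log_cvg (L f : R[i] -> R[i]) : log_branch U f L ->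
  (fun h => L (z (0 + h))) @ 0^' --> L (z 0).
Proof.
move=> [/subspace_continuousP cL _] B /(cL _ Uz) nB.
have /z_cvg H : nbhs xi [set p | U p -> B (L p)] by exact: nB.
have : \forall h \near 0^', B (L (z (0 + h))) by apply: filterS2 z_near H => h Uh /(_ Uh).
exact.
Qed.

Lemma gamma_rderive j : is_rderive (fun h => gamma (br j) (w j) (z h)) 0
  (dG 'i (Dj j) (Sj j) P y (gj j) X Y).
Proof.
pose f q := w j - complex.Re (z q); pose k q := complex.Im (z q).
have df : is_derive (0 : R) (1 : R) f (- x').
  by have := is_deriveB (is_derive_cst (w j) (0 : R) (1 : R)) dre; rewrite sub0r.
have := @Gp_rderive _ (br j) f k 0 (- x') y' y0 df dim.
rewrite realCN (_ : Gp _ _ _ _ = gj j); last by rewrite /gj gammaE.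
by apply: (@eq_is_rderive _ R[i]) => q; rewrite gammaE.
Qed.

Lemma dgamma_rderive j : is_rderive (fun h => Lgw j (z h)) 0
  (dE 'i (Dj j) (Sj j) P y (gj j) X Y).
Proof.
pose f q := w j - complex.Re (z q); pose k q := complex.Im (z q).
have df : is_derive (0 : R) (1 : R) f (- x').
  by have := is_deriveB (is_derive_cst (w j) (0 : R) (1 : R)) dre; rewrite sub0r.
have D1 := @Gp_rderive _ (br j) f k 0 (- x') y' y0 df dim.
have D2 := @GpS_rderive _ (br j) f k 0 (- x') y' y0 df dim _ D1.
have GE q : Gp (br j) f k q / (Sp (br j) f k q)%:C =
    gamma (br j) (w j) (z q) / sgn_rootC (br j) (w j) (z q) by rewrite gammaE.
have LE q : U (z q) -> cexp (Lgw j (z q)) = Gp (br j) f k q / (Sp (br j) f k q)%:C.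
  by move=> Uq; rewrite (Lgw_branch j).2// dgamma_dwE ?GE// gt_eqF// U_upper.
have := @is_rderive_log _ (fun h => Lgw j (z h)) (fun q => Gp (br j) f k q / (Sp (br j) f k q)%:C) 0 _
  (log_cvg (Lgw_branch j)) (LE _ Uz) _ D2.
rewrite realCN (_ : Gp _ _ _ 0 = gj j); last by rewrite /gj gammaE.
apply; near=> h; apply: LE; near: h; exact: z_near.
Unshelve. all: by end_near. Qed.

Lemma log_xi_rderive : is_rderive (fun h => Lxi (z h)) 0 (dl 'i P X Y).
Proof.
have D1 := is_rderiveM (is_rderive_cst (2 * 'i : R[i]) 0) (is_rderive_real dim).
have LE q : U (z q) -> cexp (Lxi (z q)) = 2 * 'i * (complex.Im (z q))%:C.
  by move=> Uq; rewrite Lxi_branch.2// subr_conjC mulrA.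
have := @is_rderive_log _ (fun h => Lxi (z h)) (fun q => 2 * 'i * (complex.Im (z q))%:C) 0 _
  (log_cvg Lxi_branch) (LE _ Uz) _ D1.
rewrite (_ : _ / _ = dl 'i P X Y).
  apply; near=> h; apply: LE; near: h; exact: z_near.
rewrite /dl /P /y mul0r add0r -/xi -/Y -[2 * 'i * Y]mulrA -[2 * 'i * _]mulrA -mulf_div divff ?mul1r//.
Unshelve. all: by end_near. Qed.

Lemma wdw_state_rderive : differentiable Phi (gamma_row br w xi) ->
  let pre := cexp (wdw_exponent hbar (s_infty M s) * Lxi xi) *
    \prod_(j < N) cexp (wdw_exponent hbar (s j) * Lgw j xi) in
  is_rderive (fun h => wdw_state M hbar br w Lxi Lgw Phi (z h)) 0
   (pre *: (\sum_j dG 'i (Dj j) (Sj j) P y (gj j) X Y *: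
        'D_(delta_mx 0 j) Phi (gamma_row br w xi)) +
     ((wdw_exponent hbar (s_infty M s) * dl 'i P X Y +
       \sum_j wdw_exponent hbar (s j) * dE 'i (Dj j) (Sj j) P y (gj j) X Y) * pre) *:
      Phi (gamma_row br w xi)).
Proof.
move=> dPhi pre.
have cexpL (c : R[i]) L l : is_rderive (fun h => L (z h)) 0 l ->
    is_rderive (fun h => cexp (c * L (z h))) 0 (c * l * cexp (c * L (z 0))).
  move=> DL; have D1 := is_rderiveM (is_rderive_cst c 0) DL.
  by have := is_rderive_cexp D1; rewrite mul0r add0r.
have DA := cexpL (wdw_exponent hbar (s_infty M s)) Lxi _ log_xi_rderive.
have DB := @is_rderive_prod _ _ (index_enum 'I_N) xpredT
  (fun j h => cexp (wdw_exponent hbar (s j) * Lgw j (z h))) 0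
  (fun j => wdw_exponent hbar (s j) * dE 'i (Dj j) (Sj j) P y (gj j) X Y)
  (fun j _ => cexpL (wdw_exponent hbar (s j)) (Lgw j) _ (@dgamma_rderive j)).
have Dpre := is_rderiveM DA DB.
have DPhi : is_rderive (fun h => Phi (gamma_row br w (z h))) 0
    (\sum_j dG 'i (Dj j) (Sj j) P y (gj j) X Y *:
        'D_(delta_mx 0 j) Phi (gamma_row br w xi)).
  have Dg j : is_rderive (fun h => gamma_row br w (z h) 0 j) 0
      (dG 'i (Dj j) (Sj j) P y (gj j) X Y).
    by apply: (@eq_is_rderive _ R[i]) (@gamma_rderive j) => q; rewrite mxE.
  exact: (@is_rderive_chain R N T Phi (fun h => gamma_row br w (z h)) _ dPhi Dg).
have := is_rderiveZ Dpre DPhi.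
rewrite (_ : (_ * _ + _) = (wdw_exponent hbar (s_infty M s) * dl 'i P X Y +
       \sum_j wdw_exponent hbar (s j) * dE 'i (Dj j) (Sj j) P y (gj j) X Y) * pre) //.
rewrite /pre -/xi; set a := \prod_j _; set b := \sum_j _; set c := cexp _.
move: (dl _ _ _ _) (wdw_exponent _ _) => d e; ring.
Qed.

End path.
End wdw.

(** The exponent as - i hbar / 2 times the Casimir eigenvalue, the form in which it meets
    [kz_sum]. *)
Lemma wdw_exponentE (R : realType) (hbar : R) (m : int) :
  wdw_exponent hbar m = - ('i * hbar%:C / 2) * (m%:~R * (m%:~R - 2) / 2).
Proof.
rewrite /wdw_exponent intrM intrB -[2%:~R]/(2 : R[i]).
by move: (m%:~R : R[i]) ('i * hbar%:C) => a b; field.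
Qed.

Lemma OmegaZ (R : realType) (N : nat) (F : real_form) (s : 'I_N -> int)
    (rep : forall j, lowest_weight_module R F (s j)) (T : tensor_rep rep) j k (c : R[i]) (u : T) :
  Omega j k (c *: u) = c *: Omega j k u.
Proof.
have lZ l (A : {linear rep l -> rep l}) a (v : T) : tp_lift T A (a *: v) = a *: tp_lift T A v.
  by have := linearP (tp_lift T A) a v 0; rewrite linear0 !addr0.
rewrite /Omega /op_h /op_f /op_e !lZ.
by rewrite !scalerDr !scalerA [2^-1 * c]mulrC.
Qed.

Lemma is_derive_shift (R : realType) (a : R) : is_derive (0 : R) (1 : R) (fun q => a + q) 1.
Proof.
by have := is_deriveD (is_derive_cst a (0 : R) (1 : R)) (is_derive_id (0 : R) (1 : R)); rewrite add0r.
Qed.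

Theorem theorem10 (R : realType) (hbar : R) (hbar_gt0 : 0 < hbar)
  (N M : nat) (F : real_form) (s : 'I_N -> int)
  (rep : forall j : 'I_N, lowest_weight_module R F (s j))
  (T : tensor_rep rep)
  (G : set 'rV[R[i]]_N) (G_open : open G)
  (G_distinct : forall g, G g -> forall j k : 'I_N, j != k -> g 0 j != g 0 k)
  (Lgg : 'I_N -> 'I_N -> 'rV[R[i]]_N -> R[i])
  (D : contour_family R N M) (D_cycle : admissible_cycle hbar s G Lgg D)
  (Phi_KZ : 'rV[R[i]]_N -> T)
  (Phi_KZ_integral : contour_integral_form hbar G Lgg D Phi_KZ)
  (Phi_KZ_solution : KZ_solution hbar G Phi_KZ)
  (w : 'I_N -> R) (w_distinct : injective w) (br : 'I_N -> bool)
  (U : set R[i]) (U_open : open U)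
  (U_upper : forall xi, U xi -> 0 < complex.Im xi)
  (U_gamma : forall xi, U xi -> G (gamma_row br w xi))
  (Lxi : R[i] -> R[i]) (Lxi_branch : log_branch U (fun xi => xi - xi^*) Lxi)
  (Lgw : 'I_N -> R[i] -> R[i])
  (Lgw_branch : forall j : 'I_N, log_branch U (dgamma_dw (br j) (w j)) (Lgw j)) :
  let Phi := wdw_state M hbar br w Lxi Lgw Phi_KZ in
  forall xi : R[i], U xi ->
    (exists dPhi : T, is_dxi Phi xi dPhi /\
       - ('i * hbar%:C) *: dPhi = H_xi hbar (gamma_row br w xi) xi (Phi xi)) /\
    (exists dPhi : T, is_dxibar Phi xi dPhi /\
       - ('i * hbar%:C) *: dPhi = H_xibar hbar (gamma_row br w xi) xi (Phi xi)).
Proof.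
move=> Phi xi Uxi.
set g := gamma_row br w xi.
have Gg : G g by exact: U_gamma.
have [dPhi KZ] := Phi_KZ_solution g Gg.
have hbar0 : hbar != 0 by rewrite gt_eqF.
pose y : R[i] := (complex.Im xi)%:C; pose P : R[i] := 'i * y.
pose Dj j : R[i] := (w j - complex.Re xi)%:C.
pose Sj j : R[i] := sgn_rootC (br j) (w j) xi.
pose m : R[i] := (s_infty M s)%:~R.
pose kp (j : 'I_N) : R[i] := (s j)%:~R * ((s j)%:~R - 2) / 2.
pose pre : R[i] := cexp (wdw_exponent hbar (s_infty M s) * Lxi xi) *
    \prod_(j < N) cexp (wdw_exponent hbar (s j) * Lgw j xi).
pose DX j : R[i] := dG 'i (Dj j) (Sj j) P y (g 0 j) 1 0.
pose DY j : R[i] := dG 'i (Dj j) (Sj j) P y (g 0 j) 0 1.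
pose EX j : R[i] := dE 'i (Dj j) (Sj j) P y (g 0 j) 1 0.
pose EY j : R[i] := dE 'i (Dj j) (Sj j) P y (g 0 j) 0 1.
pose dP j : T := 'D_(delta_mx 0 j) Phi_KZ g.
pose val (dGj dEj : 'I_N -> R[i]) (l : R[i]) : T := pre *: (\sum_j dGj j *: dP j) +
  ((- ('i * hbar%:C / 2) * (m * (m - 2) / 2) * l +
    \sum_j - ('i * hbar%:C / 2) * kp j * dEj j) * pre) *: Phi_KZ g.
have gE j : g 0 j = gamma (br j) (w j) xi by rewrite mxE.
(* One formula for all directions; the two coordinate lines used by [is_dxi] and [is_dxibar] are the
   velocities (1, 0) and (0, 1). *)
have path (z : R -> R[i]) x' y' : z 0 = xi ->
    is_derive (0 : R) (1 : R) (fun q => complex.Re (z q)) x' ->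
    is_derive (0 : R) (1 : R) (fun q => complex.Im (z q)) y' ->
    is_rderive (fun h => Phi (z h)) 0
      (val (fun j => dG 'i (Dj j) (Sj j) P y (g 0 j) x'%:C y'%:C)
        (fun j => dE 'i (Dj j) (Sj j) P y (g 0 j) x'%:C y'%:C) (dl 'i P x'%:C y'%:C)).
  move=> z0 dre dim; have Uz : U (z 0) by rewrite z0.
  have dz : differentiable Phi_KZ (gamma_row br w (z 0)) by rewrite z0.
  have := @wdw_state_rderive _ N M F s rep T hbar Phi_KZ w br U Lxi Lgw U_open U_upper Lxi_branch
    Lgw_branch z x' y' dre dim Uz dz.
  rewrite /= z0 -/g -/pre; set L := (X in is_rderive _ _ X -> _) => H.
  rewrite (_ : val _ _ _ = L); first exact: H.
  rewrite /L /val; congr (_ *: _ + ((_ + _) * _) *: _).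
  - by apply: eq_bigr => j _; rewrite gE.
  - by rewrite wdw_exponentE.
  - by apply: eq_bigr => j _; rewrite wdw_exponentE gE.
have dX : is_rderive (fun x : R => Phi (xi + x%:C)) 0 (val DX EX (dl 'i P 1 0)).
  apply: (path (fun q => xi + q%:C) 1 0); first by rewrite (_ : 0%:C = 0) ?addr0.
    by rewrite (_ : (fun q => _) = (fun q => complex.Re xi + q)); [exact: is_derive_shift|apply/funext => q; case: (xi)].
  rewrite (_ : (fun q => _) = (fun=> complex.Im xi)); first exact: is_derive_cst.
  by apply/funext => q; case: (xi) => a b /=; rewrite addr0.
have dY : is_rderive (fun x : R => Phi (xi + 'i * x%:C)) 0 (val DY EY (dl 'i P 0 1)).
  apply: (path (fun q => xi + 'i * q%:C) 0 1); first by rewrite (_ : 0%:C = 0) ?mulr0 ?addr0.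
    rewrite (_ : (fun q => _) = (fun=> complex.Re xi)); first exact: is_derive_cst.
    by apply/funext => q; case: (xi) => a b /=; ring.
  rewrite (_ : (fun q => _) = (fun q => complex.Im xi + q)); first exact: is_derive_shift.
  by apply/funext => q; case: (xi) => a b /=; ring.
have n2 : 2%:R != 0 :> R[i] by rewrite pnatr_eq0.
have II : 'i * 'i = -1 :> R[i] by rewrite -expr2 sqr_i.
have y0 : complex.Im xi != 0 by rewrite gt_eqF// U_upper.
have P0 : P != 0 by rewrite mulf_neq0 ?i_neq0 ?real_complex_neq0.
have Sp0 j : Sj j != 0 by rewrite real_complex_neq0// sgn_root_neq0.
have SS j : Sj j ^+ 2 = Dj j ^+ 2 - P ^+ 2.
  have -> : P ^+ 2 = - (y * y) by rewrite /P expr2 mulrACA II mulN1r.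
  by rewrite /Sj /sgn_rootC expr2 -realCM -expr2 sgn_root_sq realCD !expr2 !realCM opprK.
have gDS j : g 0 j = (Dj j + Sj j) / P by rewrite gE gammaE realCD.
have ga1 j := g_neq1 n2 P0 (Sp0 j) (SS j) (gDS j).
have gaN1 j := g_neqN1 n2 P0 (Sp0 j) (SS j) (gDS j).
have fu : tot (lin_f T) (Phi_KZ g) = 0.
  exact: (tot_f_integral hbar0 D_cycle Phi_KZ_integral Gg).
have hu : tot (lin_h T) (Phi_KZ g) = m *: Phi_KZ g.
  by have := tot_h_integral D_cycle Phi_KZ_integral Gg; rewrite /m s_inftyE.
(* The xi equation is the case [e = 1], the xibar equation the case [e = -1]. *)
have main e : (e == 1) || (e == -1) ->
    2^-1 *: (val DX EX (dl 'i P 1 0) - e *: ('i *: val DY EY (dl 'i P 0 1))) =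
    (- ('i * hbar%:C) * e / (2 * P) * pre) *:
      \sum_j \sum_k ((1 - e * g 0 j) * (1 - e * g 0 k))^-1 *: Omega j k (Phi_KZ g).
  move=> ee; apply: (wdw_combine (P := P) (gam := fun j => g 0 j) (kap := kp)) => //.
  - by move=> j; exact: (dG_half n2 II erefl P0 (Sp0 j) (SS j) (gDS j) ee).
  - by move=> j; exact: (dE_half n2 II erefl P0 (Sp0 j) (SS j) (gDS j) ee).
  - exact: (dl_half n2 II P0).
  - by move=> j k jk; exact: Omega_sym.
  - by move=> j; exact: Omega_diag.
  - exact: Omega_total fu hu.
  - by move=> j k jk; exact: G_distinct.
have pull (c : 'I_N -> 'I_N -> R[i]) : \sum_j \sum_k c j k *: Omega j k (Phi xi) =
    pre *: \sum_j \sum_k c j k *: Omega j k (Phi_KZ g).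
  rewrite scaler_sumr; apply: eq_bigr => j _; rewrite scaler_sumr; apply: eq_bigr => k _.
  by rewrite /Phi /wdw_state OmegaZ !scalerA mulrC.
(* The factor - i hbar of the Knizhnik-Zamolodchikov equations meets the one on the left of the
   Wheeler-DeWitt equations; their product is - hbar^2, the origin of hbar^2 in the Hamiltonians. *)
have coef (c e q : R[i]) : - ('i * c) * (- ('i * c) * e / (2 * P) * q) = - e * (c ^+ 2 / (2 * P)) * q.
  transitivity ('i * 'i * c ^+ 2 * e / (2 * P) * q); first by move: ('i : R[i]) P0 => I P0; field.
  by rewrite II; field.
split.
  exists (2^-1 *: (val DX EX (dl 'i P 1 0) - 'i *: val DY EY (dl 'i P 0 1))); split.
    by exists (val DX EX (dl 'i P 1 0)), (val DY EY (dl 'i P 0 1)).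
  have := main 1; rewrite eqxx scale1r => -> //.
  rewrite /H_xi pull scalerA coef scalerA subr_conjC -/y -/P mulN1r.
  by congr (_ *: _); apply: eq_bigr => j _; apply: eq_bigr => k _; rewrite !mul1r.
exists (2^-1 *: (val DX EX (dl 'i P 1 0) + 'i *: val DY EY (dl 'i P 0 1))); split.
  by exists (val DX EX (dl 'i P 1 0)), (val DY EY (dl 'i P 0 1)).
have := main (-1); rewrite eqxx orbT scaleN1r opprK => -> //.
rewrite /H_xibar pull scalerA coef scalerA subr_conjC -/y -/P opprK mul1r.
by congr (_ *: _); apply: eq_bigr => j _; apply: eq_bigr => k _; rewrite !mulN1r !opprK.
Qed.
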